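(* Let $\Gamma$ be a Fuchsian group and $t_0\in\mathbb T$ with $\sum_{\gamma\in\Gamma}|\gamma'(t_0)|<\infty$ and $m'_{t_0}$ of bounded characteristic. Assume that the nontangential limits $\Delta_{t_0}(t_0)$, with $|\Delta_{t_0}(t_0)|=1$, and $\Delta'_{t_0}(t_0)$, finite, exist, that is, $\Delta_{t_0}(\zeta)=\Delta_{t_0}(t_0)+\Delta'_{t_0}(t_0)(\zeta-t_0)+o(\zeta-t_0)$ as $\zeta\to t_0$ nontangentially, and that $$ |t_0-\zeta|\sum_{\gamma\in\Gamma,\ \gamma\ne e}\frac{|\gamma'(t_0)|}{|\gamma(t_0)-\zeta|^2}=o(1) $$ as $\zeta\to t_0$ nontangentially. Then for every unitary character $\alpha$ of $\Gamma$ there exists an $\alpha$-automorphic function $g$ such that $g\in 1+(t-t_0)H^2$, i.e. $g(\zeta)=1+(\zeta-t_0)h(\zeta)$ with $h\in H^2$.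
   Context: $\mathbb D$ is the open unit disk, $\mathbb T$ the unit circle, $H^2$ the Hardy space of $\mathbb D$. A Fuchsian group $\Gamma$ is a discrete subgroup of the group of conformal automorphisms $\zeta\mapsto\frac{a\zeta+b}{\overline b\zeta+\overline a}$, $|a|^2-|b|^2=1$, of $\mathbb D$; $e$ is its identity. A unitary character of $\Gamma$ is a homomorphism $\alpha:\Gamma\to\mathbb T$. A function $f$ analytic on $\mathbb D$ is $\alpha$-automorphic if $f(\gamma(\zeta))=\alpha(\gamma)f(\zeta)$ for all $\gamma\in\Gamma$, $\zeta\in\mathbb D$. When $\sum_{\gamma\in\Gamma}|\gamma'(t_0)|<\infty$, the Martin function is $m_{t_0}(\zeta)=\frac i2\sum_{\gamma\in\Gamma}\frac{\gamma(t_0)+\zeta}{\gamma(t_0)-\zeta}|\gamma'(t_0)|$, so $m'_{t_0}(\zeta)=i t_0\sum_{\gamma\in\Gamma}\frac{\gamma'(t_0)}{(\gamma(t_0)-\zeta)^2}$, $\zeta\in\mathbb D$. A function is of bounded characteristic if it is a quotient of two bounded analytic functions on $\mathbb D$. When $m'_{t_0}$ is of bounded characteristic it factors as $m'_{t_0}=\Delta_{t_0}/\varphi$ with $\Delta_{t_0}$ inner and $\varphi$ outer, $|\varphi|\le4$; $\Delta_{t_0}$ is determined up to a unimodular constant and is fixed. *)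

(* Defs.v *)
From HB Require Import structures.
From mathcomp Require Import all_boot all_order all_algebra.
From mathcomp Require Import complex.
From mathcomp Require Import all_classical all_reals all_analysis.
From mathcomp Require summability.
Set Implicit Arguments.
Unset Strict Implicit.
Unset Printing Implicit Defensive.
Import Order.TTheory GRing.Theory Num.Theory.
Import numFieldNormedType.Exports.
Export numFieldNormedType.Exports.

Local Open Scope classical_set_scope.
Local Open Scope ring_scope.

(* The library puts the topology given by the norm on abstract fields only;
   this copies it onto the concrete type R[i]. *)
HB.instance Definition _ (R : rcfType) := NormedModule.copy R[i] R[i]^o.

Section Defs.
Context {R : realType}.
Local Notation C := R[i].
Local Notation mu := (@lebesgue_measure R).
Implicit Types (Gamma : set (C -> C)) (t : C) (alpha : (C -> C) -> C).

(* `|z| has type R[i]; this is the same modulus as a real number. *)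
Definition modulus (z : C) : R := Normc.normc z.

Definition disk : set C := [set z | `|z| < 1].

Definition expi (theta : R) : C := (cos theta +i* sin theta)%C.

Definition cexp (z : C) : C := (expR (complex.Re z))%:C%C * expi (complex.Im z).

Definition cint (f : R -> C) : C :=
  ((\int[mu]_(theta in `[0, 2 * pi]) complex.Re (f theta)) +i*
   (\int[mu]_(theta in `[0, 2 * pi]) complex.Im (f theta)))%C.

Definition analytic (f : C -> C) := forall z, disk z -> derivable f z 1.

(* Points tending to t within a Stolz angle; it is the trivial filter for
   M <= 1, so that quantifying over all M is harmless. *)
Definition stolz t (M : R) : set_system C :=
  within [set z | disk z /\ `|t - z| < M%:C%C * (1 - `|z|)] (nbhs t).

Definition nontangential_lim (f : C -> C) t (l : C) :=
  forall M : R, f z @[z --> stolz t M] --> l.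

Definition nontangential_expansion (f : C -> C) t (l0 l1 : C) :=
  nontangential_lim (fun z => (f z - (l0 + l1 * (z - t))) / (z - t)) t 0.

Definition bounded_analytic (f : C -> C) :=
  analytic f /\ exists M : R, forall z, disk z -> modulus (f z) <= M.

Definition bounded_characteristic (f : C -> C) :=
  exists f1 f2, [/\ bounded_analytic f1, bounded_analytic f2,
    (exists2 z, disk z & f2 z != 0) &
    forall z, disk z -> f z * f2 z = f1 z].

Definition inner (f : C -> C) :=
  [/\ analytic f, (forall z, disk z -> `|f z| <= 1) &
    {ae mu, forall theta, theta \in `[0, 2 * pi] ->
      exists2 l, nontangential_lim f (expi theta) l & `|l| = 1}].

(* k is the modulus of the boundary values of f on the circle. *)
Definition outer (f : C -> C) :=
  exists (c : C) (k : R -> R),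
    [/\ `|c| = 1, (forall theta, 0 < k theta),
      mu.-integrable `[0, 2 * pi] (fun theta => (ln (k theta))%:E) &
      forall z, disk z ->
        f z = c * cexp ((2 * pi)^-1%:C%C *
          cint (fun theta => (expi theta + z) / (expi theta - z) *
                             (ln (k theta))%:C%C))].

Definition hardy2 (h : C -> C) :=
  analytic h /\ exists M : R, forall r : R, 0 <= r < 1 ->
    (\int[mu]_(theta in `[0%R, (2 * pi)%R])
       (modulus (h (r%:C%C * expi theta)) ^+ 2)%:E <= M%:E)%E.

(* The value at the pole is the junk value 0.  The pole lies outside the
   closed disk when |a|^2 - |b|^2 = 1, and two such maps that agree on the
   disk are equal, so sets of them are sets of automorphisms of the disk. *)
Definition moebius (a b : C) : C -> C :=
  fun z => (a * z + b) / ((b^*)%C * z + (a^*)%C).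

Definition disk_aut_coefs : set (C * C) :=
  [set p | `|p.1| ^+ 2 - `|p.2| ^+ 2 = 1].

(* Group laws are required on the disk only, because of the junk value at the
   pole.  Automorphisms form SU(1,1) / {1, -1}; a subset is discrete there iff
   its inverse image in SU(1,1), a subspace of C * C, is. *)
Record fuchsian Gamma : Prop := {
  fuchsian_aut : forall gamma, Gamma gamma ->
    exists2 p, disk_aut_coefs p & gamma = moebius p.1 p.2;
  fuchsian_id : Gamma id;
  fuchsian_comp : forall gamma1 gamma2, Gamma gamma1 -> Gamma gamma2 ->
    exists2 gamma, Gamma gamma &
      forall z, disk z -> gamma z = gamma1 (gamma2 z);
  fuchsian_inv : forall gamma, Gamma gamma ->
    exists2 gamma', Gamma gamma' & forall z, disk z -> gamma' (gamma z) = z;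
  fuchsian_discrete :
    let G := disk_aut_coefs `&` [set p | Gamma (moebius p.1 p.2)] in
    G `<=` isolated G
}.

(* Only the restriction of alpha to Gamma matters. *)
Definition unitary_character Gamma alpha :=
  (forall gamma, Gamma gamma -> `|alpha gamma| = 1) /\
  (forall gamma1 gamma2 gamma, Gamma gamma1 -> Gamma gamma2 -> Gamma gamma ->
    (forall z, disk z -> gamma z = gamma1 (gamma2 z)) ->
    alpha gamma = alpha gamma1 * alpha gamma2).

Definition automorphic Gamma alpha (f : C -> C) :=
  analytic f /\ forall gamma z, Gamma gamma -> disk z ->
    f (gamma z) = alpha gamma * f z.

(* summability.sum is the unordered sum, i.e. the limit along finite subsets. *)
Definition martin Gamma t : C -> C := fun z =>
  'i%C / 2 * summability.sum (fun g : Gamma =>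
    let gamma := \val g in
    (gamma t + z) / (gamma t - z) * `|derive1 gamma t|).

Definition martin_inner_factor Gamma t (Delta : C -> C) :=
  inner Delta /\ exists phi, [/\ outer phi,
    (forall z, disk z -> `|phi z| <= 4) &
    forall z, disk z -> derive1 (martin Gamma t) z = Delta z / phi z].

End Defs.

(* Main.v *)
Require Import Defs.
From HB Require Import structures.
From mathcomp Require Import all_boot all_order all_algebra.
From mathcomp Require Import complex.
From mathcomp Require Import all_classical all_reals all_analysis.
From mathcomp Require Import ring lra.
From mathcomp Require Import finmap.
From mathcomp Require summability.
From mathcomp Require Import measurable_realfun.
Set Implicit Arguments.
Unset Strict Implicit.
Unset Printing Implicit Defensive.
Import Order.TTheory GRing.Theory Num.Theory.
Import numFieldNormedType.Exports.
Local Open Scope classical_set_scope.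
Local Open Scope ring_scope.

(* Put S_b(z) = sum_g b(g) g'(t0) / (g(t0) - z)^2, so that m' = i t0 S_1 and
   Delta = i t0 phi S_1.  On the disk |S_b| <= 2 Im m / (1 - |z|^2).  At almost
   every boundary point t, Im m has lower limit 0 along the radius and m' is
   bounded there by nearly 1 / |phi(t)|, hence Im m(s t) <= (1 - s) / |phi(t)|
   up to an error, and the maximum principle gives |phi S_b| <= 1 for every
   unimodular b.  From S_1(g z) g'(z) = S_1(z) and |Delta| <= 1 one gets
   |phi(g z)| <= |phi(z) g'(z)|, first almost everywhere on the circle and then
   inside because phi is outer; applied to the inverse of g this is an equality,
   so phi(g z) = chi(g) g'(z) phi(z) with a unitary character chi.  With
   b = alpha / chi the function
   G = i t0 phi S_b / Delta(t0) is alpha-automorphic and |G| <= 1.  On the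
   radius towards t0 the terms g = e dominate both S_b and S_1, so that
   G(r t0) - 1 = O(1 - r).  Finally |G - 1|^2 <= 2 (1 - Re G), and the Poisson
   formula for 1 - Re G at r t0 bounds the circle means of
   |(G - 1) / (z - t0)|^2. *)

(** * The modulus and the exponential *)

(** Inside the disk |S_b| is bounded by the sum of the absolute values of the terms, not by |S_1|,
    so |phi S_1| <= 1 alone says nothing about S_b. On the circle, however, t0 g'(t0) = |g'(t0)|
    g(t0) and g(t0) t / (g(t0) - t)^2 = - 1 / |g(t0) - t|^2, so all terms of S_1 share one argument
    and formally |S_b| <= |S_1|. The series need not converge there. The substitute is Im m: 2 Im m
    / (1 - |z|^2) is exactly the sum of absolute values, and Im m is recovered from m' by
    integrating along a radius. As phi S_b is not known to be bounded, the maximum principle is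
    applied to phi(z) S_b(r z), with bound 1 / r, before r tends to 1. That phi is outer lets
    boundary inequalities for quotients by phi pass to the disk: 1 / phi is approximated in modulus
    by bounded outer functions. Near t0, S_1 has size (1 - r)^-2, so |phi S_1| <= 1 forces |phi| =
    O((1 - r)^2); this outweighs the error 1 / (1 - r) of either series, and the expansion of Delta
    then controls G - 1. *)

Section Modulus.
Context {R : realType}.
Local Notation C := R[i].
Local Notation N := (@modulus R).
Local Notation Re := complex.Re.
Local Notation Im := complex.Im.
Implicit Types x y z : C.

Lemma normE z : `|z| = (N z)%:C%C. Proof. by []. Qed.

Lemma NM x y : N (x * y) = N x * N y. Proof. exact: Normc.normcM. Qed.

Lemma NV x : N x^-1 = (N x)^-1. Proof. exact: Normc.normcV. Qed.

Lemma N0 : N 0 = 0. Proof. exact: Normc.normc0. Qed.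

Lemma N1 : N 1 = 1. Proof. exact: Normc.normc1. Qed.

Lemma ND x y : N (x + y) <= N x + N y. Proof. exact: le_normcD. Qed.

Lemma NN x : N (- x) = N x. Proof. exact: normcN. Qed.

Lemma NB x y : N (x - y) <= N x + N y.
Proof. by rewrite -[N y]NN; exact: ND. Qed.

Lemma Ndist x y : N (x - y) = N (y - x).
Proof. by rewrite -NN opprB. Qed.

Lemma N_ge0 z : 0 <= N z. Proof. by case: z => a b; exact: sqrtr_ge0. Qed.

Lemma N_eq0 z : (N z == 0) = (z == 0).
Proof.
by apply/eqP/eqP => [/Normc.eq0_normc //|->]; rewrite N0.
Qed.

Lemma N_gt0 z : (0 < N z) = (z != 0).
Proof. by rewrite lt_def N_ge0 andbT N_eq0. Qed.

Lemma Nsq z : N z ^+ 2 = Re z ^+ 2 + Im z ^+ 2.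
Proof. by case: z => a b /=; rewrite sqr_sqrtr // addr_ge0 // sqr_ge0. Qed.

Lemma NX z n : N (z ^+ n) = N z ^+ n.
Proof. by elim: n => [|n IH]; rewrite ?expr0 ?N1 // !exprS NM IH. Qed.

Lemma NJ z : N (z^*)%C = N z.
Proof. by case: z => a b /=; rewrite sqrrN. Qed.

Lemma NR (a : R) : N a%:C%C = `|a|.
Proof. by rewrite /modulus /= expr0n /= addr0 sqrtr_sqr. Qed.

Lemma Ni : N 'i%C = 1.
Proof. by rewrite /modulus /= expr0n expr1n /= add0r sqrtr1. Qed.

Lemma Nn n : N n%:R = n%:R.
Proof. by rewrite -(rmorph_nat (real_complex R)) NR ger0_norm. Qed.

Lemma ReN z : `|Re z| <= N z.
Proof.
rewrite -(@ler_pXn2r _ 2) ?nnegrE ?N_ge0 // Nsq real_normK ?num_real //.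
by rewrite lerDl sqr_ge0.
Qed.

Lemma ImN z : `|Im z| <= N z.
Proof.
rewrite -(@ler_pXn2r _ 2) ?nnegrE ?N_ge0 // Nsq real_normK ?num_real //.
by rewrite lerDr sqr_ge0.
Qed.

Lemma NReIm z : N z <= `|Re z| + `|Im z|.
Proof.
rewrite -(@ler_pXn2r _ 2) ?nnegrE ?N_ge0 ?addr_ge0 // Nsq sqrrD.
rewrite !real_normK ?num_real //.
have := mulr_ge0 (normr_ge0 (Re z)) (normr_ge0 (Im z)); lra.
Qed.

Lemma NconjM z : z * (z^*)%C = (N z ^+ 2)%:C%C.
Proof. by rewrite Nsq; case: z => a b /=; simpc; congr (_ +i* _)%C; ring. Qed.

Lemma cReD x y : Re (x + y) = Re x + Re y. Proof. by case: x y => ? ? []. Qed.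
Lemma cImD x y : Im (x + y) = Im x + Im y. Proof. by case: x y => ? ? []. Qed.
Lemma cReNg x : Re (- x) = - Re x. Proof. by case: x. Qed.
Lemma cImNg x : Im (- x) = - Im x. Proof. by case: x. Qed.
Lemma cReB x y : Re (x - y) = Re x - Re y. Proof. by rewrite cReD cReNg. Qed.
Lemma cImB x y : Im (x - y) = Im x - Im y. Proof. by rewrite cImD cImNg. Qed.
Lemma cReM x y : Re (x * y) = Re x * Re y - Im x * Im y.
Proof. by case: x y => ? ? []. Qed.
Lemma cImM x y : Im (x * y) = Re x * Im y + Im x * Re y.
Proof. by case: x y => ? ? []. Qed.
Lemma cReZ x (a : R) : Re (x * a%:C%C) = Re x * a.
Proof. by rewrite cReM /= mulr0 subr0. Qed.
Lemma cImZ x (a : R) : Im (x * a%:C%C) = Im x * a.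
Proof. by rewrite cImM /= mulr0 add0r. Qed.

Lemma complexP x y : Re x = Re y -> Im x = Im y -> x = y.
Proof. by case: x y => a b [c d] /= -> ->. Qed.

Lemma ND3 x y z : N (x + y + z) <= N x + N y + N z.
Proof. by rewrite (le_trans (ND _ _)) // lerD2r ND. Qed.

Lemma N_sub_le x y : `|N x - N y| <= N (x - y).
Proof.
rewrite ler_norml; apply/andP; split.
  have := ND (y - x) x; rewrite subrK Ndist; lra.
have := ND (x - y) y; rewrite subrK; lra.
Qed.

Lemma N_le1 z : `|z| <= 1 -> N z <= 1.
Proof. by rewrite normE -[1]/(1%:C%C) lecR. Qed.

Lemma N_eq1 z : `|z| = 1 -> N z = 1.
Proof. by rewrite normE -[1]/(1%:C%C) => /complexI. Qed.

Lemma diskE z : disk z = (N z < 1) :> Prop.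
Proof. by rewrite /disk /= normE -[1]/(1%:C%C) ltcR. Qed.

(* Rotating x to the positive axis turns a modulus into a real part. *)
Lemma N_rot x : exists2 c, N c = 1 & (N x)%:C%C = c * x.
Proof.
have [->|x0] := eqVneq x 0; first by exists 1; rewrite ?N1 // mulr0 N0.
have Nx0 : N x != 0 by rewrite N_eq0.
exists ((x^*)%C / (N x)%:C%C).
  by rewrite NM NV NJ NR ger0_norm ?N_ge0 // divff.
rewrite mulrAC [_ * x]mulrC NconjM expr2 rmorphM /= -mulrA divff ?mulr1 //.
by apply: contra Nx0 => /eqP/complexI ->.
Qed.

Lemma N_expi t : N (expi t) = 1.
Proof. by rewrite /modulus /expi /= cos2Dsin2 sqrtr1. Qed.

Lemma expi_neq0 (t : R) : expi t != 0.
Proof. by rewrite -N_gt0 N_expi. Qed.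

Lemma cexpD x y : cexp (x + y) = cexp x * cexp y.
Proof.
apply: complexP; case: x => a b; case: y => c d; rewrite /cexp /expi;
  rewrite expRD ?cosD ?sinD /=; simpc; rewrite ?cosD ?sinD /=; ring.
Qed.

Lemma N_cexp z : N (cexp z) = expR (Re z).
Proof. by rewrite NM N_expi mulr1 NR ger0_norm // expR_ge0. Qed.

Lemma cexp_neq0 z : cexp z != 0.
Proof. by rewrite -N_gt0 N_cexp expR_gt0. Qed.

End Modulus.

(** The field is left abstract because the lemma serves real functions of a real variable as well as
    complex ones. *)
Lemma is_derive_quad (K : numFieldType) (f : K^o -> K^o) (x d del M : K) :
  0 < del -> 0 <= M -> (forall y, `|y - x| < del ->
    `|f y - f x - d * (y - x)| <= M * `|y - x| ^+ 2) ->
  is_derive x 1 f d.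
Proof.
move=> del0 M0 H.
suff cv : h^-1 *: (f (h *: 1 + x) - f x) @[h --> 0^'] --> (d : K^o).
  by apply: DeriveDef; [apply/cvg_ex; exists d|exact/cvg_lim].
apply/cvgrPdist_lt => e e0; near=> h.
have h0 : h != 0 by near: h; exact: nbhs_dnbhs_neq.
have hd : `|h| < del.
  near: h; apply: dnbhs0_lt => //.
have he : `|h| < e / (M + 1).
  by near: h; apply: dnbhs0_lt; rewrite divr_gt0 // ltr_wpDl.
have E : h *: (1 : K^o) + x - x = h by rewrite addrK scaler1.
have := H (h *: 1 + x); rewrite E => /(_ hd) Hh.
have -> : d - h^-1 *: (f (h *: 1 + x) - f x) =
    - (h^-1 * (f (h *: 1 + x) - f x - d * h)).
  by rewrite [d * h]mulrC mulrBr mulKf // opprB.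
rewrite normrN normrM normfV.
have nh0 : 0 < `|h| by rewrite normr_gt0.
rewrite mulrC ltr_pdivrMr //; apply: le_lt_trans Hh _.
rewrite expr2 mulrA ltr_pM2r //.
apply: le_lt_trans (_ : (M + 1) * `|h| < e).
  by rewrite ler_wpM2r // lerDl.
by rewrite mulrC -ltr_pdivlMr // ltr_wpDl.
Unshelve. all: by end_near. Qed.

Section RealEstimates.
Context {R : realType}.
Implicit Types (F dF : R -> R) (a b t : R).

Lemma mvt_bound F dF (M a b : R) : (forall t, is_derive t 1 F (dF t)) ->
  (forall t, `|t - a| <= `|b - a| -> `|dF t| <= M) ->
  `|F b - F a| <= M * `|b - a|.
Proof.
move=> HF HM.
have cF : continuous F.
  by move=> t; apply/differentiable_continuous/derivable1_diffP; case: (HF t).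
have W c d : c <= d -> (forall t, c <= t <= d -> `|dF t| <= M) ->
    `|F d - F c| <= M * (d - c).
  move=> cd H; have [|e /[!in_itv]/= ecd ->] := MVT_segment cd (fun t _ => HF t).
    exact: continuous_subspaceT.
  by rewrite normrM [ `|d - c|]ger0_norm ?subr_ge0 // ler_wpM2r ?subr_ge0 // H.
have [ab|/ltW ba] := leP a b.
  rewrite [ `|b - a|]ger0_norm ?subr_ge0 //; apply: W => // t /andP[ta tb].
  by apply: HM; rewrite !ger0_norm ?subr_ge0 // lerD2r.
rewrite distrC [ `|b - a|]distrC [ `|a - b|]ger0_norm ?subr_ge0 //.
apply: W => // t /andP[ta tb].
by apply: HM; rewrite !ler0_norm ?subr_le0 // lerN2 lerD2r.
Qed.

Lemma cos_quad b : `|cos b - 1| <= `|b| ^+ 2.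
Proof.
have S (c : R) : `|sin c| <= `|c|.
  have := @mvt_bound sin cos 1 0 c (fun t => is_derive_sin t).
  by rewrite sin0 !subr0 mul1r; apply=> t _; exact: cos_max.
have := @mvt_bound cos (fun t => - sin t) `|b| 0 b (fun t => is_derive_cos t).
rewrite cos0 !subr0 expr2; apply=> t; rewrite subr0 normrN => tb.
exact: le_trans (S t) tb.
Qed.

Lemma sin_quad b : `|sin b - b| <= `|b| ^+ 2.
Proof.
have S (c : R) : `|cos c - 1| <= `|c|.
  have := @mvt_bound cos (fun t => - sin t) 1 0 c (fun t => is_derive_cos t).
  by rewrite cos0 !subr0 mul1r; apply=> t _; rewrite normrN; exact: sin_max.
have D (t : R) : is_derive t 1 (fun t => sin t - t) (cos t - 1).
  by apply: is_deriveB.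
have := @mvt_bound _ _ `|b| 0 b D.
rewrite sin0 !subr0 expr2; apply=> t; rewrite subr0 => tb.
exact: le_trans (S t) tb.
Qed.

Lemma expR_lin a : `|expR a - 1| <= expR `|a| * `|a|.
Proof.
have := @mvt_bound expR expR (expR `|a|) 0 a (fun t => is_derive_expR t).
rewrite expR0 !subr0; apply=> t; rewrite subr0 => ta.
by rewrite ger0_norm ?expR_ge0 // ler_expR (le_trans (ler_norm _)).
Qed.

Lemma expR_quad a : `|expR a - 1 - a| <= expR `|a| * `|a| ^+ 2.
Proof.
have D (t : R) : is_derive t 1 (fun t => expR t - 1 - t) (expR t - 1).
  have -> : expR t - 1 = (expR t - 0) - 1 by rewrite subr0.
  by do 2 apply: is_deriveB.
have := @mvt_bound _ _ (expR `|a| * `|a|) 0 a D.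
rewrite expR0 !subrr !subr0 expr2 mulrA; apply=> t; rewrite subr0 => ta.
apply: (le_trans (expR_lin t)).
by apply: ler_pM; rewrite ?expR_ge0 // ler_expR.
Qed.
End RealEstimates.

(** * Uniform second-order calculus on closed disks *)

Section ComplexEstimates.
Context {R : realType}.
Local Notation C := R[i].
Local Notation N := (@modulus R).
Local Notation Re := complex.Re.
Local Notation Im := complex.Im.
Implicit Types (f g df dg : C -> C) (r K : R).

(** Real and imaginary parts split into four products of one-variable remainders, each at most
    [expR (N h) * N h ^+ 2]; the constant 6 is generous. *)
Lemma cexp_quad (h : C) :
  N (cexp h - 1 - h) <= 6 * expR (N h) * N h ^+ 2.
Proof.
case: h => a b; set h := (a +i* b)%C.
have ah : `|a| <= N h := ReN h; have bh : `|b| <= N h := ImN h.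
have [a0 b0] : 0 <= `|a| /\ 0 <= `|b| by [].
set n := N h in ah bh *; set E := expR n.
have n0 : 0 <= n by exact: N_ge0.
have E1 : 1 <= E by rewrite -expR0 ler_expR.
have aE : expR `|a| <= E by rewrite ler_expR.
have [a2 b2 ab] : [/\ `|a| ^+ 2 <= n ^+ 2, `|b| ^+ 2 <= n ^+ 2 &
    `|a| * `|b| <= n ^+ 2].
  by rewrite !expr2; split; exact: ler_pM.
have n20 : 0 <= n ^+ 2 by exact: sqr_ge0.
have EM (x y z : R) : 0 <= x -> 0 <= z -> x <= E -> z <= n ^+ 2 ->
    y <= x * z -> y <= E * n ^+ 2.
  by move=> x0 z0 xE zn /le_trans; apply; exact: ler_pM.
have q1 : `|expR a - 1 - a| <= E * n ^+ 2.
  by apply: (EM (expR `|a|) _ (`|a| ^+ 2)); rewrite ?expR_ge0 ?expr_ge0 // expR_quad.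
have q2 : `|expR a * (cos b - 1)| <= E * n ^+ 2.
  rewrite normrM; apply: (EM (expR `|a|) _ (`|b| ^+ 2));
    rewrite ?expR_ge0 ?expr_ge0 //.
  apply: ler_pM => //; last exact: cos_quad.
  by rewrite ger0_norm ?expR_ge0 // ler_expR ler_norm.
have q3 : `|expR a * (sin b - b)| <= E * n ^+ 2.
  rewrite normrM; apply: (EM (expR `|a|) _ (`|b| ^+ 2));
    rewrite ?expR_ge0 ?expr_ge0 //.
  apply: ler_pM => //; last exact: sin_quad.
  by rewrite ger0_norm ?expR_ge0 // ler_expR ler_norm.
have q4 : `|(expR a - 1) * b| <= E * n ^+ 2.
  rewrite normrM; apply: (EM (expR `|a|) _ (`|a| * `|b|));
    rewrite ?expR_ge0 ?mulr_ge0 //.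
  by rewrite mulrA ler_wpM2r // expR_lin.
apply: le_trans (NReIm _) _.
have -> : Re (cexp h - 1 - h) = (expR a * (cos b - 1)) + (expR a - 1 - a).
  by rewrite !cReB /cexp /expi /=; ring.
have -> : Im (cexp h - 1 - h) = (expR a * (sin b - b)) + (expR a - 1) * b.
  by rewrite !cImB /cexp /expi /=; ring.
apply: le_trans (lerD (ler_normD _ _) (ler_normD _ _)) _.
have : 0 <= E * n ^+ 2 by rewrite mulr_ge0 // (le_trans _ E1).
lra.
Qed.

Lemma expi_quad (t u : R) :
  N (expi u - expi t - 'i%C * expi t * (u - t)%:C%C) <= 12 * `|u - t| ^+ 2.
Proof.
have -> : expi u = expi t * expi (u - t).
  have -> : expi u = expi (t + (u - t)) by rewrite addrC subrK.
  by rewrite /expi; apply: complexP => /=; rewrite (cosD, sinD) //; ring.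
have -> : expi t * expi (u - t) - expi t - 'i%C * expi t * (u - t)%:C%C =
   expi t * (expi (u - t) - 1 - 'i%C * (u - t)%:C%C) by ring.
rewrite NM N_expi mul1r; set s := u - t.
apply: le_trans (NReIm _) _.
have -> : Re (expi s - 1 - 'i%C * s%:C%C) = cos s - 1.
  by rewrite !cReB /expi /=; ring.
have -> : Im (expi s - 1 - 'i%C * s%:C%C) = sin s - s.
  by rewrite !cImB /expi /=; ring.
have := cos_quad s; have := sin_quad s; have := sqr_ge0 `|s|; lra.
Qed.

(* A uniform form of twice differentiability on the disk of radius r, with
   derivative df; it passes to sums and integrals without limit exchange. *)
Definition qd r K f df := forall x y, N x <= r -> N y <= r ->
  [/\ N (f x) <= K, N (df x) <= K &
      N (f y - f x - df x * (y - x)) <= K * N (y - x) ^+ 2].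

Lemma qd_le r K L f df : K <= L -> qd r K f df -> qd r L f df.
Proof.
move=> KL H x y xr yr; have [h1 h2 h3] := H x y xr yr.
split; [exact: le_trans KL|exact: le_trans KL|].
by apply: le_trans h3 _; rewrite ler_wpM2r // sqr_ge0.
Qed.

Lemma qd_ext r K f df g dg : (forall x, N x <= r -> f x = g x) ->
  (forall x, N x <= r -> df x = dg x) -> qd r K f df -> qd r K g dg.
Proof.
move=> fg dfg H x y xr yr; have [h1 h2 h3] := H x y xr yr.
by rewrite -!fg // -!dfg.
Qed.

Lemma qd_ge0 r K f df : 0 <= r -> qd r K f df -> 0 <= K.
Proof.
by move=> r0 /(_ 0 0); rewrite N0 => /(_ r0 r0)[h _ _]; exact: le_trans (N_ge0 _) h.
Qed.

Lemma qd_cst r (c : C) : qd r (N c) (cst c) (cst 0).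
Proof.
move=> x y _ _; rewrite /cst subrr mul0r subr0 !N0.
by split; rewrite ?N_ge0 // mulr_ge0 ?N_ge0 ?sqr_ge0.
Qed.

Lemma qd_id r : r <= 1 -> qd r 1 id (cst 1).
Proof.
move=> r1 x y xr yr; rewrite /cst mul1r subrr N0 N1.
by split; rewrite ?(le_trans xr) // mul1r sqr_ge0.
Qed.

Lemma qd_add r K L f df g dg : qd r K f df -> qd r L g dg ->
  qd r (K + L) (f \+ g) (df \+ dg).
Proof.
move=> F G x y xr yr; have [f1 f2 f3] := F x y xr yr.
have [g1 g2 g3] := G x y xr yr.
split => /=; [exact: le_trans (ND _ _) (lerD f1 g1)|
  exact: le_trans (ND _ _) (lerD f2 g2)|].
have -> : f y + g y - (f x + g x) - (df x + dg x) * (y - x) =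
  (f y - f x - df x * (y - x)) + (g y - g x - dg x * (y - x)) by ring.
by rewrite mulrDl (le_trans (ND _ _)) ?lerD.
Qed.

Lemma qd_scal r K f df (c : C) : qd r K f df ->
  qd r (N c * K) (fun z => c * f z) (fun z => c * df z).
Proof.
move=> F x y xr yr; have [f1 f2 f3] := F x y xr yr.
have -> : c * f y - c * f x - c * df x * (y - x) =
  c * (f y - f x - df x * (y - x)) by ring.
by rewrite !NM; split; rewrite -?mulrA; apply: ler_wpM2l; rewrite ?N_ge0.
Qed.

(** The disk has diameter at most 2, so the quadratic remainder adds at most [2 * K * N (y - x)] to
    the linear term. *)
Lemma qd_lip r K f df x y : r <= 1 -> qd r K f df -> N x <= r -> N y <= r ->
  N (f y - f x) <= 3 * K * N (y - x).
Proof.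
move=> r1 F xr yr; have [f1 f2 f3] := F x y xr yr.
have K0 : 0 <= K by exact: le_trans (N_ge0 _) f1.
have -> : f y - f x = df x * (y - x) + (f y - f x - df x * (y - x)) by ring.
have n2 : N (y - x) <= 2 by apply: le_trans (NB _ _) _; lra.
apply: le_trans (ND _ _) _; rewrite NM.
have n0 := N_ge0 (y - x).
have h1 : N (df x) * N (y - x) <= K * N (y - x) by apply: ler_wpM2r.
have h2 : K * N (y - x) ^+ 2 <= K * (2 * N (y - x)).
  by apply: ler_wpM2l => //; rewrite expr2 ler_wpM2r.
lra.
Qed.

(** Adding the expansions from [x] to [y] and from [y] to [x] leaves [(df y - df x) * (y - x)], so
    the derivative is Lipschitz without any second derivative. *)
Lemma qd_dlip r K f df x y : qd r K f df -> N x <= r -> N y <= r ->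
  N (df y - df x) <= 2 * K * N (y - x).
Proof.
move=> F xr yr; have [_ _ f3] := F x y xr yr; have [_ _ f4] := F y x yr xr.
have [->|yx] := eqVneq y x; first by rewrite !subrr N0 mulr0.
have n0 : 0 < N (y - x) by rewrite N_gt0 subr_eq0.
rewrite -(ler_pM2r n0) -NM.
have -> : (df y - df x) * (y - x) = (f y - f x - df x * (y - x)) +
   (f x - f y - df y * (x - y)) by ring.
apply: le_trans (ND _ _) _; rewrite [N (x - y)]Ndist in f4.
move: f3 f4; rewrite expr2; lra.
Qed.

(** The constant is 9 + 1 + 1: the product of the two increments, each with the factor 3 of
    [qd_lip], and one remainder for each function. *)
Lemma qd_mul r K L f df g dg : r <= 1 -> qd r K f df -> qd r L g dg ->
  qd r (11 * K * L) (fun z => f z * g z) (fun z => df z * g z + f z * dg z).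
Proof.
move=> r1 F G x y xr yr; have [f1 f2 f3] := F x y xr yr.
have [g1 g2 g3] := G x y xr yr.
have K0 : 0 <= K by exact: le_trans (N_ge0 _) f1.
have L0 : 0 <= L by exact: le_trans (N_ge0 _) g1.
have KL0 : 0 <= K * L by exact: mulr_ge0.
have n0 := N_ge0 (y - x); have n20 := sqr_ge0 (N (y - x)).
split.
- by rewrite NM; apply: le_trans (ler_pM _ _ f1 g1) _; rewrite ?N_ge0 //; lra.
- apply: le_trans (ND _ _) _; rewrite !NM.
  have := ler_pM (N_ge0 _) (N_ge0 _) f2 g1.
  have := ler_pM (N_ge0 _) (N_ge0 _) f1 g2; lra.
have -> : f y * g y - f x * g x - (df x * g x + f x * dg x) * (y - x) =
  (f y - f x) * (g y - g x) + f x * (g y - g x - dg x * (y - x)) +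
  g x * (f y - f x - df x * (y - x)) by ring.
apply: le_trans (ND3 _ _ _) _; rewrite !NM.
have := ler_pM (N_ge0 _) (N_ge0 _) (qd_lip r1 F xr yr) (qd_lip r1 G xr yr).
have := ler_pM (N_ge0 _) (N_ge0 _) f1 g3.
have := ler_pM (N_ge0 _) (N_ge0 _) g1 f3.
have -> : 3 * K * N (y - x) * (3 * L * N (y - x)) =
  9 * (K * L * N (y - x) ^+ 2) by ring.
have -> : K * (L * N (y - x) ^+ 2) = K * L * N (y - x) ^+ 2 by ring.
have -> : L * (K * N (y - x) ^+ 2) = K * L * N (y - x) ^+ 2 by ring.
have -> : 11 * K * L * N (y - x) ^+ 2 = 11 * (K * L * N (y - x) ^+ 2) by ring.
lra.
Qed.

Lemma qd_comp r s K L f df g dg : r <= 1 -> qd r K g dg -> qd s L f df ->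
  (forall z, N z <= r -> N (g z) <= s) ->
  qd r (L * (1 + K + 9 * K ^+ 2)) (f \o g) (fun z => df (g z) * dg z).
Proof.
move=> r1 G F gs x y xr yr; have [g1 g2 g3] := G x y xr yr.
have [f1 f2 f3] := F (g x) (g y) (gs x xr) (gs y yr).
have K0 : 0 <= K by exact: le_trans (N_ge0 _) g1.
have L0 : 0 <= L by exact: le_trans (N_ge0 _) f1.
have KL0 : 0 <= K * L by exact: mulr_ge0.
have K20 : 0 <= L * K ^+ 2 by rewrite mulr_ge0 // sqr_ge0.
have n0 := N_ge0 (y - x); have n20 := sqr_ge0 (N (y - x)).
split.
- by apply: le_trans f1 _; lra.
- by rewrite NM; apply: le_trans (ler_pM _ _ f2 g2) _; rewrite ?N_ge0 //; lra.
have -> : (f \o g) y - (f \o g) x - df (g x) * dg x * (y - x) =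
  (f (g y) - f (g x) - df (g x) * (g y - g x)) +
   df (g x) * (g y - g x - dg x * (y - x)) by rewrite /=; ring.
apply: le_trans (ND _ _) _; rewrite NM.
have h1 := ler_pM (N_ge0 _) (N_ge0 _) f2 g3.
have h2 : L * N (g y - g x) ^+ 2 <= L * (3 * K * N (y - x)) ^+ 2.
  have hl := qd_lip r1 G xr yr.
  by rewrite ler_wpM2l // lerXn2r ?nnegrE ?N_ge0 // !mulr_ge0.
apply: le_trans (lerD f3 h1) _; apply: le_trans (lerD h2 (lexx _)) _.
have : 0 <= L * N (y - x) ^+ 2 by exact: mulr_ge0.
have -> : L * (1 + K + 9 * K ^+ 2) * N (y - x) ^+ 2 =
  L * N (y - x) ^+ 2 + L * (K * N (y - x) ^+ 2) + L * (3 * K * N (y - x)) ^+ 2.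
  ring.
lra.
Qed.

Lemma N_kern (zeta z : C) r : N zeta = 1 -> N z <= r -> 1 - r <= N (zeta - z).
Proof.
move=> z1 zr; have := ND (zeta - z) z; rewrite subrK z1; lra.
Qed.

Lemma kern_neq0 (zeta z : C) : N zeta = 1 -> N z < 1 -> zeta - z != 0.
Proof.
move=> h zr; rewrite -N_gt0; apply: lt_le_trans (N_kern h (lexx _)).
by rewrite subr_gt0.
Qed.

(** The second-order remainder is exactly a product of three inverse distances times [(y - x) ^+ 2],
    hence the exponent 3; lower powers are absorbed because [(1 - r)^-1] is at least 1. *)
Lemma qd_kern r (zeta : C) : 0 <= r < 1 -> N zeta = 1 ->
  qd r ((1 - r) ^- 3) (fun z => (zeta - z)^-1) (fun z => (zeta - z)^-2).
Proof.
move=> /andP[r0 r1] h x y xr yr.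
have nx := kern_neq0 h (le_lt_trans xr r1).
have ny := kern_neq0 h (le_lt_trans yr r1).
have q0 : 0 < 1 - r by rewrite subr_gt0.
have q1 : 1 - r <= 1 by rewrite lerBlDr lerDl.
have bx : (N (zeta - x))^-1 <= (1 - r)^-1.
  by rewrite lef_pV2 ?posrE ?N_gt0 // N_kern.
have by_ : (N (zeta - y))^-1 <= (1 - r)^-1.
  by rewrite lef_pV2 ?posrE ?N_gt0 // N_kern.
have i0 : 0 <= (1 - r)^-1 by rewrite invr_ge0 ltW.
have i1 : 1 <= (1 - r)^-1 by rewrite invf_ge1.
have -> : (1 - r) ^- 3 = (1 - r)^-1 ^+ 3 by rewrite exprVn.
have -> : (zeta - x) ^- 2 = (zeta - x)^-1 ^+ 2 by rewrite exprVn.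
rewrite !(NX, NV); split.
- by apply: le_trans bx _; rewrite [_ ^+ 3]exprS ler_peMr // exprn_ege1.
- rewrite [_ ^+ 3]exprSr; apply: le_trans (_ : (1 - r)^-1 ^+ 2 <= _).
    by rewrite lerXn2r ?nnegrE // invr_ge0 N_ge0.
  by rewrite ler_peMr // exprn_ge0.
have -> : (zeta - y)^-1 - (zeta - x)^-1 - (zeta - x)^-1 ^+ 2 * (y - x) =
   (zeta - y)^-1 * (zeta - x)^-1 ^+ 2 * (y - x) ^+ 2.
  by field; rewrite nx ny.
rewrite !(NM, NX, NV) ler_wpM2r ?sqr_ge0 // [_ ^+ 3]exprS ler_pM ?invr_ge0 ?N_ge0 ?sqr_ge0 //.
by rewrite -expr2 lerXn2r ?nnegrE // invr_ge0 N_ge0.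
Qed.

Lemma qd_cexp r K f df : r <= 1 -> qd r K f df ->
  exists K', qd r K' (fun z => cexp (f z)) (fun z => cexp (f z) * df z).
Proof.
move=> r1 F; pose E := expR (Num.max K 0); pose E2 := expR (6 * Num.max K 0).
exists (E * (1 + K + 54 * E2 * K ^+ 2)) => x y xr yr.
have [f1 f2 f3] := F x y xr yr.
have K0 : 0 <= K by exact: le_trans (N_ge0 _) f1.
have E0 : 0 <= E by exact: expR_ge0.
have E20 : 0 <= E2 by exact: expR_ge0.
have EK0 : 0 <= E * K by exact: mulr_ge0.
have EE0 : 0 <= E * E2 * K ^+ 2 by rewrite !mulr_ge0.
have n20 := sqr_ge0 (N (y - x)).
have e1 : N (cexp (f x)) <= E.
  by rewrite N_cexp ler_expR (le_trans (ler_norm _)) // (le_trans (ReN _))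
    // le_max f1.
have dxy := qd_lip r1 F xr yr.
have dd : N (y - x) <= 2 by apply: le_trans (NB _ _) _; lra.
have d6 : N (f y - f x) <= 6 * K.
  apply: le_trans dxy _; have := ler_wpM2l K0 dd; lra.
split.
- by apply: le_trans e1 _; lra.
- by rewrite NM; apply: le_trans (ler_pM _ _ e1 f2) _; rewrite ?N_ge0 //; lra.
set h := f y - f x in dxy d6.
have -> : cexp (f y) = cexp (f x) * cexp h by rewrite -cexpD /h addrC subrK.
have -> : cexp (f x) * cexp h - cexp (f x) - cexp (f x) * df x * (y - x) =
  cexp (f x) * ((cexp h - 1 - h) + (f y - f x - df x * (y - x))).
  by rewrite /h; ring.
rewrite NM -mulrA ler_pM ?N_ge0 //.
apply: le_trans (ND _ _) _.
have c1 : N (cexp h - 1 - h) <= 6 * E2 * (3 * K * N (y - x)) ^+ 2.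
  apply: le_trans (cexp_quad _) _; apply: ler_pM.
  - by rewrite mulr_ge0 // expR_ge0.
  - exact: sqr_ge0.
  - by rewrite ler_wpM2l // ler_expR; apply: le_trans d6 _; rewrite ler_wpM2l // le_max lexx.
  - by rewrite lerXn2r ?nnegrE ?N_ge0 // !mulr_ge0 ?N_ge0.
apply: le_trans (lerD c1 f3) _.
have -> : (1 + K + 54 * E2 * K ^+ 2) * N (y - x) ^+ 2 =
  N (y - x) ^+ 2 + (6 * E2 * (3 * K * N (y - x)) ^+ 2 + K * N (y - x) ^+ 2).
  ring.
by rewrite lerDr.
Qed.

End ComplexEstimates.

(** * The Poisson formula and the maximum principle *)

Section ComplexIntegral.
Context {R : realType}.
Local Notation C := R[i].
Local Notation N := (@modulus R).
Local Notation Re := (@complex.Re R).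
Local Notation Im := (@complex.Im R).
Local Notation mu := (@lebesgue_measure R).
Local Notation J := (`[0, 2 * pi]%classic : set R).
Implicit Types (h g : R -> C) (z w : C).

Lemma cvgCP T (F : set_system T) {FF : Filter F} (f : T -> C) (l : C) :
  (f x @[x --> F] --> l) <->
  (forall e : R, 0 < e -> \forall x \near F, N (l - f x) < e).
Proof.
split=> [/cvgrPdist_lt H e e0|H].
  have /H : 0 < e%:C%C by rewrite ltcR.
  by apply: filterS => x; rewrite normE ltcR.
(* In the order of [R[i]] a positive element has zero imaginary part, so every tolerance is real. *)
apply/cvgrPdist_lt => -[e e'] /[!ltcE] /= /andP[/eqP -> e0].
by apply: filterS (H e e0) => x; rewrite normE ltcE /= eqxx.
Qed.

Lemma cvg_Re T (F : set_system T) {FF : Filter F} (f : T -> C) (l : C) :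
  f x @[x --> F] --> l -> Re (f x) @[x --> F] --> Re l.
Proof.
move=> /cvgCP H; apply/cvgrPdist_lt => e /H; apply: filterS => x.
by rewrite -cReB; apply: le_lt_trans (ReN _).
Qed.

Lemma cvg_Im T (F : set_system T) {FF : Filter F} (f : T -> C) (l : C) :
  f x @[x --> F] --> l -> Im (f x) @[x --> F] --> Im l.
Proof.
move=> /cvgCP H; apply/cvgrPdist_lt => e /H; apply: filterS => x.
by rewrite -cImB; apply: le_lt_trans (ImN _).
Qed.

Lemma cvg_modulus T (F : set_system T) {FF : Filter F} (f : T -> C) (l : C) :
  f x @[x --> F] --> l -> N (f x) @[x --> F] --> N l.
Proof.
move=> /cvgCP H; apply/cvgrPdist_lt => e /H; apply: filterS => x.
by apply: le_lt_trans (N_sub_le _ _).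
Qed.

Lemma continuousC_lip h : (forall t u, `|u - t| < 1 -> exists K, forall u,
    `|u - t| < 1 -> N (h u - h t) <= K * `|u - t|) -> continuous h.
Proof.
move=> H t; apply/cvgCP => e e0.
have [|K HK] := H t t; first by rewrite subrr normr0.
pose K' := `|K| + 1; have K0 : 0 < K' by rewrite ltr_wpDl.
have d0 : 0 < Num.min 1 (e / K') by rewrite lt_min ltr01 divr_gt0.
near=> u.
have : `|t - u| < Num.min 1 (e / K').
  by near: u; apply/nbhs_ballP; exists (Num.min 1 (e / K')).
rewrite distrC lt_min => /andP[u1 u2]; rewrite Ndist.
apply: le_lt_trans (HK u u1) _; apply: le_lt_trans (_ : K' * `|u - t| < e).
  by rewrite ler_wpM2r // (le_trans (ler_norm K)) // lerDl.
by rewrite mulrC -ltr_pdivlMr.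
Unshelve. all: by end_near. Qed.

Lemma expi_lip (t u : R) : N (expi u - expi t) <= 13 * `|u - t|.
Proof.
have [u1|u1] := leP `|u - t| 1.
  have -> : expi u - expi t = (expi u - expi t - 'i%C * expi t * (u - t)%:C%C)
    + 'i%C * expi t * (u - t)%:C%C by rewrite subrK.
  apply: le_trans (ND _ _) _; rewrite !NM Ni N_expi NR !mul1r.
  have := expi_quad t u; have : `|u - t| ^+ 2 <= `|u - t|.
    by rewrite expr2 ler_piMl.
  lra.
by apply: le_trans (NB _ _) _; rewrite !N_expi; lra.
Qed.

Lemma continuous_expi : continuous (@expi R).
Proof.
apply: continuousC_lip => t _ _; exists 13 => u _; exact: expi_lip.
Qed.

Definition cintegrable h :=
  mu.-integrable J (EFin \o (Re \o h)) /\ mu.-integrable J (EFin \o (Im \o h)).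

Lemma integrableJ (f : R -> R) : continuous f -> mu.-integrable J (EFin \o f).
Proof.
move=> cf; apply: continuous_compact_integrable; first exact: segment_compact.
exact: continuous_subspaceT.
Qed.

Lemma cintegrable_cont h : continuous h -> cintegrable h.
Proof.
move=> ch; split; apply: integrableJ => t.
  exact: (cvg_Re (ch t)).
exact: (cvg_Im (ch t)).
Qed.

Lemma measurableJ : measurable (J : set (measurableTypeR R)). Proof. exact: measurable_itv. Qed.

Lemma cintegrableD h g : cintegrable h -> cintegrable g ->
  cintegrable (fun t => h t + g t).
Proof.
move=> [h1 h2] [g1 g2]; split.
  have := integrableD measurableJ h1 g1; apply: eq_integrable => // t _.
  by rewrite /= cReD EFinD.
have := integrableD measurableJ h2 g2; apply: eq_integrable => // t _.
by rewrite /= cImD EFinD.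
Qed.

Lemma integrableJZ (f : R -> R) (a : R) : mu.-integrable J (EFin \o f) ->
  mu.-integrable J (EFin \o (fun t => a * f t)).
Proof.
move=> /(integrableZl measurableJ a); apply: eq_integrable => // t _.
Qed.

Lemma cintegrableZ h (c : C) : cintegrable h -> cintegrable (fun t => c * h t).
Proof.
move=> [h1 h2]; split.
  have := integrableB measurableJ (integrableJZ (Re c) h1) (integrableJZ (Im c) h2).
  by apply: eq_integrable => // t _; rewrite /= cReM.
have := integrableD measurableJ (integrableJZ (Re c) h2) (integrableJZ (Im c) h1).
by apply: eq_integrable => // t _; rewrite /= cImM EFinD.
Qed.

Lemma cintD h g : cintegrable h -> cintegrable g ->
  cint (fun t => h t + g t) = cint h + cint g.
Proof.
move=> [h1 h2] [g1 g2]; apply: complexP; rewrite ?cReD ?cImD /cint /=.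
  by under eq_Rintegral do rewrite cReD; rewrite RintegralD.
by under eq_Rintegral do rewrite cImD; rewrite RintegralD.
Qed.

Lemma cintZ h (c : C) : cintegrable h ->
  cint (fun t => c * h t) = c * cint h.
Proof.
move=> [h1 h2]; apply: complexP; rewrite ?cReM ?cImM /cint /=.
  under eq_Rintegral do rewrite cReM.
  by rewrite RintegralB ?RintegralZl //; exact: integrableJZ.
under eq_Rintegral do rewrite cImM.
by rewrite RintegralD ?RintegralZl //; exact: integrableJZ.
Qed.

Lemma cintegrableB h g : cintegrable h -> cintegrable g ->
  cintegrable (fun t => h t - g t).
Proof.
move=> H G; have := cintegrableD H (cintegrableZ (-1) G).
by rewrite (_ : (fun t => _) = (fun t => h t - g t)) //; apply/funext => t; rewrite mulN1r.
Qed.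

Lemma cintB h g : cintegrable h -> cintegrable g ->
  cint (fun t => h t - g t) = cint h - cint g.
Proof.
move=> H G; rewrite -[- cint g]mulN1r -cintZ // -cintD //; last exact: cintegrableZ.
by congr cint; apply/funext => t; rewrite mulN1r.
Qed.

Lemma Rintegral_cstJ (a : R) : \int[mu]_(t in J) a = a * (2 * pi).
Proof.
have pi0 : 0 <= 2 * pi :> R by rewrite mulr_ge0 // pi_ge0.
have E : mu J = (2 * pi)%:E.
  rewrite lebesgue_measure_itv /= lte_fin lt_neqAle pi0 andbT.
  by case: eqP => [<-//|_]; rewrite oppr0 adde0.
by rewrite Rintegral_cst //; congr (_ * _); exact: (congr1 fine E).
Qed.

Lemma cint_cst (c : C) : cint (fun=> c) = c * (2 * pi)%:C%C.
Proof. by apply: complexP; rewrite ?cReZ ?cImZ /cint /= Rintegral_cstJ. Qed.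

Lemma eq_cint h g : (forall t, 0 <= t <= 2 * pi -> h t = g t) -> cint h = cint g.
Proof.
move=> hg; rewrite /cint; congr (_ +i* _)%C; apply: eq_Rintegral => t /set_mem;
  by rewrite /= in_itv /= => /hg ->.
Qed.

(** Bounding the two components separately costs the factor 2. This is harmless where only a finite
    constant is wanted; sharp bounds go through [N_rot] instead. *)
Lemma cint_le h (b : R -> R) : cintegrable h -> mu.-integrable J (EFin \o b) ->
  (forall t, N (h t) <= b t) -> N (cint h) <= 2 * \int[mu]_(t in J) b t.
Proof.
move=> [h1 h2] ib hb; apply: le_trans (NReIm _) _; rewrite /cint /=.
have A (f : R -> R) : mu.-integrable J (EFin \o f) -> (forall t, `|f t| <= b t) ->
    `|\int[mu]_(t in J) f t| <= \int[mu]_(t in J) b t.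
  move=> fi fb; apply: le_trans (le_normr_Rintegral measurableJ fi) _.
  apply: le_Rintegral => //; first exact: integrable_norm.
by rewrite [leRHS]mulr_natl [leRHS]mulr2n lerD // A // => t;
  [apply: le_trans (ReN _) _|apply: le_trans (ImN _) _].
Qed.

Lemma cint_bound h (M : R) : cintegrable h ->
  (forall t, N (h t) <= M) -> N (cint h) <= 4 * pi * M.
Proof.
move=> ih hM; have := cint_le ih (integrableJ (@cst_continuous _ _ M)) hM.
by rewrite Rintegral_cstJ; have -> : 2 * (M * (2 * pi)) = 4 * pi * M by ring.
Qed.

Lemma cint_FTC (P dP : R -> C) (K : R) : continuous dP -> 0 <= K ->
  (forall t u, `|u - t| < 1 ->
    N (P u - P t - dP t * (u - t)%:C%C) <= K * `|u - t| ^+ 2) ->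
  cint dP = P (2 * pi) - P 0.
Proof.
move=> cdP K0 H.
have pi0 : 0 < 2 * pi :> R by rewrite mulr_gt0 // pi_gt0.
have F (F f : R -> R) : continuous f -> (forall t u, `|u - t| < 1 ->
    `|F u - F t - f t * (u - t)| <= K * `|u - t| ^+ 2) ->
    \int[mu]_(t in J) f t = F (2 * pi) - F 0.
  move=> cf HF; have D (t : R) : is_derive t 1 F (f t).
    by apply: (@is_derive_quad R F t (f t) 1 K) => // u; exact: HF.
  have cF : continuous F.
    by move=> t; apply/differentiable_continuous/derivable1_diffP; case: (D t).
  rewrite /Rintegral (@continuous_FTC2 _ f F) //.
  - exact: continuous_subspaceT.
  - split=> [t _||]; first by case: (D t).
      exact/cvg_at_right_filter/cF.
    exact/cvg_at_left_filter/cF.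
  - by move=> t _; rewrite derive1E; case: (D t).
apply: complexP; rewrite /cint /= ?cReB ?cImB.
  apply: (F (Re \o P) (Re \o dP)) => [t|t u ut]; first exact: (cvg_Re (cdP t)).
  by rewrite /= -cReZ -!cReB; apply: le_trans (ReN _) (H t u ut).
apply: (F (Im \o P) (Im \o dP)) => [t|t u ut]; first exact: (cvg_Im (cdP t)).
by rewrite /= -cImZ -!cImB; apply: le_trans (ImN _) (H t u ut).
Qed.

End ComplexIntegral.

(** * Cauchy's formula by contraction of the circle, and the Poisson kernel *)

Section CauchyPoisson.
Context {R : realType}.
Local Notation C := R[i].
Local Notation N := (@modulus R).
Local Notation Re := (@complex.Re R).
Local Notation Im := (@complex.Im R).
Local Notation mu := (@lebesgue_measure R).
Local Notation J := (`[0, 2 * pi]%classic : set R).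
Implicit Types (f df : C -> C) (w z : C).

(* Subdividing [0, 1] into n steps bounds |I 0 - I 1| by M / n; this replaces
   differentiation under the integral sign in Cauchy's theorem. *)
Lemma quad_cst (I : R -> C) (M : R) : (forall s u, 0 < s <= 1 -> 0 <= u <= 1 ->
  N (I u - I s) <= M * (u - s) ^+ 2) -> I 0 = I 1.
Proof.
move=> H; have T n : (0 < n)%N -> forall k, (k <= n)%N ->
    N (I 0 - I (k%:R / n%:R)) <= k%:R * (M * (n%:R^-1) ^+ 2).
  move=> n0; elim=> [|k IH] kn; first by rewrite mul0r subrr N0 mul0r.
  have -> : I 0 - I (k.+1%:R / n%:R) = (I 0 - I (k%:R / n%:R)) +
    (I (k%:R / n%:R) - I (k.+1%:R / n%:R)) by ring.
  apply: le_trans (ND _ _) _; rewrite -[in leRHS]natr1 mulrDl mul1r.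
  have n0' : 0 < n%:R :> R by rewrite ltr0n.
  apply: lerD; first exact: (IH (ltnW kn)).
  have -> : M * n%:R^-1 ^+ 2 = M * (k%:R / n%:R - k.+1%:R / n%:R) ^+ 2.
    by rewrite -mulrBl -natr1 opprD addrA subrr add0r mulN1r sqrrN.
  (* Each step is expanded from its right end, which is never 0; this matches the hypothesis
     [0 < s], needed where [cint_df_seg] divides by [s]. *)
  apply: H.
    by rewrite divr_gt0 ?ltr0n //= ler_pdivrMr // mul1r ler_nat.
  by rewrite divr_ge0 //= ler_pdivrMr // mul1r ler_nat ltnW.
have T1 n : (0 < n)%N -> N (I 0 - I 1) <= M / n%:R.
  move=> n0; have n0' : n%:R != 0 :> R by rewrite pnatr_eq0 -lt0n.
  have := T n n0 n (leqnn n); rewrite divff // => /le_trans; apply.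
  by rewrite le_eqVlt; apply/orP; left; apply/eqP; field.
apply/eqP; rewrite -subr_eq0 -N_eq0 eq_le N_ge0 andbT.
apply/ler_addgt0Pr => e e0; rewrite add0r.
pose n := (Num.trunc (`|M| / e)).+1.
have n0 : 0 < n%:R :> R by rewrite ltr0n.
apply: le_trans (T1 n isT) _; rewrite ler_pdivrMr // mulrC -ler_pdivrMr //.
apply: le_trans (ltW (truncnS_gt _)).
by rewrite ler_wpM2r ?invr_ge0 ?(ltW e0) // ler_norm.
Qed.

(** A homotopy from the point [w] at [s = 0] to the unit circle at [s = 1]; convexity keeps it in
    the closed disk. *)
Definition seg w (s : R) (t : R) : C := w + s%:C%C * (expi t - w).

Lemma seg_bound w s t : N w <= 1 -> 0 <= s <= 1 -> N (seg w s t) <= 1.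
Proof.
move=> w1 /andP[s0 s1].
have -> : seg w s t = (1 - s)%:C%C * w + s%:C%C * expi t.
  by rewrite /seg rmorphB /= rmorph1; ring.
apply: le_trans (ND _ _) _; rewrite !NM !NR N_expi !ger0_norm ?subr_ge0 //.
have : (1 - s) * N w <= (1 - s) * 1 by rewrite ler_wpM2l ?subr_ge0.
lra.
Qed.

Lemma seg_lip w s t u : 0 <= s <= 1 ->
  N (seg w s u - seg w s t) <= 13 * `|u - t|.
Proof.
move=> /andP[s0 s1].
have -> : seg w s u - seg w s t = s%:C%C * (expi u - expi t) by rewrite /seg; ring.
rewrite NM NR ger0_norm //; apply: le_trans (ler_wpM2l s0 (expi_lip t u)) _.
by apply: ler_piMl; rewrite // mulr_ge0.
Qed.

Lemma continuous_seg w s (g : C -> C) (L : R) : N w <= 1 -> 0 <= s <= 1 -> 0 <= L ->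
  (forall x y, N x <= 1 -> N y <= 1 -> N (g y - g x) <= L * N (y - x)) ->
  continuous (fun t => g (seg w s t)).
Proof.
move=> w1 s01 L0 gL; apply: continuousC_lip => t _ _; exists (L * 13) => u _.
apply: le_trans (gL _ _ _ _) _; rewrite ?seg_bound //.
by rewrite -mulrA ler_wpM2l // seg_lip.
Qed.

Lemma continuousCM (g h : R -> C) : continuous g -> continuous h ->
  continuous (fun t => g t * h t).
Proof. by move=> cg ch t; exact: (cvgM (cg t) (ch t)). Qed.

Lemma expi2pi : expi (2 * pi) = expi 0 :> C.
Proof.
have -> : 2 * pi = pi *+ 2 :> R by rewrite mulr_natl.
by rewrite /expi cos2pi sin2pi cos0 sin0.
Qed.

(** Up to the factor [s * 'i], the integrand is the derivative in [t] of the periodic function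
    [f (seg w s t)]. *)
Lemma cint_df_seg f df K w s : qd 1 K f df -> N w <= 1 -> 0 < s <= 1 ->
  cint (fun t => df (seg w s t) * expi t) = 0.
Proof.
move=> F w1 /andP[s0 s1]; have s01 : 0 <= s <= 1 by rewrite ltW.
have K0 := qd_ge0 ler01 F.
have c0 : continuous (fun t => df (seg w s t)).
  apply: (continuous_seg w1 s01 (mulr_ge0 (ler0n _ 2) K0)) => x y; exact: qd_dlip F.
have c1 : continuous (fun t => df (seg w s t) * expi t).
  exact: (continuousCM c0 (@continuous_expi R)).
have : cint (fun t => (s%:C%C * 'i%C) * (df (seg w s t) * expi t)) =
    f (seg w s (2 * pi)) - f (seg w s 0).
  (* 169 is the square of the Lipschitz constant 13 of [seg_lip], and 12 comes from the remainder of
     [expi]. *)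
  apply: (@cint_FTC R (fun t => f (seg w s t)) _ (169 * K + 12 * K)).
  - by apply: (continuousCM _ c1) => t; exact: cvg_cst.
  - by rewrite addr_ge0 // mulr_ge0.
  move=> t u _; set zt := seg w s t; set zu := seg w s u.
  have zt1 : N zt <= 1 by exact: seg_bound.
  have zu1 : N zu <= 1 by exact: seg_bound.
  have [_ d1 d2] := F zt zu zt1 zu1.
  have -> : f zu - f zt - s%:C%C * 'i%C * (df zt * expi t) * (u - t)%:C%C =
    (f zu - f zt - df zt * (zu - zt)) +
    df zt * s%:C%C * (expi u - expi t - 'i%C * expi t * (u - t)%:C%C).
    by rewrite /zu /zt /seg; ring.
  apply: le_trans (ND _ _) _; rewrite mulrDl lerD //.
    apply: le_trans d2 _; rewrite [169 * K]mulrC -mulrA ler_wpM2l //.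
    have -> : 169 * `|u - t| ^+ 2 = (13 * `|u - t|) ^+ 2 by ring.
    by rewrite lerXn2r ?nnegrE ?N_ge0 ?mulr_ge0 // seg_lip.
  rewrite !NM NR (ger0_norm (ltW s0)).
  have -> : 12 * K * `|u - t| ^+ 2 = K * 1 * (12 * `|u - t| ^+ 2) by ring.
  apply: ler_pM; rewrite ?N_ge0 ?mulr_ge0 ?N_ge0 ?(ltW s0) //.
    by apply: ler_pM; rewrite ?N_ge0 ?(ltW s0).
  exact: expi_quad.
rewrite cintZ; last exact: cintegrable_cont.
rewrite /seg expi2pi subrr => /eqP; rewrite mulf_eq0 => /orP[|/eqP //].
by rewrite -N_eq0 NM NR Ni mulr1 normr_eq0 gt_eqF.
Qed.

(** Cauchy's formula. The derivative in [s] of the integral over [seg w s] has integrand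
    [df (seg w s t) * (expi t - w) * Kc t]; the hypothesis on [Kc] reduces it to
    [df (seg w s t) * expi t], which integrates to 0. So the values at [s = 1] and [s = 0] agree. *)
Lemma cint_seg_cst f df K w (Kc : R -> C) (B : R) : qd 1 K f df -> N w < 1 ->
  continuous Kc -> (forall t, N (Kc t) <= B) ->
  (forall t, (expi t - w) * Kc t = expi t) ->
  cint (fun t => f (expi t) * Kc t) = f w * cint Kc.
Proof.
move=> F /ltW w1 cK KB Kw.
have K0 := qd_ge0 ler01 F.
pose I s := cint (fun t => f (seg w s t) * Kc t).
have cf s : 0 <= s <= 1 -> continuous (fun t => f (seg w s t)).
  move=> s01; apply: (continuous_seg w1 s01 (mulr_ge0 (ler0n _ 3) K0)).
  by move=> x y; exact: qd_lip F.
have cdf s : 0 <= s <= 1 -> continuous (fun t => df (seg w s t)).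
  move=> s01; apply: (continuous_seg w1 s01 (mulr_ge0 (ler0n _ 2) K0)).
  by move=> x y; exact: qd_dlip F.
have : I 0 = I 1.
  apply: (@quad_cst I (4 * pi * (4 * K * B))) => s u /andP[s0 s1] u01.
  have s01 : 0 <= s <= 1 by rewrite ltW.
  have i1 : cintegrable (fun t => f (seg w u t) * Kc t).
    exact: (cintegrable_cont (continuousCM (cf _ _) cK)).
  have i2 : cintegrable (fun t => f (seg w s t) * Kc t).
    exact: (cintegrable_cont (continuousCM (cf _ _) cK)).
  have i3 : cintegrable (fun t => (u - s)%:C%C * (df (seg w s t) * expi t)).
    apply/cintegrableZ/cintegrable_cont.
    exact: (continuousCM (cdf _ s01) (@continuous_expi R)).
  have Z : cint (fun t => (u - s)%:C%C * (df (seg w s t) * expi t)) = 0.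
    rewrite cintZ; last first.
      apply/cintegrable_cont.
      exact: (continuousCM (cdf _ s01) (@continuous_expi R)).
    by rewrite (cint_df_seg F w1) ?mulr0 // s0.
  have -> : I u - I s = cint (fun t => f (seg w u t) * Kc t -
      f (seg w s t) * Kc t - (u - s)%:C%C * (df (seg w s t) * expi t)).
    by rewrite cintB ?Z ?subr0 ?cintB //; exact: cintegrableB.
  have -> : 4 * pi * (4 * K * B) * (u - s) ^+ 2 =
     4 * pi * (K * (2 * `|u - s|) ^+ 2 * B).
    by rewrite -[(u - s) ^+ 2]real_normK ?num_real //; ring.
  apply: cint_bound; first by apply: cintegrableB => //; exact: cintegrableB.
  move=> t; set zs := seg w s t; set zu := seg w u t.
  have zs1 : N zs <= 1 by exact: seg_bound.
  have zu1 : N zu <= 1 by exact: seg_bound.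
  have [_ _ d2] := F zs zu zs1 zu1.
  have -> : f zu * Kc t - f zs * Kc t - (u - s)%:C%C * (df zs * expi t) =
    (f zu - f zs - df zs * (zu - zs)) * Kc t.
    by rewrite -[X in df zs * X]Kw /zu /zs /seg rmorphB /=; ring.
  rewrite NM; apply: ler_pM; rewrite ?N_ge0 //.
  apply: le_trans d2 _; rewrite ler_wpM2l // lerXn2r ?nnegrE ?N_ge0 ?mulr_ge0 //.
  have -> : zu - zs = (u - s)%:C%C * (expi t - w).
    by rewrite /zu /zs /seg rmorphB /=; ring.
  rewrite NM NR mulrC ler_wpM2r //.
  by apply: le_trans (NB _ _) _; rewrite N_expi; lra.
rewrite /I; under eq_fun do rewrite /seg mul0r addr0.
rewrite cintZ; last exact: cintegrable_cont.
move=> ->; apply: eq_cint => t _; rewrite /seg mul1r addrC subrK //.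
Qed.

Lemma cint_mean f df K : qd 1 K f df ->
  cint (fun t => f (expi t)) = f 0 * (2 * pi)%:C%C.
Proof.
move=> F; have := @cint_seg_cst f df K 0 (fun=> 1) 1 F _ _ _ _.
rewrite cint_cst mul1r => <- //; rewrite ?N0 ?N1 //.
- by apply: eq_cint => t _; rewrite mulr1.
- by move=> t; exact: cvg_cst.
- by move=> t; rewrite subr0 mulr1.
Qed.

(** This is the factor that turns the Cauchy kernel into the Poisson kernel in [pkE]; it is
    [qd_kern] at the boundary point 1 after multiplication by the conjugate of [w]. *)
Lemma qd_cauchy w : N w < 1 -> exists K df,
  qd 1 K (fun z => (1 - (w^*)%C * z)^-1) df.
Proof.
move=> w1; have G := qd_scal (w^*)%C (qd_id (lexx (1 : R))).
have F : qd (N w) _ (fun z => (1 - z)^-1) (fun z => (1 - z) ^- 2) :=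
  @qd_kern R (N w) 1 _ (N1).
have w01 : 0 <= N w < 1 by rewrite N_ge0.
have := qd_comp (lexx _) G (F w01); do 2 eexists; apply: H => z z1.
by rewrite NM NJ ler_piMr ?N_ge0.
Qed.

(** The Poisson kernel, normalized to have integral [2 * pi] over the period. *)
Definition pk w (t : R) : R := (1 - N w ^+ 2) / N (expi t - w) ^+ 2.

Lemma continuous_pole (g : R -> C) : continuous g -> (forall t, g t != 0) ->
  continuous (fun t => (g t)^-1).
Proof. by move=> cg g0 t; exact: (cvgV (g0 t) (cg t)). Qed.

Lemma continuous_expiB w : continuous (fun t : R => expi t - w : C).
Proof.
by move=> t; exact: (cvgB (@continuous_expi R t) (cvg_cst w)).
Qed.

Lemma cint_conj (h : R -> C) : cintegrable h ->
  cint (fun t => (h t)^*)%C = ((cint h)^*)%C.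
Proof.
move=> [h1 h2]; apply: complexP; rewrite /cint /=.
  by apply: eq_Rintegral => t _; case: (h t).
rewrite -[RHS]mulN1r -RintegralZl //.
by apply: eq_Rintegral => t _; rewrite mulN1r; case: (h t).
Qed.

Lemma expiJ (t : R) : ((expi t)^*)%C * expi t = 1 :> C.
Proof. by rewrite mulrC NconjM N_expi expr1n. Qed.

Lemma conj_kern (E w : C) : (E^*)%C * E = 1 -> E - w != 0 ->
  ((E / (E - w))^*)%C = (1 - (w^*)%C * E)^-1.
Proof.
move=> EE e1.
have -> : ((E / (E - w))^*)%C = (E^*)%C / ((E^*)%C - (w^*)%C).
  by rewrite (fmorph_div conjc) (rmorphB conjc).
have : (E^*)%C - (w^*)%C != 0 by rewrite -(rmorphB conjc) conjc_eq0.
have : E != 0 by apply: contra_eq_neq EE => ->; rewrite mulr0 eq_sym oner_neq0.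
move: EE; move: (E^*)%C (w^*)%C => E' w' EE e0 e2.
have -> : 1 - w' * E = (E' - w') * E by rewrite mulrBl EE.
rewrite invfM mulrC; congr (_ * _).
by apply: (mulIf e0); rewrite EE mulVf.
Qed.

(** On the circle the conjugate of the Cauchy kernel is the boundary value of 1 / (1 - conj(w) z),
    whose mean is its value 1 at the origin. *)
Lemma cint_kern w : N w < 1 ->
  cint (fun t => expi t / (expi t - w)) = (2 * pi)%:C%C.
Proof.
move=> w1; have [K [df F]] := qd_cauchy w1.
have := cint_mean F; rewrite mulr0 subr0 invr1 mul1r.
move=> /(congr1 conjc); rewrite conjc_real => <-.
have nz t : 1 - (w^*)%C * expi t != 0.
  apply: kern_neq0; first exact: N1.
  by rewrite NM NJ N_expi mulr1.
rewrite -cint_conj.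
  apply: eq_cint => t _; rewrite -[LHS]conjcK; congr conjc.
  by apply: conj_kern; rewrite ?expiJ ?kern_neq0 ?N_expi.
apply/cintegrable_cont/continuous_pole => // t.
apply: (cvgB (cvg_cst _)); exact: (cvgM (cvg_cst _) (@continuous_expi R t)).
Qed.

Lemma pk_ge0 w t : N w < 1 -> 0 <= pk w t.
Proof.
by move=> w1; rewrite divr_ge0 ?sqr_ge0 // subr_ge0 exprn_ile1 ?N_ge0 ?ltW.
Qed.

Lemma pkE w t : N w < 1 -> (pk w t)%:C%C =
  (1 - N w ^+ 2)%:C%C * (1 - (w^*)%C * expi t)^-1 * (expi t / (expi t - w)).
Proof.
move=> w1; have e1 : expi t - w != 0 by rewrite kern_neq0 // N_expi.
have -> : 1 - (w^*)%C * expi t = expi t * (expi t - w)^*%C.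
  by rewrite rmorphB /= mulrBr [_ * (expi t)^*%C]mulrC expiJ [_ * expi t]mulrC.
have e2 : (expi t - w)^*%C != 0 by rewrite conjc_eq0.
rewrite /pk rmorphM /= fmorphV /= -NconjM.
move: (expi t - w)^*%C e2 => D' e2; move: (expi t - w) e1 => D e1.
by field; rewrite e1 e2 expi_neq0.
Qed.

Lemma pk_bound w t : N w < 1 -> pk w t <= (1 - N w) ^- 2.
Proof.
move=> w1; have d0 : 0 < 1 - N w by rewrite subr_gt0.
have d1 : 1 - N w <= N (expi t - w) by rewrite N_kern ?N_expi.
rewrite /pk -[leRHS]mul1r ler_pM ?invr_ge0 ?sqr_ge0 //.
- by rewrite subr_ge0 exprn_ile1 ?N_ge0 ?ltW.
- by rewrite gerBl sqr_ge0.
by rewrite lef_pV2 ?posrE ?exprn_gt0 ?lerXn2r ?nnegrE ?N_ge0 ?(ltW d0) //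
  (lt_le_trans d0).
Qed.

Lemma continuous_pk w : N w < 1 -> continuous (pk w).
Proof.
move=> w1 t; apply: cvgM; first exact: cvg_cst.
have c : N (expi u - w) @[u --> t] --> N (expi t - w).
  exact: (cvg_modulus (@continuous_expiB w t)).
apply: cvgV; last exact: (cvgM c c).
by rewrite expf_neq0 // N_eq0 kern_neq0 ?N_expi.
Qed.

(** Cauchy's formula for the product of [f] with (1 - |w|^2) / (1 - conj(w) z), a factor equal to 1
    at [w]. *)
Lemma poisson f df K w : qd 1 K f df -> N w < 1 ->
  cint (fun t => f (expi t) * (pk w t)%:C%C) = f w * (2 * pi)%:C%C.
Proof.
move=> F w1; have [L [dg G]] := qd_cauchy w1.
have H := qd_mul (lexx _) F (qd_scal (1 - N w ^+ 2)%:C%C G).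
have e1 t : expi t - w != 0 by rewrite kern_neq0 // N_expi.
have cK : continuous (fun t => expi t / (expi t - w) : C).
  apply: (continuousCM (@continuous_expi R)).
  exact: (continuous_pole (@continuous_expiB w)).
have KB t : N (expi t / (expi t - w)) <= (1 - N w)^-1.
  rewrite NM NV N_expi mul1r lef_pV2 ?posrE ?N_gt0 ?subr_gt0 //.
  by rewrite N_kern // N_expi.
have Kw t : (expi t - w) * (expi t / (expi t - w)) = expi t.
  by rewrite mulrCA divff ?mulr1.
have := cint_seg_cst H w1 cK KB Kw; rewrite cint_kern // => E.
transitivity (f w * ((1 - N w ^+ 2)%:C%C * (1 - (w^*)%C * w)^-1) * (2 * pi)%:C%C).
  by rewrite -E; apply: eq_cint => t _; rewrite pkE // !mulrA.
congr (_ * _); rewrite [_ * w]mulrC NconjM rmorphB /= rmorph1 divff ?mulr1 //.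
rewrite -(rmorph1 (real_complex R)) -rmorphB /= -(rmorph0 (real_complex R)).
by apply/eqP => /complexI/eqP; rewrite gt_eqF // subr_gt0 exprn_ilt1 ?N_ge0.
Qed.

Lemma Rintegral_pk w : N w < 1 -> \int[mu]_(t in J) pk w t = 2 * pi.
Proof.
move=> w1; have := poisson (@qd_cst R 1 (1 : C)) w1.
rewrite /cst mul1r => E; rewrite -[RHS]/(Re (2 * pi)%:C%C) -E; rewrite /cint /=.
by apply: eq_Rintegral => t _; rewrite mul1r mul0r subr0.
Qed.

(** This stands for analyticity throughout: the constant of [qd] may blow up as the disks exhaust
    the unit disk. *)
Definition smooth f df := forall r, 0 <= r < 1 -> exists K, qd r K f df.

Lemma qd_dilate f df K r : 0 <= r <= 1 -> qd r K f df ->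
  qd 1 K (fun z => f (r%:C%C * z)) (fun z => r%:C%C * df (r%:C%C * z)).
Proof.
move=> /andP[r0 r1] F x y x1 y1.
have h z : N z <= 1 -> N (r%:C%C * z) <= r.
  by move=> z1; rewrite NM NR ger0_norm // ler_piMr.
have [f1 f2 f3] := F _ _ (h x x1) (h y y1).
have K0 : 0 <= K by exact: le_trans (N_ge0 _) f1.
split=> //.
  by rewrite NM NR ger0_norm //; apply: le_trans f2; rewrite ler_piMl ?N_ge0.
rewrite -mulrBr in f3.
have -> : r%:C%C * df (r%:C%C * x) * (y - x) =
  df (r%:C%C * x) * (r%:C%C * (y - x)) by ring.
apply: le_trans f3 _; rewrite ler_wpM2l // lerXn2r ?nnegrE ?N_ge0 //.
by rewrite NM NR ger0_norm // ler_piMl ?N_ge0.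
Qed.

Lemma poisson_circle f df r w : smooth f df -> 0 <= r < 1 -> N w < 1 ->
  cint (fun t => f (r%:C%C * expi t) * (pk w t)%:C%C) =
    f (r%:C%C * w) * (2 * pi)%:C%C.
Proof.
move=> F /[dup] r01 /andP[r0 r1] w1; have [K FK] := F r r01.
have r01' : 0 <= r <= 1 by rewrite r0 ltW.
exact: (poisson (qd_dilate r01' FK) w1).
Qed.

Lemma smooth_continuous_circle f df r : smooth f df -> 0 <= r < 1 ->
  continuous (fun t => f (r%:C%C * expi t)).
Proof.
move=> F /[dup] r01 /andP[r0 r1]; have [K FK] := F r r01.
have K0 := qd_ge0 r0 FK.
have h t : N (r%:C%C * expi t) <= r by rewrite NM NR ger0_norm // N_expi mulr1.
apply: continuousC_lip => t _ _; exists (3 * K * 13) => u _.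
apply: le_trans (qd_lip (ltW r1) FK (h t) (h u)) _.
rewrite -!mulrA ler_wpM2l // ler_wpM2l // -mulrBr NM NR ger0_norm //.
apply: le_trans (expi_lip t u); by rewrite ler_piMl ?N_ge0 // ltW.
Qed.

Lemma smooth_derive f df z : smooth f df -> N z < 1 -> is_derive z 1 f (df z).
Proof.
move=> F z1; pose r := (1 + N z) / 2.
have zr : N z <= r by rewrite /r; lra.
have r01 : 0 <= r < 1 by rewrite /r; have := N_ge0 z; lra.
have [K FK] := F r r01.
have K0 := qd_ge0 (proj1 (andP r01)) FK.
apply: (@is_derive_quad C f z (df z) ((1 - N z) / 2)%:C%C K%:C%C).
- by rewrite ltcR divr_gt0 // subr_gt0.
- by rewrite lecR.
move=> y; rewrite !normE ltcR => yz; rewrite -rmorphXn -rmorphM lecR.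
have yr : N y <= r.
  by rewrite -[y](subrK z); apply: le_trans (ND _ _) _; rewrite /r; lra.
by have [_ _] := FK z y zr yr.
Qed.

Lemma smooth_analytic f df : smooth f df -> analytic f.
Proof. by move=> F z; rewrite diskE => /(smooth_derive F)[]. Qed.

Lemma smooth_cvg f df z : smooth f df -> N z < 1 -> f y @[y --> z] --> f z.
Proof.
move=> F /(smooth_derive F)[d _].
exact/differentiable_continuous/derivable1_diffP.
Qed.

End CauchyPoisson.

(** * The maximum principle for bounded functions with radial boundary bounds *)

Section MaximumPrinciple.
Context {R : realType}.
Local Notation C := R[i].
Local Notation N := (@modulus R).
Local Notation Re := (@complex.Re R).
Local Notation Im := (@complex.Im R).
Local Notation mu := (@lebesgue_measure R).
Local Notation J := (`[0, 2 * pi]%classic : set R).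
Implicit Types (f df : C -> C) (w z : C).

Lemma measurableJ_cont (u : R -> R) : continuous u -> measurable_fun J u.
Proof.
move=> cu; apply: measurable_funS (continuous_measurable_fun cu) => //.
Qed.

Definition aeJ (P : R -> Prop) :=
  almost_everywhere mu [set t | 0 <= t <= 2 * pi -> P t].

Lemma ae_filter_lebesgue : Filter (almost_everywhere mu).
Proof. exact: ae_filter_ringOfSetsType. Qed.

Lemma aeJS (P Q : R -> Prop) : (forall t, 0 <= t <= 2 * pi -> P t -> Q t) ->
  aeJ P -> aeJ Q.
Proof.
move=> PQ; apply: (@filterS _ _ ae_filter_lebesgue) => t H Jt.
exact: PQ (H Jt).
Qed.

Lemma aeJI (P Q : R -> Prop) : aeJ P -> aeJ Q -> aeJ (fun t => P t /\ Q t).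
Proof.
apply: (@filterS2 _ _ ae_filter_lebesgue) => t H1 H2 Jt.
by split; [exact: H1|exact: H2].
Qed.

Lemma dominatedJ (u_ : nat -> R -> R) (u g : R -> R) :
  (forall n, measurable_fun J (u_ n)) -> measurable_fun J u ->
  aeJ (fun t => u_ n t @[n --> \oo] --> u t) ->
  mu.-integrable J (EFin \o g) ->
  (forall n t, `|u_ n t| <= g t) ->
  \int[mu]_(t in J) u_ n t @[n --> \oo] --> \int[mu]_(t in J) u t.
Proof.
move=> m_ m cv ig ug.
have m1 n : measurable_fun J (EFin \o u_ n) by exact/measurable_EFinP.
have m2 : measurable_fun J (EFin \o u) by exact/measurable_EFinP.
have h1 : {ae (lebesgue_measure : {measure set _ -> \bar R}),
    forall t, J t -> (EFin \o u_ n) t @[n --> \oo] --> (EFin \o u) t}.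
  apply: (@filterS _ _ ae_filter_lebesgue) cv => t H Jt.
  apply: cvg_EFin; first exact: nearW.
  by apply: H; move: Jt; rewrite /= in_itv.
have h2 : {ae (lebesgue_measure : {measure set _ -> \bar R}), forall t n, J t -> (`|(EFin \o u_ n) t| <= (EFin \o g) t)%E}.
  by apply: aeW => t n Jt; rewrite lee_fin ug.
have [iu _ L] := dominated_convergence measurableJ m1 m2 h1 ig h2.
rewrite /Rintegral; apply: fine_cvg; rewrite fineK; last exact: integrable_fin_num.
by apply: L.
Qed.

(** Dominated convergence concerns sequences, so radii tending to 1 are sampled along this one. *)
Definition rho (n : nat) : R := n%:R / n.+1%:R.

Lemma rho01 n : 0 <= rho n < 1.
Proof.
by rewrite /rho divr_ge0 //= ltr_pdivrMr ?ltr0n // mul1r ltr_nat.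
Qed.

Lemma rhoE n : rho n = 1 - n.+1%:R^-1.
Proof.
have h : 1 + n%:R != 0 :> R by rewrite addrC natr1 pnatr_eq0.
by rewrite /rho -natr1 addrC; field.
Qed.

Lemma rho_cvg : rho n @[n --> \oo] --> (1:R).
Proof.
rewrite (_ : rho = fun n => 1 - harmonic n); last by apply/funext => n; exact: rhoE.
rewrite -[X in _ --> X]subr0; apply: cvgB; [exact: cvg_cst|exact: cvg_harmonic].
Qed.

Lemma rho_at_left : rho n @[n --> \oo] --> (1:R)^'-.
Proof.
move=> A /= HA; rewrite /nbhs /= /at_left /within /= in HA.
have H : \forall n \near \oo, rho n < 1 -> A (rho n) := rho_cvg HA.
suff : \forall n \near \oo, A (rho n) by [].
by apply: filterS H => n; apply; have /andP[] := rho01 n.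
Qed.

(** Subharmonicity of |f|: a rotation first makes the value at [w] nonnegative, and only then is the
    real part taken under the integral, so that no constant is lost. *)
Lemma smooth_pos_poisson f df r w : smooth f df -> 0 <= r < 1 -> N w < 1 ->
  N (f (r%:C%C * w)) * (2 * pi) <=
  \int[mu]_(t in J) (N (f (r%:C%C * expi t)) * pk w t).
Proof.
move=> F r01 w1; have [c c1 cE] := N_rot (f (r%:C%C * w)).
have cf := smooth_continuous_circle F r01.
have cp : continuous (fun t => (pk w t)%:C%C : C).
  have cpk : continuous (pk w) := continuous_pk w1.
  move=> t; apply/cvgCP => e e0.
  have /cvgrPdist_lt/(_ _ e0) := cpk t.
  by apply: filterS => u; rewrite -rmorphB NR.
have E : (N (f (r%:C%C * w)) * (2 * pi))%:C%C =
   cint (fun t => c * (f (r%:C%C * expi t) * (pk w t)%:C%C)).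
  rewrite cintZ; last exact: (cintegrable_cont (continuousCM cf cp)).
  by rewrite (poisson_circle F) // [RHS]mulrA -cE -rmorphM.
have [iRe _] := cintegrableZ c (cintegrable_cont (continuousCM cf cp)).
rewrite -[leLHS]/(Re (N (f (r%:C%C * w)) * (2 * pi))%:C%C) E /cint /=.
apply: le_Rintegral => //.
  apply: integrableJ => t.
  exact: (cvgM (cvg_modulus (cf t)) (continuous_pk w1 (x:=t))).
move=> t _; apply: le_trans (ler_norm _) _; apply: le_trans (ReN _) _.
by rewrite !NM c1 mul1r NR ger0_norm // pk_ge0.
Qed.

Lemma smooth_cvg_dilate f df w : smooth f df -> N w < 1 ->
  f ((rho n)%:C%C * w) @[n --> \oo] --> f w.
Proof.
move=> F w1; have := smooth_cvg F w1; apply: cvg_comp.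
apply/cvgCP => e e0; near=> n.
rewrite -{1}[w]mul1r -mulrBl NM -(rmorph1 (real_complex R)) -rmorphB NR.
apply: le_lt_trans (_ : `|1 - rho n| < e); first by rewrite ler_piMr // ltW.
near: n; have /cvgrPdist_lt := rho_cvg; exact.
Unshelve. all: by end_near. Qed.

(** The bound [B] enters only as a dominating constant when the circles expand, but it is
    indispensable: exp((1 + z) / (1 - z)) has radial limits of modulus 1 almost everywhere. *)
Lemma max_principle f df (B K : R) : smooth f df ->
  (forall z, N z < 1 -> N (f z) <= B) ->
  aeJ (fun t => forall e, 0 < e ->
    \forall r \near (1:R)^'-, N (f (r%:C%C * expi t)) <= K + e) ->
  0 <= K -> forall w, N w < 1 -> N (f w) <= K.
Proof.
move=> F fB ae K0 w w1.
have B0 : 0 <= B by apply: le_trans (fB 0 _); rewrite ?N_ge0 ?N0.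
(* Only an upper bound for the radial upper limit is given; taking the maximum with [K] turns it
   into genuine convergence to [K]. *)
pose u_ n t := Num.max (N (f ((rho n)%:C%C * expi t))) K * pk w t.
have cN n : continuous (fun t => N (f ((rho n)%:C%C * expi t))).
  have cf : continuous (fun t => f ((rho n)%:C%C * expi t)).
    exact: smooth_continuous_circle F (rho01 n).
  by move=> t; exact: (cvg_modulus (cf t)).
have mp : measurable_fun J (pk w) by exact: measurableJ_cont (continuous_pk w1).
have Nrho n t : N ((rho n)%:C%C * expi t) < 1.
  by have /andP[r0 r1] := rho01 n; rewrite NM NR N_expi mulr1 ger0_norm.
have mu_ n : measurable_fun J (u_ n).
  apply: measurable_funM => //; apply: measurable_maxr => //.
  exact: measurableJ_cont (cN n).
have ub n t : `|u_ n t| <= (B + K) * pk w t.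
  rewrite normrM [ `|pk w t|]ger0_norm ?pk_ge0 // ler_wpM2r ?pk_ge0 //.
  rewrite ger0_norm ?le_max ?N_ge0 // ge_max lerDr B0 andbT.
  by rewrite (le_trans (fB _ (Nrho n t))) // lerDl.
have L : \int[mu]_(t in J) u_ n t @[n --> \oo] -->
    \int[mu]_(t in J) (K * pk w t).
  apply: (@dominatedJ _ _ (fun t => (B + K) * pk w t)) => //.
  - by apply: measurable_funM.
  - apply: aeJS ae => t tJ H; apply: cvgM; last exact: cvg_cst.
    apply/cvgrPdist_le => e e0; near=> n.
    rewrite distrC ger0_norm ?subr_ge0 ?le_max ?lexx ?orbT //.
    rewrite lerBlDr addrC ge_max lerDl (ltW e0) andbT.
    by near: n; exact: (rho_at_left (H e e0)).
  - by apply: integrableJZ; exact: integrableJ (continuous_pk w1).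
have i0 : mu.-integrable J (EFin \o pk w) by exact: integrableJ (continuous_pk w1).
rewrite RintegralZl ?Rintegral_pk // in L.
have pi0 : 0 < 2 * pi :> R by rewrite mulr_gt0 // pi_gt0.
rewrite -(ler_pM2r pi0).
apply: (ler_cvg_to _ L (f := fun n => N (f ((rho n)%:C%C * w)) * (2 * pi))).
  by apply: cvgM; [exact: (cvg_modulus (smooth_cvg_dilate F w1))|exact: cvg_cst].
apply: nearW => n; apply: le_trans (smooth_pos_poisson F (rho01 n) w1) _.
apply: le_Rintegral => //.
- apply: integrableJ => t; exact: (cvgM (cN n t) (continuous_pk w1 (x:=t))).
- apply: (@le_integrable _ _ _ _ _ measurableJ _ (EFin \o (fun t => (B + K) * pk w t))).
  + by apply/measurable_EFinP; exact: mu_.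
  + move=> t _; rewrite /= lee_fin; apply: le_trans (ub n t) _; exact: ler_norm.
  + exact: integrableJZ.
- by move=> t _; rewrite ler_wpM2r ?pk_ge0 // le_max lexx.
Unshelve. all: by end_near. Qed.

End MaximumPrinciple.

(** * Radial limits of Poisson integrals; outer functions *)

Section ApproximateIdentity.
Context {R : realType}.
Local Notation mu := (@lebesgue_measure R).
Local Notation J := (`[0, 2 * pi]%classic : set R).

Lemma Rintegral_sumJ (n : nat) (g : nat -> R -> R) :
  (forall j, mu.-integrable J (EFin \o g j)) ->
  mu.-integrable J (EFin \o (fun t => \sum_(j < n) g j t)) /\
  \int[mu]_(t in J) (\sum_(j < n) g j t) = \sum_(j < n) \int[mu]_(t in J) g j t.
Proof.
move=> ig; elim: n => [|n [IH1 IH2]].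
  rewrite big_ord0; split.
    by apply: integrableJ => t; under eq_fun do rewrite big_ord0; exact: cvg_cst.
  by under eq_Rintegral do rewrite big_ord0; rewrite Rintegral_cstJ mul0r.
split.
  have := integrableD measurableJ IH1 (ig n); apply: eq_integrable => // t _.
  by rewrite /= big_ord_recr.
under eq_Rintegral do rewrite big_ord_recr.
by rewrite RintegralD // IH2 big_ord_recr.
Qed.

Lemma dyadic_scale (e d : R) : 0 < e < d ->
  exists n, 2 ^+ n * e < d /\ d <= 2 ^+ n.+1 * e.
Proof.
move=> /andP[e0 ed].
have ex : exists m, d <= 2 ^+ m * e.
  exists (Num.trunc (d / e)).+1; rewrite -ler_pdivrMr //.
  apply: (le_trans (ltW (truncnS_gt _))).
  by rewrite -natrX ler_nat ltnW // ltn_expl.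
case: (ex_minnP ex) => -[|n] dn min; first by rewrite expr0 mul1r leNgt ed in dn.
exists n; split=> //; rewrite ltNge; apply/negP => /min; by rewrite ltnn.
Qed.

(* The kernel is dominated on the dyadic shell |y - x| ~ 2^j e by 4^-j / e. *)
Lemma dyadic_kernel (P W : R -> R) (x e d c eta : R) :
  0 < e < d -> 0 <= c -> 0 <= eta ->
  (forall y, 0 <= W y) -> mu.-integrable J (EFin \o W) ->
  (forall s, 0 < s < d -> \int[mu]_(y in J) (W \_ (ball x s)) y <= eta * s) ->
  continuous P ->
  (forall y, 0 <= y <= 2 * pi ->
     [/\ 0 <= P y, P y <= c / e & P y * (y - x) ^+ 2 <= c * e]) ->
  \int[mu]_(y in J) (P y * W y) <=
    8 * c * eta + 4 * c * e / d ^+ 2 * \int[mu]_(y in J) W y.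
Proof.
move=> /[dup] ed /andP[e0 e_d] c0 eta0 W0 iW Wd cP PB.
have d0 : 0 < d by exact: lt_trans e_d.
have [n [nd dn]] := dyadic_scale ed.
pose B j : set R := ball x (2 ^+ j * e).
(* Between the radii 2^(j-1) e and 2^j e the kernel is at most c e / (2^(j-1) e)^2 = (4 c / e) 4^-j.
   The majorant is spread over the whole ball, where [Wd] applies. *)
pose g j y := (4 * c / e * 4^-1 ^+ j) * (W \_ (B j)) y.
have mW : measurable_fun J W.
  by apply/measurable_EFinP; apply: measurable_int iW.
have iWB j : mu.-integrable J (EFin \o (W \_ (B j))).
  apply: (@le_integrable _ _ _ _ _ measurableJ _ (EFin \o W)) => //.
    apply/measurable_EFinP/measurable_restrict => //; first exact: measurable_ball.
    apply: measurable_funS mW; first exact: measurableJ.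
    exact: subIsetl.
  move=> y _; rewrite /= lee_fin /patch; case: ifP => _; last by rewrite normr0.
  by [].
have ig j : mu.-integrable J (EFin \o g j) by exact: integrableJZ.
have [isum Esum] := Rintegral_sumJ n.+1 ig.
(* Points outside the last ball satisfy [d <= 2 * |y - x|], so there the decay of the kernel gives
   the constant 4 c e / d^2. *)
set tl := 4 * c * e / d ^+ 2.
have tl0 : 0 <= tl by rewrite divr_ge0 ?sqr_ge0 // !mulr_ge0 // ltW.
have itl : mu.-integrable J (EFin \o (fun y => tl * W y)) by exact: integrableJZ.
have g0 j y : 0 <= g j y.
  rewrite mulr_ge0 //; last by rewrite /patch; case: ifP.
  by rewrite mulr_ge0 ?exprn_ge0 ?invr_ge0 // divr_ge0 ?(ltW e0) // mulr_ge0.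
have pt y : 0 <= y <= 2 * pi -> P y * W y <= \sum_(j < n.+1) g j y + tl * W y.
  move=> /PB[P0 P1 P2].
  have [far|near] := leP (2 ^+ n * e) `|y - x|.
    apply: (@le_trans _ _ (tl * W y)); last by rewrite lerDr sumr_ge0.
    rewrite ler_wpM2r // /tl ler_pdivlMr ?exprn_gt0 //.
    have d2 : d <= 2 * `|y - x|.
      by apply: le_trans dn _; rewrite exprS -mulrA ler_pM2l.
    apply: (@le_trans _ _ (P y * (2 * `|y - x|) ^+ 2)).
      by rewrite ler_wpM2l // lerXn2r ?nnegrE ?mulr_ge0 // ltW.
    rewrite exprMn real_normK ?num_real // mulrCA.
    have -> : 4 * c * e = 2 ^+ 2 * (c * e) by ring.
    by rewrite ler_wpM2l // exprn_ge0.
  have ex : exists j, `|y - x| < 2 ^+ j * e by exists n.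
  case: (ex_minnP ex) => j jy jmin.
  have jn : (j < n.+1)%N by rewrite ltnS jmin.
  apply: (@le_trans _ _ (g j y)); last first.
    rewrite (bigD1 (Ordinal jn)) //= -addrA lerDl addr_ge0 ?sumr_ge0 //.
    by rewrite mulr_ge0.
  have -> : g j y = 4 * c / e * 4^-1 ^+ j * W y.
    by rewrite /g patchE mem_set // /B -ball_normE /= distrC.
  rewrite ler_wpM2r //; case: j jy jmin {jn} => [_ _|j jy jmin].
    rewrite expr0 mulr1; apply: le_trans P1 _.
    by rewrite -!mulrA ler_peMl ?divr_ge0 ?(ltW e0) // ler1n.
  have nj : 2 ^+ j * e <= `|y - x|.
    by rewrite leNgt; apply/negP => /jmin; rewrite ltnn.
  have p0 : 0 < (2 ^+ j * e) ^+ 2 by rewrite exprn_gt0 // mulr_gt0 // exprn_gt0.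
  rewrite -(ler_pM2r p0).
  apply: (@le_trans _ _ (P y * (y - x) ^+ 2)).
    rewrite ler_wpM2l // -[leRHS]real_normK ?num_real // lerXn2r ?nnegrE //.
    by rewrite mulr_ge0 ?exprn_ge0 // ltW.
  apply: le_trans P2 _; rewrite le_eqVlt; apply/orP; left; apply/eqP.
  have -> : 4^-1 ^+ j.+1 = 4^-1 * ((2 ^+ j) ^+ 2)^-1 :> R.
    by rewrite exprS -exprM mulnC exprM exprVn; congr (_ * (_ ^+ _)^-1); ring.
  by field; rewrite expf_neq0 ?gt_eqF // pnatr_eq0.
have iPW : mu.-integrable J (EFin \o (fun y => P y * W y)).
  apply: (@le_integrable _ _ _ _ _ measurableJ _
    (EFin \o (fun y => \sum_(j < n.+1) g j y + tl * W y))).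
  - apply/measurable_EFinP/measurable_funM; first exact: measurableJ_cont.
    exact: mW.
  - move=> y; rewrite /= in_itv /= => yJ; rewrite lee_fin.
    have [P0 _ _] := PB y yJ.
    rewrite ger0_norm ?mulr_ge0 // (le_trans (pt y yJ)) // ler_norm //.
  - have := integrableD measurableJ isum itl.
    by apply: eq_integrable => // t _.
apply: (@le_trans _ _ (\int[mu]_(y in J) (\sum_(j < n.+1) g j y + tl * W y))).
  apply: le_Rintegral => //.
  have := integrableD measurableJ isum itl.
  by apply: eq_integrable => // t _.
rewrite RintegralD // RintegralZl // lerD2r Esum.
have S m : \sum_(j < m) (2^-1 : R) ^+ j = 2 - 2 * 2^-1 ^+ m.
  elim: m => [|m IH]; first by rewrite big_ord0 expr0; ring.
  by rewrite big_ord_recr /= IH exprS; field.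
(* The mass [eta * 2 ^+ j * e] of a ball against the weight 4^-j leaves a geometric series of ratio
   1/2, with sum at most [8 * c * eta]. *)
apply: (@le_trans _ _ (\sum_(j < n.+1) 4 * c * eta * 2^-1 ^+ j)).
  apply: ler_sum => j _; rewrite RintegralZl //.
  have jd : 0 < 2 ^+ j * e < d.
    rewrite mulr_gt0 ?exprn_gt0 //=; apply: le_lt_trans nd.
    by rewrite ler_pM2r // ler_weXn2l ?ler1n // -ltnS.
  apply: le_trans (ler_wpM2l _ (Wd _ jd)) _.
    by rewrite mulr_ge0 ?exprn_ge0 ?invr_ge0 // divr_ge0 ?(ltW e0) // mulr_ge0.
  rewrite le_eqVlt; apply/orP; left; apply/eqP.
  have -> : 4^-1 ^+ j = 2^-1 ^+ j * 2^-1 ^+ j :> R.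
    by rewrite -exprMn; congr (_ ^+ _); field.
  rewrite !exprVn; field; by rewrite expf_neq0 ?gt_eqF // pnatr_eq0.
rewrite -mulr_sumr S.
have : 0 <= 4 * c * eta * (2 * 2^-1 ^+ n.+1).
  by rewrite !mulr_ge0 // exprn_ge0 // invr_ge0.
lra.
Qed.

End ApproximateIdentity.

(** * Radial limits of Poisson integrals at Lebesgue points *)

Section Fatou.
Context {R : realType}.
Local Notation C := R[i].
Local Notation N := (@modulus R).
Local Notation Re := (@complex.Re R).
Local Notation Im := (@complex.Im R).
Local Notation mu := (@lebesgue_measure R).
Local Notation J := (`[0, 2 * pi]%classic : set R).

Lemma N_chord (x y : R) : N (expi y - expi x) ^+ 2 = 2 - 2 * cos (y - x).
Proof.
rewrite Nsq /expi /= cosB.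
have := cos2Dsin2 x; have := cos2Dsin2 y; move=> h1 h2; lra.
Qed.

Lemma chord_small (x y : R) : `|y - x| <= 24^-1 ->
  4^-1 * (y - x) ^+ 2 <= N (expi y - expi x) ^+ 2.
Proof.
move=> h; set s := `|y - x|; have s0 : 0 <= s by exact: normr_ge0.
have -> : 4^-1 * (y - x) ^+ 2 = (s / 2) ^+ 2.
  by rewrite -[(y - x) ^+ 2]real_normK ?num_real // -/s; field.
rewrite lerXn2r ?nnegrE ?N_ge0 ?divr_ge0 //.
have -> : expi y - expi x = 'i%C * expi x * (y - x)%:C%C +
  (expi y - expi x - 'i%C * expi x * (y - x)%:C%C) by ring.
set q := _ - _ * _; set p : C := 'i%C * _ * _.
have pN : N p = s by rewrite !NM Ni N_expi NR !mul1r.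
have qN : N q <= 12 * s ^+ 2 by exact: expi_quad.
have := ND (p + q) (- q); rewrite addrK NN pN => h2.
(* With [s] at most 1 / 24 the remainder [12 * s ^+ 2] takes away at most half of the linear term
   [s]. *)
have : s ^+ 2 <= s * 24^-1 by rewrite expr2 ler_wpM2l.
lra.
Qed.

Lemma chord_lower (x : R) : 0 < x < 2 * pi -> exists2 c, 0 < c &
  forall y, 0 <= y <= 2 * pi -> c * (y - x) ^+ 2 <= N (expi y - expi x) ^+ 2.
Proof.
move=> /andP[x0 x2].
have pi0 : 0 < pi :> R by exact: pi_gt0.
(* The chord degenerates also when [y - x] is near 2 pi or - 2 pi. Since [a] is at most the distance
   from [x] to either end of the period, [|y - x|] stays below [2 * pi - a]. *)
pose a := Num.min 24^-1 (Num.min x (2 * pi - x)).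
have a0 : 0 < a by rewrite !lt_min x0 subr_gt0 x2 invr_gt0 ltr0n.
have a1 : a <= 24^-1 by rewrite ge_min lexx.
have a2 : a <= x by rewrite /a !ge_min lexx orbT.
have a3 : a <= 2 * pi - x by rewrite /a !ge_min lexx !orbT.
have api : a < pi by rewrite (le_lt_trans a1) // (lt_le_trans _ (pi_ge2 R)) //; lra.
pose d := 2 - 2 * cos a.
have d0 : 0 < d.
  suff : cos a < 1 by rewrite /d; lra.
  by rewrite -cos0 ltr_cos // in_itv /= ?lexx ?(ltW pi0) ?(ltW a0) ?(ltW api).
pose c := Num.min 4^-1 (d / (4 * pi ^+ 2)).
have c0 : 0 < c by rewrite lt_min invr_gt0 ltr0n divr_gt0 // mulr_gt0 // exprn_gt0.
exists c => // y /andP[y0 y2].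
have s2 : (y - x) ^+ 2 <= 4 * pi ^+ 2.
  have -> : 4 * pi ^+ 2 = (2 * pi) ^+ 2 :> R by ring.
  rewrite -[leLHS]real_normK ?num_real // lerXn2r ?nnegrE ?mulr_ge0 ?(ltW pi0) //.
  by rewrite ler_norml; lra.
have [sa|sa] := leP `|y - x| a.
  apply: le_trans (chord_small (le_trans sa a1)).
  by rewrite ler_wpM2r ?sqr_ge0 // ge_min lexx.
apply: (@le_trans _ _ d).
  apply: (@le_trans _ _ (d / (4 * pi ^+ 2) * (4 * pi ^+ 2))).
    apply: ler_pM => //; rewrite ?(ltW c0) ?sqr_ge0 //.
    by rewrite ge_min lexx orbT.
  by rewrite divfK // gt_eqF // mulr_gt0 // exprn_gt0.
rewrite N_chord /d lerB // ler_wpM2l //.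
have M b : a <= b <= pi -> cos b <= cos a.
  move=> /andP[]; rewrite le_eqVlt => /predU1P[<- //|ab bp]; apply: ltW.
  by rewrite ltr_cos // in_itv /= ?bp ?(ltW api) ?(ltW a0) // (ltW (lt_trans a0 ab)).
have K b : a <= b <= 2 * pi - a -> cos b <= cos a.
  move=> /andP[ab b2]; have [bp|pb] := leP b pi; first by apply: M; rewrite ab.
  have -> : cos b = cos (2 * pi - b).
    by rewrite -cosN -[LHS]cosD2pi mulr_natl addrC.
  by apply: M; lra.
case: (ltrP 0 (y - x)) sa => h; last first.
  by rewrite ler0_norm // -cosN => sa; apply: K; rewrite ltW //=; lra.
by rewrite gtr0_norm // => sa; apply: K; rewrite ltW //=; lra.
Qed.

(** The squared distance from [expi y] to [r * expi x] is (1 - r)^2 + r |expi y - expi x|^2: the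
    first summand limits the height of the kernel, the second gives its decay. *)
Lemma pk_bounds (x c r y : R) : 2^-1 <= r < 1 -> 0 < c ->
  c * (y - x) ^+ 2 <= N (expi y - expi x) ^+ 2 ->
  pk (r%:C%C * expi x) y <= 2 / (1 - r) /\
  pk (r%:C%C * expi x) y * (y - x) ^+ 2 <= 4 / c * (1 - r).
Proof.
move=> /andP[r2 r1] c0 h.
have r0 : 0 <= r by lra.
have d0 : 0 < 1 - r by rewrite subr_gt0.
have nz : N (r%:C%C * expi x) = r by rewrite NM NR N_expi mulr1 ger0_norm.
set z := _ * _ in nz *; set D := N (expi y - z).
have D0 : 0 < D by rewrite N_gt0 kern_neq0 ?N_expi ?nz.
have D1 : 1 - r <= D by rewrite -nz N_kern ?N_expi.
have D2 : r * N (expi y - expi x) ^+ 2 <= D ^+ 2.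
  rewrite /D /z N_chord Nsq /expi /= cosB.
  have h1 := cos2Dsin2 x; have h2 := cos2Dsin2 y.
  have -> : (cos y - (r * cos x - 0 * sin x)) ^+ 2 +
     (sin y - (r * sin x + 0 * cos x)) ^+ 2 =
     (cos y ^+ 2 + sin y ^+ 2) + r ^+ 2 * (cos x ^+ 2 + sin x ^+ 2) -
     2 * r * (cos y * cos x + sin y * sin x) by ring.
  rewrite h1 h2 mulr1; have := sqr_ge0 (1 - r); lra.
have p0 : 0 <= 1 - r ^+ 2 by rewrite subr_ge0 exprn_ile1 // ltW.
have p1 : 1 - r ^+ 2 <= 2 * (1 - r) by have := sqr_ge0 (1 - r); lra.
rewrite /pk nz; split.
  rewrite ler_pdivrMr ?exprn_gt0 // mulrAC ler_pdivlMr //.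
  apply: le_trans (ler_wpM2r (ltW d0) p1) _; rewrite -mulrA ler_wpM2l //.
  by rewrite -expr2 lerXn2r ?nnegrE ?(ltW d0) ?(ltW D0).
have h3 : c * (y - x) ^+ 2 <= 2 * D ^+ 2.
  apply: le_trans h _; have := ler_wpM2r (sqr_ge0 (N (expi y - expi x))) r2; lra.
have cs0 : 0 <= c * (y - x) ^+ 2 by rewrite mulr_ge0 ?sqr_ge0 // ltW.
have h4 := ler_pM p0 cs0 p1 h3.
have cD : 0 < c * D ^+ 2 by rewrite mulr_gt0 // exprn_gt0.
have -> : (1 - r ^+ 2) / D ^+ 2 * (y - x) ^+ 2 =
  (1 - r ^+ 2) * (c * (y - x) ^+ 2) / (c * D ^+ 2).
  by field; rewrite !gt_eqF.
rewrite ler_pdivrMr //; apply: le_trans h4 _.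
rewrite le_eqVlt; apply/orP; left; apply/eqP; field.
by rewrite gt_eqF.
Qed.

Lemma aeJ_interior : aeJ (fun x : R => 0 < x < 2 * pi).
Proof.
have n1 (a : R) : mu.-negligible [set a].
  by exists [set a]; split=> //; exact: lebesgue_measure_set1.
apply: (negligibleS _ (negligibleU (n1 0) (n1 (2 * pi)))) => x /=.
move=> /not_implyP[/andP[]]; rewrite !le_eqVlt => /predU1P[<-|x0]; first by left.
by move=> /predU1P[->|x2] H; [right|case: H; rewrite x0].
Qed.

Lemma integrable_osc (v : R -> R) (a : R) : mu.-integrable J (EFin \o v) ->
  mu.-integrable J (EFin \o (fun y => `|v y - a|)).
Proof.
move=> iv; apply: integrable_norm.
have ia : mu.-integrable J (EFin \o (fun=> a)) by apply: integrableJ => t; exact: cvg_cst.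
by have := integrableB measurableJ iv ia; apply: eq_integrable.
Qed.

Lemma lebesgue_pt_osc (v : R -> R) (x eta : R) : mu.-integrable J (EFin \o v) ->
  lebesgue_pt (v \_ J) x -> 0 < x < 2 * pi -> 0 < eta ->
  exists2 d, 0 < d & forall s, 0 < s < d ->
    \int[mu]_(y in J) ((fun y => `|v y - v x|) \_ (ball x s)) y <= eta * s.
Proof.
move=> iv H /andP[x0 x2] eta0.
have Jx : J x by rewrite /= in_itv /= !ltW.
(* The average is over a ball of length [2 * s], so the tolerance [eta / 2] yields the bound
   [eta * s] for the integral. *)
have : \forall s \near (0 : R)^'+, (davg (v \_ J) x s < (eta / 2)%:E)%E.
  move/fine_cvgP : H => [fin /cvgrPdist_lt /(_ _ (divr_gt0 eta0 (ltr0n _ 2)))].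
  apply: filterS2 fin => s sfin; rewrite sub0r normrN => /(le_lt_trans (ler_norm _)).
  by rewrite -lte_fin fineK.
rewrite /at_right /= => /nbhs_ballP[d /= d0 Hd]; exists d => // s /andP[s0 sd].
have : (davg (v \_ J) x s < (eta / 2)%:E)%E.
  by apply: Hd => //; rewrite -ball_normE /= sub0r normrN gtr0_norm.
rewrite /davg /iavg lebesgue_measure_ball ?(ltW s0) // inver.
have -> : s *+ 2 == 0 = false by rewrite mulrn_eq0 /= gt_eqF.
rewrite lte_pdivrMl ?mulrn_wgt0 //.
rewrite -EFinM => lt.
have mv : measurable_fun J v by apply/measurable_EFinP; apply: measurable_int iv.
have mV : measurable_fun [set: R] (v \_ J).
  apply/(measurable_restrict _ measurableJ) => //.
  by rewrite setTI.
have mB : measurable_fun (ball x s)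
    (fun y => `|((center ((v \_ J) x) \o (v \_ J)) y)%:E|%E).
  do 2 apply: measurableT_comp => //.
  apply: (@measurable_funS _ _ _ _ setT) => //.
  exact: measurable_funB mV (measurable_cst _).
have mJB : measurable (J `&` ball x s : set (measurableTypeR R)).
  by apply: measurableI; [exact: measurableJ|exact: measurable_ball].
have iJB : mu.-integrable (J `&` ball x s) (EFin \o (fun y => `|v y - v x|)).
  by apply: integrableS (integrable_osc (v x) iv).
rewrite -Rintegral_mkcondr /Rintegral -lee_fin fineK; last exact: integrable_fin_num.
apply: (@le_trans _ _ (\int[mu]_(y in ball x s)
    `|((center ((v \_ J) x) \o (v \_ J)) y)%:E|)%E); last first.
  apply: (le_trans (ltW lt)); rewrite lee_fin le_eqVlt; apply/orP; left.
  by apply/eqP; field.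
apply: (@le_trans _ _ (\int[mu]_(y in J `&` ball x s)
    `|((center ((v \_ J) x) \o (v \_ J)) y)%:E|)%E); last first.
  by apply: ge0_subset_integral => //; exact: measurable_ball.
rewrite le_eqVlt; apply/orP; left; apply/eqP; apply: eq_integral => y /set_mem[Jy _].
by rewrite /= !patchE !mem_set.
Qed.

Lemma integrable_pk (v : R -> R) w : N w < 1 -> mu.-integrable J (EFin \o v) ->
  mu.-integrable J (EFin \o (fun y => pk w y * v y)).
Proof.
move=> w1 iv; have mv : measurable_fun J v.
  by apply/measurable_EFinP; apply: measurable_int iv.
apply: (@le_integrable _ _ _ _ _ measurableJ _
  (EFin \o (fun y => (1 - N w) ^- 2 * v y))); last exact: integrableJZ.
  apply/measurable_EFinP/measurable_funM => //.
  exact: measurableJ_cont (continuous_pk w1).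
move=> y _; have p0 := pk_ge0 y w1.
have b0 : 0 <= (1 - N w) ^- 2 by rewrite invr_ge0 sqr_ge0.
rewrite /= lee_fin (normrM (pk w y)) (normrM ((1 - N w) ^- 2)) ler_wpM2r // (ger0_norm p0).
by rewrite (ger0_norm b0) pk_bound.
Qed.

Lemma near_at_left1 (P : R -> Prop) (e : R) : 0 < e ->
  (forall r, 1 - e < r < 1 -> P r) -> \forall r \near (1 : R)^'-, P r.
Proof.
move=> e0 H; apply/nbhs_ballP; exists e => //= r.
by rewrite /ball /= ltr_distlC => /andP[h1 _] r1; apply: H; rewrite h1.
Qed.

(** At a Lebesgue point the kernel is an approximate identity of scale [1 - r]. The two ends of the
    period are discarded because there small chords join distant parameters. *)
Theorem fatou_radial (v : R -> R) : mu.-integrable J (EFin \o v) ->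
  aeJ (fun x => \int[mu]_(y in J) (pk (r%:C%C * expi x) y * v y)
      @[r --> (1 : R)^'-] --> 2 * pi * v x).
Proof.
move=> iv; have L := lebesgue_differentiation (integrable_locally measurableJ iv).
have L' : aeJ (fun x => lebesgue_pt (v \_ J) x).
  apply: (@filterS _ _ ae_filter_lebesgue) L => x H _; exact: H.
apply: aeJS (aeJI L' aeJ_interior) => x _ [Lx /[dup] x02 /chord_lower[c c0 cB]].
pose K := Num.max 2 (4 / c).
have K2 : 2 <= K by rewrite le_max lexx.
have Kc : 4 / c <= K by rewrite le_max lexx orbT.
have K0 : 0 < K by exact: lt_le_trans K2.
pose I := \int[mu]_(y in J) `|v y - v x|.
have I0 : 0 <= I by apply: Rintegral_ge0.
apply/cvgrPdist_le => e e0.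
(* In [dyadic_kernel] at scale [1 - r], [eta] makes the local part equal to [e / 2] and [e1] keeps
   the tail below [e / 2]; the 1 added to [I] avoids a division by zero. *)
pose eta := e / (16 * K).
have eta0 : 0 < eta by rewrite divr_gt0 // mulr_gt0.
have [d d0 Hd] := lebesgue_pt_osc iv Lx x02 eta0.
pose e1 := e * d ^+ 2 / (8 * K * (I + 1)).
have e10 : 0 < e1.
  by rewrite divr_gt0 ?mulr_gt0 ?exprn_gt0 // ltr_wpDl.
apply: (@near_at_left1 _ (Num.min 2^-1 (Num.min d e1))).
  by rewrite !lt_min d0 e10 invr_gt0 ltr0n.
move=> r /andP[hr r1].
have [q1 [q2 q3]] : 1 - r < 2^-1 /\ 1 - r < d /\ 1 - r < e1.
  have : 1 - r < Num.min 2^-1 (Num.min d e1) by lra.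
  by rewrite !lt_min => /and3P[-> -> ->].
have r2 : 2^-1 <= r by lra.
have d1 : 0 < 1 - r by rewrite subr_gt0.
have zr : N (r%:C%C * expi x) < 1.
  by rewrite NM NR N_expi mulr1 ger0_norm //; lra.
set z := _ * expi x in zr *.
have iW := integrable_osc (v x) iv.
have pb y : 0 <= y <= 2 * pi -> [/\ 0 <= pk z y, pk z y <= K / (1 - r) &
    pk z y * (y - x) ^+ 2 <= K * (1 - r)].
  move=> yJ; have rr : 2^-1 <= r < 1 by rewrite r2.
  have [h1 h2] := pk_bounds rr c0 (cB y yJ).
  split; first exact: pk_ge0.
    by apply: le_trans h1 _; rewrite ler_wpM2r // invr_ge0 ltW.
  by apply: le_trans h2 _; rewrite ler_wpM2r // ltW.
have ed : 0 < 1 - r < d by rewrite d1.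
have D := dyadic_kernel ed (ltW K0) (ltW eta0) (fun y => normr_ge0 _) iW Hd
  (continuous_pk zr) pb.
have -> : 2 * pi * v x = \int[mu]_(y in J) (pk z y * v x).
  by rewrite RintegralZr ?Rintegral_pk //; apply: integrableJ; exact: continuous_pk.
have ipx : mu.-integrable J (EFin \o (fun y => pk z y * v x)).
  by apply: integrable_pk => //; apply: integrableJ => t; exact: cvg_cst.
have ipv := integrable_pk zr iv.
rewrite distrC -RintegralB //.
apply: le_trans (le_normr_Rintegral measurableJ _) _.
  have := integrableB measurableJ ipv ipx.
  by apply: eq_integrable => // y _; rewrite /= EFinB.
have -> : \int[mu]_(t in J) `|pk z t * v t - pk z t * v x| =
    \int[mu]_(t in J) (pk z t * `|v t - v x|).
  by apply: eq_Rintegral => t _; rewrite -mulrBr normrM ger0_norm ?pk_ge0.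
apply: le_trans D _.
have -> : 8 * K * eta = e / 2 by rewrite /eta; field; rewrite gt_eqF.
have : 4 * K * (1 - r) / d ^+ 2 * I <= e / 2; last by rewrite -/I; lra.
apply: (@le_trans _ _ (4 * K * e1 / d ^+ 2 * I)).
  rewrite ler_wpM2r // ler_wpM2r ?invr_ge0 ?sqr_ge0 // ler_wpM2l ?(ltW q3) //.
  by rewrite mulr_ge0 // ltW.
have -> : 4 * K * e1 / d ^+ 2 * I = e / 2 * (I / (I + 1)).
  by rewrite /e1; field; rewrite !gt_eqF // ltr_wpDl.
rewrite ler_piMr ?divr_ge0 ?(ltW e0) // ler_pdivrMr ?ltr_wpDl //.
by rewrite mul1r lerDl.
Qed.

End Fatou.

(** * Herglotz integrals and outer functions *)

Section Herglotz.
Context {R : realType}.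
Local Notation C := R[i].
Local Notation N := (@modulus R).
Local Notation Re := (@complex.Re R).
Local Notation Im := (@complex.Im R).
Local Notation mu := (@lebesgue_measure R).
Local Notation J := (`[0, 2 * pi]%classic : set R).
Implicit Types (v : R -> R) (z : C).

Lemma cintegrable_mulR (h : R -> C) (M : R) v : continuous h ->
  (forall t, N (h t) <= M) -> mu.-integrable J (EFin \o v) ->
  cintegrable (fun t => h t * (v t)%:C%C).
Proof.
move=> ch hM iv; have mv : measurable_fun J v.
  by apply/measurable_EFinP; apply: measurable_int iv.
have M0 : 0 <= M by exact: le_trans (N_ge0 _) (hM 0).
have A (u : R -> R) : continuous u -> (forall t, `|u t| <= M) ->
    mu.-integrable J (EFin \o (fun t => u t * v t)).
  move=> cu uM.
  apply: (@le_integrable _ _ _ _ _ measurableJ _ (EFin \o (fun y => M * v y)));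
    last exact: integrableJZ.
    apply/measurable_EFinP/measurable_funM => //.
    exact: measurableJ_cont cu.
  move=> y _; rewrite /= lee_fin (normrM (u y)) (normrM M) ler_wpM2r //.
  by rewrite (ger0_norm M0).
have cRe : continuous (Re \o h) by move=> t; exact: (cvg_Re (ch t)).
have cIm : continuous (Im \o h) by move=> t; exact: (cvg_Im (ch t)).
split.
  have := A _ cRe (fun t => le_trans (ReN _) (hM t)).
  by apply: eq_integrable => // t _; rewrite /= cReZ.
have := A _ cIm (fun t => le_trans (ImN _) (hM t)).
by apply: eq_integrable => // t _; rewrite /= cImZ.
Qed.

Lemma cint_mulR_le (h : R -> C) (M : R) v : continuous h ->
  (forall t, N (h t) <= M) -> mu.-integrable J (EFin \o v) ->
  N (cint (fun t => h t * (v t)%:C%C)) <= M * (2 * \int[mu]_(t in J) `|v t|).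
Proof.
move=> ch hM iv; have inv := integrable_norm iv.
apply: (@le_trans _ _ (2 * \int[mu]_(t in J) (M * `|v t|))).
  apply: cint_le.
  - exact: cintegrable_mulR hM iv.
  - exact: integrableJZ.
  - by move=> t; rewrite NM NR ler_wpM2r.
by rewrite RintegralZl // mulrCA.
Qed.

Definition kern z (t : R) : C := (expi t + z) / (expi t - z).

Definition dkern z (t : R) : C := 2 * expi t * (expi t - z) ^- 2.

Lemma cayleyE (zeta z : C) : N zeta = 1 -> N z < 1 ->
  (zeta + z) / (zeta - z) = - 1 + 2 * zeta * (zeta - z)^-1.
Proof. by move=> h z1; have nz := kern_neq0 h z1; field. Qed.

Lemma qd_cayley r (zeta : C) : 0 <= r < 1 -> N zeta = 1 ->
  qd r (1 + 2 * (1 - r) ^- 3) (fun z => (zeta + z) / (zeta - z))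
    (fun z => 2 * zeta * (zeta - z) ^- 2).
Proof.
move=> r01 h; have := qd_add (@qd_cst R r (-1)) (qd_scal (2 * zeta) (qd_kern r01 h)).
rewrite NN N1 NM Nn h mulr1; apply: qd_ext => z zr /=.
  by rewrite cayleyE // (le_lt_trans zr) //; case/andP: r01.
by rewrite /cst add0r.
Qed.

Lemma Re_cayley (zeta z : C) : N zeta = 1 -> N z < 1 ->
  Re ((zeta + z) / (zeta - z)) = (1 - N z ^+ 2) / N (zeta - z) ^+ 2.
Proof.
move=> h z1; have nz := kern_neq0 h z1.
have nz' : (zeta - z)^*%C != 0 by rewrite conjc_eq0.
have -> : (zeta + z) / (zeta - z) =
    (zeta + z) * (zeta - z)^*%C * (N (zeta - z) ^- 2)%:C%C.
  rewrite fmorphV /= -NconjM.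
  move: (zeta - z)^*%C nz' => D' nz'; field.
  by rewrite nz nz'.
rewrite cReZ; congr (_ * _).
have -> : 1 = N zeta ^+ 2 by rewrite h expr1n.
rewrite !Nsq; case: z {z1 nz nz'} => a b; case: zeta {h} => c d /=; ring.
Qed.

Lemma continuous_kern z : N z < 1 -> continuous (kern z).
Proof.
move=> z1 t; apply: (cvgM (cvgD (@continuous_expi R t) (cvg_cst _))).
apply: cvgV; last exact: continuous_expiB.
exact: kern_neq0 (N_expi t) z1.
Qed.

Lemma continuous_dkern z : N z < 1 -> continuous (dkern z).
Proof.
move=> z1 t; apply: (cvgM (cvgM (cvg_cst _) (@continuous_expi R t))).
have nz := kern_neq0 (N_expi t) z1; apply: cvgV; first by rewrite expf_neq0.
by apply: cvgM; exact: continuous_expiB.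
Qed.

Definition herglotz v z : C := cint (fun t => kern z t * (v t)%:C%C).

Definition dherglotz v z : C := cint (fun t => dkern z t * (v t)%:C%C).

Lemma smooth_herglotz v : mu.-integrable J (EFin \o v) ->
  smooth (herglotz v) (dherglotz v).
Proof.
move=> iv r r01; pose M := 1 + 2 * (1 - r) ^- 3.
pose I := 2 * \int[mu]_(t in J) `|v t|.
have r1 : r < 1 by case/andP: r01.
exists (M * I) => x y xr yr.
have Q t := qd_cayley r01 (N_expi t) xr yr.
have x1 := le_lt_trans xr r1; have y1 := le_lt_trans yr r1.
have kx t : N (kern x t) <= M by have [] := Q t.
have ky t : N (kern y t) <= M by have [] := qd_cayley r01 (N_expi t) yr xr.
have dx t : N (dkern x t) <= M by have [] := Q t.
have ckx := continuous_kern x1; have cky := continuous_kern y1.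
have cdx := continuous_dkern x1.
split; [exact: (cint_mulR_le ckx kx iv)|exact: (cint_mulR_le cdx dx iv)|].
have ix := cintegrable_mulR ckx kx iv.
have iy := cintegrable_mulR cky ky iv.
have id := cintegrable_mulR cdx dx iv.
have -> : herglotz v y - herglotz v x - dherglotz v x * (y - x) =
  cint (fun t => (kern y t - kern x t - (y - x) * dkern x t) * (v t)%:C%C).
  rewrite mulrC -cintZ // -cintB // -cintB //; last 2 first.
    exact: cintegrableB.
    exact: cintegrableZ.
  by apply: eq_cint => t _; ring.
rewrite mulrAC.
have ch : continuous (fun t => kern y t - kern x t - (y - x) * dkern x t).
  move=> t; apply: (cvgB (cvgB (cky t) (ckx t))).
  exact: (cvgM (cvg_cst _) (cdx t)).
apply: (cint_mulR_le ch _ iv) => t.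
by rewrite [_ * dkern _ _]mulrC; have [] := Q t.
Qed.

(** The outer function whose boundary modulus is exp v and whose value at 0 is positive. *)
Definition herg v z : C := cexp ((2 * pi)^-1%:C%C * herglotz v z).

Lemma smooth_herg v : mu.-integrable J (EFin \o v) ->
  smooth (herg v) (fun z => herg v z * ((2 * pi)^-1%:C%C * dherglotz v z)).
Proof.
move=> iv r r01; have [K F] := smooth_herglotz iv r01.
by apply: (qd_cexp _ (qd_scal _ F)); case/andP: r01 => _ /ltW.
Qed.

Lemma herg_neq0 v z : herg v z != 0. Proof. exact: cexp_neq0. Qed.

Lemma Re_kern z t : N z < 1 -> Re (kern z t) = pk z t.
Proof. exact: Re_cayley (N_expi t). Qed.

Lemma N_herg v z : mu.-integrable J (EFin \o v) -> N z < 1 ->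
  N (herg v z) = expR ((2 * pi)^-1 * \int[mu]_(t in J) (pk z t * v t)).
Proof.
move=> iv z1; rewrite N_cexp mulrC cReZ mulrC; congr (expR (_ * _)).
by apply: eq_Rintegral => t _; rewrite cReZ Re_kern.
Qed.

End Herglotz.

(** * Series over the group *)

Section UnorderedSums.
Context {R : realType} {I : choiceType}.
Local Notation C := R[i].
Local Notation N := (@modulus R).
Local Notation Re := (@complex.Re R).
Local Notation Im := (@complex.Im R).
Implicit Types (w : I -> R) (a b : I -> C) (F : {fset I}).

(** [W] is an upper bound and not the value of the sum, so that subfamilies inherit it. *)
Definition bsum w (W : R) := (forall i, 0 <= w i) /\
  forall F, \sum_(i <- F) w i <= W.

Definition has_csum a (s : C) := forall e : R, 0 < e ->
  exists F0, forall F, (F0 `<=` F)%fset -> N (\sum_(i <- F) a i - s) <= e.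

Definition dominated a := exists w W, bsum w W /\ forall i, N (a i) <= w i.

Lemma fset_sum_split (V : nmodType) (f : I -> V) F0 F : (F0 `<=` F)%fset ->
  \sum_(i <- F) f i = \sum_(i <- F0) f i +
    \sum_(i <- F) (if i \in F0 then 0 else f i).
Proof.
move=> sub; have -> : \sum_(i <- F0) f i = \sum_(i <- F) (if i \in F0 then f i else 0).
  rewrite -(big_fset_incl _ sub); last by move=> x _ /negPf ->.
  by apply: eq_big_seq => i ->.
rewrite -big_split; apply: eq_bigr => i _ /=.
by case: ifP => _; rewrite ?addr0 ?add0r.
Qed.

Lemma fset_sum_le w F0 F : (forall i, 0 <= w i) -> (F0 `<=` F)%fset ->
  \sum_(i <- F0) w i <= \sum_(i <- F) w i.
Proof.
move=> w0 /(fset_sum_split w) ->.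
by rewrite lerDl sumr_ge0 // => i _; case: ifP.
Qed.

Lemma N_sum_le (s : seq I) a w : (forall i, N (a i) <= w i) ->
  N (\sum_(i <- s) a i) <= \sum_(i <- s) w i.
Proof.
move=> aw; elim: s => [|i s IH]; first by rewrite !big_nil N0.
by rewrite !big_cons (le_trans (ND _ _)) // lerD.
Qed.

Lemma has_csum_lim a s : has_csum a s -> summability.sum a = s.
Proof.
move=> H; rewrite /summability.sum; apply: (@cvg_lim _ _ _ _ (@summability.totally_filter I)) => //.
have FF : Filter (@summability.totally I) by exact: summability.totally_filter.
apply/cvgCP => e e0; have [|F0 HF] := H (e / 2); first by rewrite divr_gt0.
exists F0 => // F /= sub; rewrite Ndist /summability.partial_sum.
have := HF F sub; rewrite big_seq_fsetE /=.
by move=> /le_lt_trans; apply; rewrite ltr_pdivrMr // ltr_pMr // ltr1n.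
Qed.

Lemma real_sum_exists w W : bsum w W -> exists s : R, forall e : R, 0 < e ->
  exists F0, forall F, (F0 `<=` F)%fset -> s - e <= \sum_(i <- F) w i <= s.
Proof.
move=> [w0 wW]; pose E : set R := [set \sum_(i <- F) w i | F in [set: {fset I}]].
have supE : has_sup E.
  split; first by exists (\sum_(i <- fset0) w i); exists fset0.
  by exists W => _ [F _ <-]; exact: wW.
exists (sup E) => e e0.
have [_ [F0 _ <-] h] := sup_adherent e0 supE.
exists F0 => F sub; apply/andP; split.
  exact: le_trans (ltW h) (fset_sum_le w0 sub).
by apply: sup_ubound => //; [exact: (proj2 supE)|exists F].
Qed.

Lemma bsum_tail w W e : bsum w W -> 0 < e ->
  exists F0, bsum (fun i => if i \in F0 then 0 else w i) e.
Proof.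
move=> bw e0; have [w0 _] := bw.
have [s /(_ e e0)[F0 H]] := real_sum_exists bw.
exists F0; split=> [i|F]; first by case: ifP.
apply: (@le_trans _ _ (\sum_(i <- F0 `|` F) (if i \in F0 then 0 else w i)))%fset.
  by apply: fset_sum_le (fsubsetUr _ _) => i; case: ifP.
have /andP[h1 _] := H F0 (fsubset_refl _).
have /andP[_ h2] := H _ (fsubsetUl F0 F).
rewrite (fset_sum_split w (fsubsetUl F0 F)) in h2; lra.
Qed.

Lemma has_csum_exists a : dominated a -> has_csum a (summability.sum a).
Proof.
move=> [w [W [[w0 wW] aw]]].
suff [s H] : exists s, has_csum a s by rewrite (has_csum_lim H).
have A (f : I -> R) : (forall i, `|f i| <= w i) -> exists s : R, forall e : R, 0 < e ->
    exists F0, forall F, (F0 `<=` F)%fset -> `|\sum_(i <- F) f i - s| <= e.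
  move=> fw.
  (* A signed family is the difference of the nonnegative families [f + w] and [w], both with
     bounded finite sums. *)
  have [|s Hs] := @real_sum_exists (fun i => f i + w i) (2 * W).
    split=> [i|F].
      by have := fw i; rewrite ler_norml => /andP[]; lra.
    apply: (@le_trans _ _ (\sum_(i <- F) (w i + w i))).
      by apply: ler_sum => i _; rewrite lerD2r (le_trans (ler_norm _)).
    by rewrite big_split /=; have := wW F; lra.
  have [t Ht] := @real_sum_exists w W (conj w0 wW).
  exists (s - t) => e e0; have [F1 H1] := Hs e e0; have [F2 H2] := Ht e e0.
  exists (F1 `|` F2)%fset => F; rewrite fsubUset => /andP[/H1 h1 /H2 h2].
  by move: h1 h2; rewrite big_split /= ler_norml; lra.
have [s1 H1] := A (Re \o a) (fun i => le_trans (ReN _) (aw i)).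
have [s2 H2] := A (Im \o a) (fun i => le_trans (ImN _) (aw i)).
exists (s1 +i* s2)%C => e e0.
have e2 : 0 < e / 2 by rewrite divr_gt0.
have [F1 h1] := H1 _ e2; have [F2 h2] := H2 _ e2.
exists (F1 `|` F2)%fset => F; rewrite fsubUset => /andP[/h1 k1 /h2 k2].
apply: le_trans (NReIm _) _; rewrite cReB cImB /=.
have -> : Re (\sum_(i <- F) a i) = \sum_(i <- F) (Re \o a) i.
  by elim/big_rec2: _ => [//|i x y _ <-]; rewrite cReD.
have -> : Im (\sum_(i <- F) a i) = \sum_(i <- F) (Im \o a) i.
  by elim/big_rec2: _ => [//|i x y _ <-]; rewrite cImD.
lra.
Qed.

Definition csum a : C := summability.sum a.

Lemma has_csumD a b s t : has_csum a s -> has_csum b t ->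
  has_csum (fun i => a i + b i) (s + t).
Proof.
move=> A B e e0; have e2 : 0 < e / 2 by rewrite divr_gt0.
have [F1 H1] := A _ e2; have [F2 H2] := B _ e2.
exists (F1 `|` F2)%fset => F; rewrite fsubUset => /andP[/H1 h1 /H2 h2].
rewrite big_split /= opprD addrACA; apply: le_trans (ND _ _) _; lra.
Qed.

Lemma has_csumZ a s (c : C) : has_csum a s -> has_csum (fun i => c * a i) (c * s).
Proof.
move=> A e e0; have c1 : 0 < N c + 1 by rewrite ltr_wpDl ?N_ge0.
have [|F0 H] := A (e / (N c + 1)); first by rewrite divr_gt0.
exists F0 => F /H; rewrite -mulr_sumr -mulrBr NM => h.
apply: le_trans (ler_wpM2l (N_ge0 c) h) _.
rewrite mulrCA ler_piMr ?(ltW e0) // ler_pdivrMr // mul1r lerDl //.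
Qed.

Lemma csumD a b : dominated a -> dominated b ->
  csum (fun i => a i + b i) = csum a + csum b.
Proof.
by move=> /has_csum_exists A /has_csum_exists B; exact/has_csum_lim/has_csumD.
Qed.

Lemma csumZ a (c : C) : dominated a -> csum (fun i => c * a i) = c * csum a.
Proof. by move=> /has_csum_exists A; exact/has_csum_lim/has_csumZ. Qed.

Lemma csumB a b : dominated a -> dominated b ->
  csum (fun i => a i - b i) = csum a - csum b.
Proof.
move=> /has_csum_exists A /has_csum_exists B; apply: has_csum_lim.
have := has_csumD A (has_csumZ (-1) B); rewrite mulN1r.
by congr has_csum; apply/funext => i; rewrite mulN1r.
Qed.

Lemma dominatedZ a (c : C) : dominated a -> dominated (fun i => c * a i).
Proof.
move=> [w [W [[w0 wW] aw]]]; exists (fun i => N c * w i), (N c * W).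
split=> [|i]; last by rewrite NM ler_wpM2l ?N_ge0.
split=> [i|F]; first by rewrite mulr_ge0 ?N_ge0.
by rewrite -mulr_sumr ler_wpM2l ?N_ge0.
Qed.

Lemma dominated_le a w W (K : R) : bsum w W -> 0 <= K ->
  (forall i, N (a i) <= K * w i) -> dominated a.
Proof.
move=> [w0 wW] K0 aw; exists (fun i => K * w i), (K * W); split=> //.
split=> [i|F]; first by rewrite mulr_ge0.
by rewrite -mulr_sumr ler_wpM2l.
Qed.

Lemma csum_le a w W (K : R) : bsum w W -> 0 <= K ->
  (forall i, N (a i) <= K * w i) -> N (csum a) <= K * W.
Proof.
move=> bw K0 aw; have [w0 wW] := bw.
have A := has_csum_exists (dominated_le bw K0 aw).
apply/ler_addgt0Pr => e e0; have [F0 /(_ F0 (fsubset_refl _)) H] := A e e0.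
have -> : csum a = \sum_(i <- F0) a i - (\sum_(i <- F0) a i - csum a) by ring.
apply: le_trans (NB _ _) _; rewrite lerD //.
apply: le_trans (N_sum_le F0 aw) _.
by rewrite -mulr_sumr ler_wpM2l.
Qed.

(** The majorant is an imaginary part because the series will be compared with the Martin function.
    With [a] equal to 0 the lemma also gives positivity of the imaginary part of a sum. *)
Lemma csum_le_Im a b : dominated a -> dominated b ->
  (forall i, N (a i) <= Im (b i)) -> N (csum a) <= Im (csum b).
Proof.
move=> /has_csum_exists A /has_csum_exists B ab.
apply/ler_addgt0Pr => e e0; have e2 : 0 < e / 2 by rewrite divr_gt0.
have [F1 H1] := A _ e2; have [F2 H2] := B _ e2.
have h1 := H1 _ (fsubsetUl F1 F2); have h2 := H2 _ (fsubsetUr F1 F2).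
set F := (_ `|` _)%fset in h1 h2.
have h3 : N (\sum_(i <- F) a i) <= Im (\sum_(i <- F) b i).
  have -> : Im (\sum_(i <- F) b i) = \sum_(i <- F) Im (b i).
    by elim/big_rec2: _ => [//|i x y _ <-]; rewrite cImD.
  exact: N_sum_le.
have h4 := ImN (\sum_(i <- F) b i - csum b); rewrite cImB in h4.
have := le_trans (ler_norm _) (le_trans h4 h2).
have := NB (\sum_(i <- F) a i) (\sum_(i <- F) a i - csum a).
have -> : \sum_(i <- F) a i - (\sum_(i <- F) a i - csum a) = csum a by ring.
rewrite -/(csum a) in h1; move: h1 h3; lra.
Qed.

Lemma csum_finite a F : csum (fun i => if i \in F then a i else 0) = \sum_(i <- F) a i.
Proof.
apply: has_csum_lim => e e0; exists F => G sub.
rewrite -(big_fset_incl _ sub); last by move=> x _ /negPf ->.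
rewrite (_ : \sum_(i <- F) (if i \in F then a i else 0) = \sum_(i <- F) a i).
  by rewrite subrr N0 ltW.
by apply: eq_big_seq => i ->.
Qed.

Lemma eq_csum a b : a =1 b -> csum a = csum b.
Proof. by move=> ab; congr csum; exact/funext. Qed.

Lemma csum_reindex a (f g : I -> I) : cancel f g -> cancel g f -> dominated a ->
  csum (fun i => a (f i)) = csum a.
Proof.
move=> fg gf /has_csum_exists A; apply: has_csum_lim => e e0.
have [F0 H] := A e e0; exists (g @` F0)%fset => F sub.
have fi : {in F &, injective f} by move=> x y _ _ /(can_inj fg).
have := H (f @` F)%fset; rewrite big_imfset //=.
apply; apply/fsubsetP => i iF; rewrite -(gf i); apply/imfsetP; exists (g i) => //=.
by apply: (fsubsetP sub); apply/imfsetP; exists i.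
Qed.

Lemma qd_csum (f df : I -> C -> C) w W r (K : R) : bsum w W -> 0 <= K ->
  (forall i, qd r (K * w i) (f i) (df i)) ->
  qd r (K * W) (fun z => csum (f^~ z)) (fun z => csum (df^~ z)).
Proof.
move=> bw K0 F x y xr yr.
have fd z : N z <= r -> forall i, N (f i z) <= K * w i.
  by move=> zr i; have [] := F i z z zr zr.
have dfd i : N (df i x) <= K * w i by have [] := F i x y xr yr.
have D1 := dominated_le bw K0 (fd x xr); have D2 := dominated_le bw K0 (fd y yr).
have D3 := dominated_le bw K0 dfd.
split; [exact: csum_le bw K0 (fd x xr)|exact: csum_le bw K0 dfd|].
have -> : csum (f^~ y) - csum (f^~ x) - csum (df^~ x) * (y - x) =
    csum (fun i => f i y - f i x - (y - x) * df i x).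
  have [H1 [H2 H3]] := (has_csum_exists D1, (has_csum_exists D2, has_csum_exists D3)).
  have := has_csumD (has_csumD H2 (has_csumZ (-1) H1)) (has_csumZ (- (y - x)) H3).
  move=> /has_csum_lim E; rewrite [csum (df^~ x) * _]mulrC -[- (_ * csum _)]mulNr.
  rewrite -[- csum (f^~ x)]mulN1r -E; congr summability.sum; apply/funext => i.
  by rewrite mulN1r mulNr.
rewrite mulrAC; apply: (csum_le bw); first by rewrite mulr_ge0 ?sqr_ge0.
move=> i; have [_ _] := F i x y xr yr.
by rewrite [df i x * _]mulrC mulrAC.
Qed.

End UnorderedSums.

(** * Automorphisms of the disk through their coefficients *)

Section Moebius.
Context {R : realType}.
Local Notation C := R[i].
Local Notation N := (@modulus R).
Implicit Types (a b x y z : C) (p q : C * C).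

(** The automorphy factor: [den p z ^- 2] is the derivative of the map, and [den_mul] is the cocycle
    law. *)
Definition den p z : C := (p.2^*)%C * z + (p.1^*)%C.

Lemma coefsE p : disk_aut_coefs p -> N p.1 ^+ 2 = 1 + N p.2 ^+ 2.
Proof.
rewrite /disk_aut_coefs /= !normE -!rmorphXn -rmorphB /= => /(congr1 (@complex.Re R)) /=.
by move=> <-; rewrite subrK.
Qed.

Lemma coefs_detE p : disk_aut_coefs p ->
  p.1 * (p.1^*)%C - p.2 * (p.2^*)%C = 1.
Proof. by move=> /coefsE h; rewrite !NconjM h rmorphD /= addrK. Qed.

Lemma coefs_gap p : disk_aut_coefs p -> 0 < N p.1 - N p.2.
Proof.
move=> /coefsE h; rewrite subr_gt0 -(@ltr_pXn2r _ 2) ?nnegrE ?N_ge0 //.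
by rewrite h ltrDr.
Qed.

Lemma N_den p z : disk_aut_coefs p -> N z <= 1 -> N p.1 - N p.2 <= N (den p z).
Proof.
move=> hp z1; have := ND (den p z) (- ((p.2^*)%C * z)).
rewrite /den addrAC subrr add0r NN NM !NJ.
have : N p.2 * N z <= N p.2 by rewrite ler_piMr ?N_ge0.
lra.
Qed.

Lemma den_neq0 p z : disk_aut_coefs p -> N z <= 1 -> den p z != 0.
Proof.
move=> hp z1; rewrite -N_gt0; apply: lt_le_trans (N_den hp z1); exact: coefs_gap.
Qed.

Lemma moebiusE p z : moebius p.1 p.2 z = (p.1 * z + p.2) / den p z.
Proof. by []. Qed.

Lemma moebiusB p x y : disk_aut_coefs p -> den p x != 0 -> den p y != 0 ->
  moebius p.1 p.2 y - moebius p.1 p.2 x = (y - x) / (den p x * den p y).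
Proof.
move=> hp dx dy; rewrite !moebiusE.
have -> : y - x = (p.1 * (p.1^*)%C - p.2 * (p.2^*)%C) * (y - x).
  by rewrite coefs_detE // mul1r.
rewrite /den in dx dy *; move: (p.1^*)%C (p.2^*)%C dx dy => a' b' dx dy.
by field; rewrite dx dy.
Qed.

Lemma moebius_quad p x y : disk_aut_coefs p -> den p x != 0 -> den p y != 0 ->
  moebius p.1 p.2 y - moebius p.1 p.2 x - den p x ^- 2 * (y - x) =
  - (p.2^*)%C * (y - x) ^+ 2 / (den p x ^+ 2 * den p y).
Proof.
move=> hp dx dy; rewrite moebiusB //.
have -> : - (p.2^*)%C * (y - x) ^+ 2 = (den p x - den p y) * (y - x) by rewrite /den; ring.
move: (den p x) (den p y) dx dy => u v u0 v0; field.
by rewrite u0 v0.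
Qed.

Lemma moebius_derive p x : disk_aut_coefs p -> N x <= 1 ->
  is_derive x 1 (moebius p.1 p.2) (den p x ^- 2).
Proof.
move=> hp x1; have dx := den_neq0 hp x1.
set d := N (den p x); have d0 : 0 < d by rewrite N_gt0.
have b0 : 0 < N p.2 + 1 by rewrite ltr_wpDl ?N_ge0.
pose e := d / (2 * (N p.2 + 1)).
have e0 : 0 < e by rewrite divr_gt0 // mulr_gt0.
pose M := N p.2 / (d ^+ 2 * (d / 2)).
have M0 : 0 <= M by rewrite divr_ge0 ?N_ge0 // mulr_ge0 ?sqr_ge0 // divr_ge0 // ltW.
apply: (@is_derive_quad C (moebius p.1 p.2) x _ e%:C%C M%:C%C).
- by rewrite ltcR.
- by rewrite lecR.
move=> y; rewrite !normE ltcR => yx; rewrite -rmorphXn -rmorphM lecR.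
have dy : d / 2 <= N (den p y).
  have := ND (den p y) ((p.2^*)%C * (x - y)).
  have -> : den p y + (p.2^*)%C * (x - y) = den p x by rewrite /den; ring.
  rewrite -/d NM NJ Ndist.
  have : N p.2 * N (y - x) <= d / 2.
    apply: (@le_trans _ _ ((N p.2 + 1) * e)).
      by rewrite ler_pM ?N_ge0 ?lerDl // ltW.
    rewrite le_eqVlt; apply/orP; left; apply/eqP; rewrite /e; field.
    by rewrite gt_eqF.
  lra.
have dy0 : den p y != 0 by rewrite -N_gt0 (lt_le_trans _ dy) // divr_gt0.
rewrite moebius_quad // !(NM, NV, NX) NN NJ -/d.
rewrite -mulrA [_ ^+ 2 / _]mulrC mulrA ler_wpM2r ?sqr_ge0 // /M ler_wpM2l ?N_ge0 //.
rewrite lef_pV2 ?posrE ?mulr_gt0 ?exprn_gt0 ?divr_gt0 // ?N_gt0 //.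
by rewrite ler_wpM2l // exprn_ge0 // ltW.
Qed.

Lemma derive1_moebius p x : disk_aut_coefs p -> N x <= 1 ->
  derive1 (moebius p.1 p.2) x = den p x ^- 2.
Proof. by move=> hp x1; rewrite derive1E; case: (moebius_derive hp x1). Qed.

Lemma moebius_norm p z : disk_aut_coefs p -> N z <= 1 ->
  1 - N (moebius p.1 p.2 z) ^+ 2 = (1 - N z ^+ 2) / N (den p z) ^+ 2.
Proof.
move=> hp z1; have dz := den_neq0 hp z1.
have nd : N (den p z) ^+ 2 != 0 by rewrite expf_neq0 // N_eq0.
rewrite moebiusE NM NV exprMn exprVn.
have -> : 1 - N z ^+ 2 = N (den p z) ^+ 2 - N (p.1 * z + p.2) ^+ 2.
  have h := coefsE hp; have -> : 1 - N z ^+ 2 =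
    (N p.1 ^+ 2 - N p.2 ^+ 2) * (1 - N z ^+ 2) by rewrite h addrK mul1r.
  rewrite /den !Nsq; case: p {hp dz nd h} => [[a1 a2] [b1 b2]]; case: z {z1} => x y /=.
  ring.
by rewrite mulrBl divff.
Qed.

Lemma moebius_disk p r : disk_aut_coefs p -> 0 <= r < 1 ->
  exists2 s, 0 <= s < 1 & forall z, N z <= r -> N (moebius p.1 p.2 z) <= s.
Proof.
move=> hp /andP[r0 r1]; pose A := N p.1 + N p.2.
have A1 : 1 <= A.
  rewrite -(@ler_pXn2r _ 2) ?nnegrE ?addr_ge0 ?N_ge0 // expr1n sqrrD.
  have := coefsE hp; have := mulr_ge0 (N_ge0 p.1) (N_ge0 p.2).
  have := sqr_ge0 (N p.2); lra.
have A0 : 0 < A by exact: lt_le_trans A1.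
pose d := (1 - r ^+ 2) / A ^+ 2.
have d1 : d <= 1.
  rewrite ler_pdivrMr ?exprn_gt0 // mul1r; apply: (@le_trans _ _ 1).
    by rewrite gerBl sqr_ge0.
  by rewrite exprn_ege1.
have d0 : 0 < d by rewrite divr_gt0 ?exprn_gt0 // subr_gt0 exprn_ilt1.
(* On the disk of radius [r] one has 1 - |moebius z|^2 >= d, and (1 - d / 2)^2 >= 1 - d avoids a
   square root. *)
exists (1 - d / 2); first by apply/andP; split; lra.
move=> z zr; have z1 : N z <= 1 by rewrite (le_trans zr) // ltW.
rewrite -(@ler_pXn2r _ 2) ?nnegrE ?N_ge0 //; last by lra.
have h : d <= 1 - N (moebius p.1 p.2 z) ^+ 2.
  rewrite moebius_norm // ler_pM ?invr_ge0 ?sqr_ge0 //.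
  - by rewrite subr_ge0 exprn_ile1 // ltW.
  - by rewrite lerB // lerXn2r ?nnegrE ?N_ge0.
  rewrite lef_pV2 ?posrE ?exprn_gt0 ?N_gt0 ?den_neq0 //.
  rewrite lerXn2r ?nnegrE ?N_ge0 ?(ltW A0) //.
  apply: le_trans (ND _ _) _; rewrite NM !NJ /A addrC lerD2l.
  by rewrite ler_piMr ?N_ge0.
have := sqr_ge0 (d / 2); lra.
Qed.

Lemma moebius_smooth p : disk_aut_coefs p ->
  smooth (moebius p.1 p.2) (derive1 (moebius p.1 p.2)).
Proof.
move=> hp r /[dup] r01 /andP[r0 r1].
pose d := N p.1 - N p.2; have d0 : 0 < d := coefs_gap hp.
exists (1 + d ^- 2 + N p.2 * d ^- 3) => x y xr yr.
have x1 : N x <= 1 by rewrite (le_trans xr) // ltW.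
have y1 : N y <= 1 by rewrite (le_trans yr) // ltW.
have b0 : 0 <= N p.2 * d ^- 3.
  by rewrite mulr_ge0 ?N_ge0 // invr_ge0 exprn_ge0 // ltW.
have i0 : 0 <= d ^- 2 by rewrite invr_ge0 exprn_ge0 // ltW.
have bd z : N z <= 1 -> (N (den p z))^-1 <= d^-1.
  by move=> z1; rewrite lef_pV2 ?posrE // ?N_gt0 ?den_neq0 // N_den.
have bd2 z : N z <= 1 -> (N (den p z) ^+ 2)^-1 <= d ^- 2.
  move=> z1; rewrite -!exprVn lerXn2r ?nnegrE ?invr_ge0 ?N_ge0 ?(ltW d0) //.
  exact: bd.
rewrite derive1_moebius //; split.
- have [s /andP[s0 s1] H] := moebius_disk hp r01.
  have := H x xr; lra.
- by rewrite NV NX; have := bd2 x x1; lra.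
rewrite moebius_quad ?den_neq0 // !(NM, NV, NX) NN NJ.
rewrite -mulrA [_ ^+ 2 / _]mulrC mulrA ler_wpM2r ?sqr_ge0 //.
apply: (@le_trans _ _ (N p.2 * d ^- 3)); last by lra.
rewrite ler_wpM2l ?N_ge0 // [d ^+ 3]exprSr (invfM (N (den p x) ^+ 2)) (invfM (d ^+ 2)) ler_pM ?(bd2 x) ?(bd y) //.
  by rewrite invr_ge0 sqr_ge0.
by rewrite invr_ge0 N_ge0.
Qed.

(** The values at 0 and at plus or minus 1/2 determine the coefficients up to a factor [l] with [l]
    real and unimodular, that is, up to sign. Equality then extends to the whole plane, so group
    laws known on the disk become equalities of functions. *)
Lemma moebius_unique p q : disk_aut_coefs p -> disk_aut_coefs q ->
  (forall z, disk z -> moebius p.1 p.2 z = moebius q.1 q.2 z) ->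
  moebius p.1 p.2 = moebius q.1 q.2.
Proof.
move=> hp hq H.
have E z : N z < 1 -> (p.1 * z + p.2) * den q z = (q.1 * z + q.2) * den p z.
  move=> z1; have := H z; rewrite diskE => /(_ z1); rewrite !moebiusE => /eqP.
  by rewrite eqr_div ?den_neq0 ?(ltW z1) // => /eqP.
have E0 : p.2 * (q.1^*)%C = q.2 * (p.1^*)%C.
  by have := E 0; rewrite N0 ltr01 /den !mulr0 !add0r => /(_ isT).
have n1 : N (2^-1 : C) < 1 by rewrite NV Nn invf_lt1 // ltr1n.
have n2 : N (- 2^-1 : C) < 1 by rewrite NN.
have E1 := E _ n1; have E2 := E _ n2.
have det1 := coefs_detE hp; have det2 := coefs_detE hq.
have pa : (p.1^*)%C != 0.
  rewrite conjc_eq0 -N_gt0; apply: lt_le_trans (coefs_gap hp) _.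
  by rewrite gerBl N_ge0.
have [l l1] : exists l, (q.1^*)%C = l * (p.1^*)%C.
  by exists ((q.1^*)%C / (p.1^*)%C); rewrite divfK.
have l2 : q.2 = l * p.2.
  by apply: (mulIf pa); rewrite -E0 l1; ring.
have l1' : q.1 = (l^*)%C * p.1 by rewrite -[LHS]conjcK l1 (rmorphM conjc) /= conjcK.
have l2' : (q.2^*)%C = (l^*)%C * (p.2^*)%C by rewrite l2 (rmorphM conjc).
have ll : l * (l^*)%C = 1.
  have := det2; rewrite l1 l2' l1' l2.
  move=> <-; rewrite -[LHS]mulr1 -det1; ring.
have lr : l = (l^*)%C.
  have : (p.1 * (q.1^*)%C + p.2 * (q.2^*)%C) = q.1 * (p.1^*)%C + q.2 * (p.2^*)%C.
    have E3 : (p.1 * 2^-1 + p.2) * den q 2^-1 - (p.1 * - 2^-1 + p.2) * den q (- 2^-1)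
      = (q.1 * 2^-1 + q.2) * den p 2^-1 - (q.1 * - 2^-1 + q.2) * den p (- 2^-1).
      by rewrite E1 E2.
    rewrite /den in E3.
    move: E3; set a' := (q.1^*)%C; set b' := (q.2^*)%C; set c' := (p.1^*)%C.
    set d' := (p.2^*)%C => E3.
    transitivity ((p.1 / 2 + p.2) * (b' / 2 + a') - (p.1 * - 2^-1 + p.2) * (b' * - 2^-1 + a')).
      by field.
    by rewrite E3; field.
  rewrite l1 l2' l1' l2 => h.
  have : l * (p.1 * (p.1^*)%C - p.2 * (p.2^*)%C) =
     (l^*)%C * (p.1 * (p.1^*)%C - p.2 * (p.2^*)%C).
    apply/eqP; rewrite -subr_eq0; apply/eqP.
    transitivity (p.1 * (l * (p.1^*)%C) + p.2 * ((l^*)%C * (p.2^*)%C) -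
      ((l^*)%C * p.1 * (p.1^*)%C + l * p.2 * (p.2^*)%C)); first by ring.
    by rewrite h subrr.
  by rewrite det1 !mulr1.
have l0 : l != 0 by apply: contra_eq_neq ll => ->; rewrite mul0r eq_sym oner_neq0.
apply/funext => z; rewrite /moebius l1 l2' l1' l2 -lr -!mulrA -!mulrDr.
(* Both maps have the same pole, and there both take the value 0 of a division by zero. *)
have [D0|D0] := eqVneq ((p.2^*)%C * z + (p.1^*)%C) 0.
  by rewrite D0 !mulr0 invr0 !mulr0.
by rewrite -mulf_div divff // mul1r.
Qed.

(** The first row of the product of the two matrices in SU(1,1). *)
Definition coefs_mul p q : C * C :=
  (p.1 * q.1 + p.2 * (q.2^*)%C, p.1 * q.2 + p.2 * (q.1^*)%C).

Lemma den_mul p q z : disk_aut_coefs q -> N z <= 1 ->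
  den (coefs_mul p q) z = den p (moebius q.1 q.2 z) * den q z.
Proof.
move=> hq z1; have dz := den_neq0 hq z1.
rewrite moebiusE {1 2}/den mulrDl mulrA mulfVK // /coefs_mul /=.
rewrite !rmorphD !rmorphM /= !conjcK /den; ring.
Qed.

Lemma moebius_mul p q z : disk_aut_coefs p -> disk_aut_coefs q -> N z <= 1 ->
  moebius (coefs_mul p q).1 (coefs_mul p q).2 z =
  moebius p.1 p.2 (moebius q.1 q.2 z).
Proof.
move=> hp hq z1; rewrite moebiusE den_mul // [in RHS]moebiusE.
have dz := den_neq0 hq z1.
have -> : (coefs_mul p q).1 * z + (coefs_mul p q).2 =
  (p.1 * moebius q.1 q.2 z + p.2) * den q z.
  by rewrite moebiusE [RHS]mulrDl -[p.1 * _ * _]mulrA divfK // /coefs_mul /den /=; ring.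
by rewrite -mulf_div divff // mulr1.
Qed.

Lemma coefs_mulP p q : disk_aut_coefs p -> disk_aut_coefs q ->
  disk_aut_coefs (coefs_mul p q).
Proof.
move=> hp hq; have h1 := coefsE hp; have h2 := coefsE hq.
rewrite /disk_aut_coefs /= !normE -!rmorphXn -rmorphB /=.
rewrite -[RHS]/((1 : R)%:C%C); congr (_%:C)%C.
have -> : (1 : R) = (N p.1 ^+ 2 - N p.2 ^+ 2) * (N q.1 ^+ 2 - N q.2 ^+ 2).
  by rewrite h1 h2 !addrK mulr1.
rewrite !Nsq; case: p {hp h1} => [[a1 a2] [b1 b2]].
case: q {hq h2} => [[c1 c2] [d1 d2]] /=; ring.
Qed.

(** On the circle the numerator is [t] times the conjugate of [den p t], so t g'(t) / g(t) = 1 /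
    |den p t|^2 is positive. This links the weights |g'(t0)| of the Martin function with the g'(t0)
    in its derivative. *)
Lemma moebius_circle p t : disk_aut_coefs p -> N t = 1 ->
  t * derive1 (moebius p.1 p.2) t =
  (N (derive1 (moebius p.1 p.2) t))%:C%C * moebius p.1 p.2 t.
Proof.
move=> hp t1; have t1' : N t <= 1 by rewrite t1.
have dt := den_neq0 hp t1'.
rewrite derive1_moebius // moebiusE NV NX fmorphV /= -NconjM.
have tt : t * (t^*)%C = 1 by rewrite NconjM t1 expr1n.
have dJ : (den p t)^*%C != 0 by rewrite conjc_eq0.
have -> : p.1 * t + p.2 = t * (den p t)^*%C.
  rewrite /den rmorphD rmorphM /= !conjcK mulrDr mulrCA tt mulr1; ring.
move: (den p t)^*%C dJ => D' dJ; field.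
by rewrite dt dJ.
Qed.

End Moebius.

(** * The twisted series over the group and the Martin function *)

Section PoincareSeries.
Context {R : realType} (Gamma : set (R[i] -> R[i])) (t0 : R[i]).
Context (hGamma : fuchsian Gamma) (t01 : modulus t0 = 1).
Context (hsum : (\esum_(gamma in Gamma) (modulus (derive1 gamma t0))%:E < +oo)%E).
Local Notation C := R[i].
Local Notation N := (@modulus R).
Local Notation Re := (@complex.Re R).
Local Notation Im := (@complex.Im R).

Lemma mem_val (g : Gamma) : Gamma (val g).
Proof. exact: set_mem (valP g). Qed.

Lemma esum_fset_le (A : set (C -> C)) (f : (C -> C) -> R) (F : {fset Gamma}) :
  (forall h, 0 <= f h) ->
  ((\sum_(g <- F) (if val g \in A then f (val g) else 0))%:E <=
     \esum_(h in A) (f h)%:E)%E.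
Proof.
move=> f0; rewrite -big_mkcond /= -big_filter.
rewrite -(big_map val xpredT f).
set s := [seq _ | _ <- _].
have us : uniq s by rewrite map_inj_uniq ?filter_uniq ?fset_uniq //; exact: val_inj.
apply: ereal_sup_ubound => /=; exists [set` s].
  split; first exact: finite_seq.
  move=> h /= /mapP[g]; rewrite mem_filter => /andP[gA _] ->; exact: set_mem.
by rewrite -fsbig_seq // sumEFin.
Qed.

Definition wgt (g : Gamma) : R := N (derive1 (val g) t0).

Definition tot : R := fine (\esum_(gamma in Gamma) (N (derive1 gamma t0))%:E)%E.

Lemma bsum_wgt : bsum wgt tot.
Proof.
split=> [g|F]; first exact: N_ge0.
rewrite -lee_fin fineK; last first.
  by rewrite ge0_fin_numE // esum_ge0 // => h _; rewrite lee_fin N_ge0.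
have := @esum_fset_le Gamma (fun h => N (derive1 h t0)) F (fun h => N_ge0 _).
congr (_%:E <= _)%E; apply: eq_bigr => g _.
by rewrite (valP g).
Qed.

Lemma gam_coefs (g : C -> C) : Gamma g ->
  exists2 p, disk_aut_coefs p & g = moebius p.1 p.2.
Proof. exact: fuchsian_aut. Qed.

Lemma gam_smooth g : Gamma g -> smooth g (derive1 g).
Proof. by move=> /gam_coefs[p hp ->]; exact: moebius_smooth. Qed.

Lemma gam_disk g r : Gamma g -> 0 <= r < 1 ->
  exists2 s, 0 <= s < 1 & forall z, N z <= r -> N (g z) <= s.
Proof. by move=> /gam_coefs[p hp ->]; exact: moebius_disk. Qed.

Lemma gam_disk1 g z : Gamma g -> N z < 1 -> N (g z) < 1.
Proof.
move=> Gg z1; have [|s /andP[_ s1] H] := gam_disk Gg (r := N z).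
  by rewrite N_ge0.
exact: le_lt_trans (H z (lexx _)) s1.
Qed.

Lemma gam_circle g z : Gamma g -> N z = 1 -> N (g z) = 1.
Proof.
move=> /gam_coefs[p hp ->] z1; have z1' : N z <= 1 by rewrite z1.
have := moebius_norm hp z1'; rewrite z1 expr1n subrr mul0r.
move=> /eqP; rewrite subr_eq0 eq_sym => /eqP h.
by apply/eqP; rewrite -(@eqrXn2 _ 2) ?N_ge0 // h expr1n.
Qed.

Lemma gam_derive_neq0 g z : Gamma g -> N z <= 1 -> derive1 g z != 0.
Proof.
move=> /gam_coefs[p hp ->] z1; rewrite derive1_moebius // invr_eq0 expf_neq0 //.
exact: den_neq0.
Qed.

(** This two-point identity gives the series its weight: it moves a group element through the kernel
    (g(t0) - z)^-2. It must hold on the closed disk because g(t0) lies on the circle. *)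
Lemma gam_sqrB g x y : Gamma g -> N x <= 1 -> N y <= 1 ->
  (g y - g x) ^+ 2 = derive1 g x * derive1 g y * (y - x) ^+ 2.
Proof.
move=> /gam_coefs[p hp ->] x1 y1; rewrite !derive1_moebius //.
have dx := den_neq0 hp x1; have dy := den_neq0 hp y1.
rewrite moebiusB //; move: (den p x) (den p y) dx dy => u v u0 v0; field.
by rewrite u0 v0.
Qed.

Lemma gam_circle_derive g t : Gamma g -> N t = 1 ->
  t * derive1 g t = (N (derive1 g t))%:C%C * g t.
Proof. by move=> /gam_coefs[p hp ->]; exact: moebius_circle. Qed.

Lemma gam_unique g h : Gamma g -> Gamma h ->
  (forall z, disk z -> g z = h z) -> g = h.
Proof.
move=> /gam_coefs[p hp ->] /gam_coefs[q hq ->]; exact: moebius_unique.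
Qed.

(* The closed disk matters at t0, where the hypothesis says nothing. *)
Lemma gam_comp g h k : Gamma g -> Gamma h -> Gamma k ->
  (forall z, disk z -> k z = g (h z)) -> forall z, N z <= 1 ->
  k z = g (h z) /\ derive1 k z = derive1 g (h z) * derive1 h z.
Proof.
move=> Gg Gh Gk; have [p hp ->] := gam_coefs Gg; have [q hq ->] := gam_coefs Gh.
have [r hr ->] := gam_coefs Gk => E.
have hm := coefs_mulP hp hq.
have Er : moebius r.1 r.2 = moebius (coefs_mul p q).1 (coefs_mul p q).2.
  apply: moebius_unique => // z dz; rewrite moebius_mul // ?E //.
  by move: dz; rewrite diskE => /ltW.
move=> z z1; rewrite Er moebius_mul //; split=> //.
have qz1 : N (moebius q.1 q.2 z) <= 1.
  rewrite -(@ler_pXn2r _ 2) ?nnegrE ?N_ge0 // expr1n -subr_ge0 moebius_norm //.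
  by rewrite divr_ge0 ?sqr_ge0 // subr_ge0 exprn_ile1 // N_ge0.
rewrite !derive1_moebius // den_mul // exprMn invfM //.
Qed.

Lemma gam_mul_exists (g : C -> C) (h : Gamma) : Gamma g ->
  exists k : Gamma, forall z, disk z -> val k z = g (val h z).
Proof.
move=> Gg; have [k Gk kE] := fuchsian_comp hGamma Gg (mem_val h).
by exists (exist _ k (mem_set Gk)).
Qed.

Definition lmul (g : C -> C) (Gg : Gamma g) (h : Gamma) : Gamma :=
  sval (cid (gam_mul_exists h Gg)).

Lemma lmulE g (Gg : Gamma g) h z : disk z -> val (lmul Gg h) z = g (val h z).
Proof. by move=> dz; rewrite /lmul; case: cid => k /= ->. Qed.

Lemma gam_diskP g z : Gamma g -> disk z -> disk (g z).
Proof. by rewrite !diskE; exact: gam_disk1. Qed.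

Lemma lmulK g h (Gg : Gamma g) (Gh : Gamma h) :
  (forall z, disk z -> h (g z) = z) -> cancel (lmul Gg) (lmul Gh).
Proof.
move=> hg k; apply/val_inj/gam_unique; [exact: mem_val|exact: mem_val|] => z dz.
by rewrite !lmulE // hg //; apply: gam_diskP => //; exact: mem_val.
Qed.

Lemma lmul_bij g (Gg : Gamma g) : exists2 f, cancel (lmul Gg) f & cancel f (lmul Gg).
Proof.
have [h Gh hg] := fuchsian_inv hGamma Gg.
have [k Gk kh] := fuchsian_inv hGamma Gh.
have gh z : disk z -> g (h z) = z.
  move=> dz; have dh := gam_diskP Gh dz.
  by rewrite -[LHS]kh ?hg ?kh //; exact: gam_diskP.
by exists (lmul Gh); exact: lmulK.
Qed.

Definition tau (g : Gamma) : C := val g t0.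

Lemma N_tau g : N (tau g) = 1.
Proof. by apply: gam_circle => //; exact: mem_val. Qed.

Definition pterm (b : (C -> C) -> C) (g : Gamma) (z : C) : C :=
  b (val g) * (derive1 (val g) t0 * (tau g - z) ^- 2).

(** The series S_b of the overview. *)
Definition pser b z : C := csum (pterm b ^~ z).

Definition charlike (b : (C -> C) -> C) := forall g, Gamma g -> N (b g) = 1.

Lemma smooth_pser b : charlike b -> exists ds, smooth (pser b) ds.
Proof.
move=> b1; pose dt (g : Gamma) z := b (val g) * (derive1 (val g) t0 *
  ((tau g - z) ^- 2 * (tau g - z)^-1 + (tau g - z)^-1 * (tau g - z) ^- 2)).
exists (fun z => csum (dt^~ z)) => r r01; pose K := (1 - r) ^- 3.
have r1 : r <= 1 by case/andP: r01 => _ /ltW.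
have K0 : 0 <= K by rewrite invr_ge0 exprn_ge0 // subr_ge0.
exists (11 * K * K * tot); apply: (qd_csum bsum_wgt); first by rewrite !mulr_ge0.
move=> g; have Q := qd_kern r01 (N_tau g).
have := qd_scal (b (val g)) (qd_scal (derive1 (val g) t0) (qd_mul r1 Q Q)).
rewrite (b1 _ (mem_val g)) mul1r -/(wgt g) mulrC.
apply: qd_ext => z _ //; by rewrite /pterm expr2 invfM.
Qed.

Lemma dominated_pser b z : charlike b -> N z < 1 -> dominated (pterm b ^~ z).
Proof.
move=> b1 z1; apply: (dominated_le bsum_wgt (K := (1 - N z) ^- 2)).
  by rewrite invr_ge0 sqr_ge0.
move=> g; rewrite !NM (b1 _ (mem_val g)) mul1r mulrC ler_wpM2r ?N_ge0 //.
have h := N_kern (N_tau g) (lexx (N z)).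
have z0 : 0 < 1 - N z by rewrite subr_gt0.
rewrite NV NX lef_pV2 ?posrE ?exprn_gt0 ?(lt_le_trans z0) //.
by rewrite lerXn2r ?nnegrE ?N_ge0 // ltW.
Qed.

(** After reindexing by left translation the chain rule at [t0] produces d'(g(t0)), and [gam_sqrB]
    cancels this factor, leaving [b d] and the inverse of d'(z). *)
Lemma pser_automorphic b d z : charlike b ->
  (forall g h k, Gamma g -> Gamma h -> Gamma k ->
    (forall z, disk z -> k z = g (h z)) -> b k = b g * b h) ->
  Gamma d -> N z < 1 -> pser b (d z) * derive1 d z = b d * pser b z.
Proof.
move=> b1 bM Gd z1; have dz1 := gam_disk1 Gd z1.
have [f fK Kf] := lmul_bij Gd.
rewrite /pser -(csum_reindex fK Kf (dominated_pser b1 dz1)).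
have D1 : dominated (fun g => pterm b (lmul Gd g) (d z)).
  have [w [W [[w0 wW] H]]] := dominated_pser b1 dz1.
  exists (w \o lmul Gd), W; split=> [|i]; last exact: H.
  split=> [i|F]; first exact: w0.
  have li : {in F &, injective (lmul Gd)} by move=> x y _ _ /(can_inj fK).
  have := wW [fset lmul Gd x | x in F]%fset.
  by rewrite big_imfset.
rewrite mulrC -!csumZ //; last exact: dominated_pser.
apply: eq_csum => g; rewrite /pterm.
have Gg := mem_val g; have Gl := mem_val (lmul Gd g).
have t1 : N t0 <= 1 by rewrite t01.
have [E1 E2] := gam_comp Gd Gg Gl (@lmulE _ Gd g) t1.
rewrite (bM _ _ _ Gd Gg Gl (@lmulE _ Gd g)) E2 /tau E1.
have g1 : N (val g t0) = 1 by exact: N_tau.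
rewrite (gam_sqrB Gd (ltW z1)) ?g1 //.
have n1 := gam_derive_neq0 Gd (ltW z1).
have n2 : derive1 d (val g t0) != 0 by apply: gam_derive_neq0; rewrite ?g1.
have n3 := kern_neq0 g1 z1.
move: (derive1 d z) (derive1 d (val g t0)) n1 n2 => u v u0 v0.
by field; rewrite u0 v0 n3.
Qed.

Definition mterm (g : Gamma) (z : C) : C :=
  'i%C / 2 * ((tau g + z) / (tau g - z) * (wgt g)%:C%C).

Lemma N_half_i : N ('i%C / 2 : C) = 2^-1.
Proof. by rewrite NM NV Ni Nn mul1r. Qed.

Lemma qd_mterm g r : 0 <= r < 1 -> qd r ((1 + (1 - r) ^- 3) * wgt g) (mterm g)
  (fun z => 'i%C * t0 * pterm (fun=> 1) g z).
Proof.
move=> r01; have := qd_scal ('i%C / 2 * (wgt g)%:C%C) (qd_cayley r01 (N_tau g)).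
have w0 : 0 <= wgt g := N_ge0 _.
have r0 : 0 <= (1 - r) ^- 3.
  by rewrite invr_ge0 exprn_ge0 // subr_ge0; case/andP: r01 => _ /ltW.
move=> H; apply: (@qd_le R r (N ('i%C / 2 * (wgt g)%:C%C) * (1 + 2 * (1 - r) ^- 3))).
  rewrite NM N_half_i NR ger0_norm //.
  have := mulr_ge0 r0 w0; lra.
apply: qd_ext H => z zr; first by rewrite /mterm; ring.
(* Here |g'(t0)| g(t0) is exchanged for t0 g'(t0), the origin of the factor [t0] in m'. *)
have := gam_circle_derive (mem_val g) t01; rewrite -/(wgt g) -/(tau g) => E.
rewrite /pterm mul1r; transitivity
  ('i%C * ((wgt g)%:C%C * tau g) * (tau g - z) ^- 2); last by rewrite -E; ring.
have nz : tau g - z != 0.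
  apply: kern_neq0 (N_tau g) _; apply: le_lt_trans zr _; by case/andP: r01.
by field.
Qed.

Lemma dominated_mterm z : N z < 1 -> dominated (mterm^~ z).
Proof.
move=> z1; have z01 : 0 <= N z < 1 by rewrite N_ge0.
apply: (dominated_le bsum_wgt (K := 1 + (1 - N z) ^- 3)).
  by rewrite addr_ge0 // invr_ge0 exprn_ge0 // subr_ge0 ltW.
by move=> g; have [] := qd_mterm g z01 (lexx (N z)) (lexx (N z)).
Qed.

Lemma martinE z : N z < 1 -> martin Gamma t0 z = csum (mterm^~ z).
Proof.
move=> z1; rewrite /martin -/(csum _) -csumZ; first exact: eq_csum.
have z01 : 0 <= N z < 1 by rewrite N_ge0.
(* [2 * - 'i] is the inverse of ['i / 2], so this removes the constant built into [mterm]. *)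
have := dominatedZ (2 * - 'i%C) (dominated_mterm z1).
congr dominated; apply/funext => g; rewrite /mterm normE /tau -/(wgt g).
have ii : 'i%C * 'i%C = -1 :> C by rewrite -expr2 sqr_i.
transitivity (- ('i%C * 'i%C) * (val g t0 + z) / (val g t0 - z) * (wgt g)%:C%C).
  have := kern_neq0 (N_tau g) z1; rewrite /tau => nz; by field.
by rewrite ii opprK mul1r.
Qed.

Lemma smooth_martin :
  smooth (martin Gamma t0) (fun z => 'i%C * t0 * pser (fun=> 1) z).
Proof.
move=> r r01; exists ((1 + (1 - r) ^- 3) * tot).
have r0 : 0 <= 1 + (1 - r) ^- 3.
  rewrite addr_ge0 // invr_ge0 exprn_ge0 // subr_ge0.
  by case/andP: r01 => _ /ltW.
have r1 : r < 1 by case/andP: r01.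
have := qd_csum bsum_wgt r0 (fun g => qd_mterm g r01).
apply: qd_ext => z zr; first by rewrite martinE // (le_lt_trans zr).
rewrite /pser csumZ //; apply: dominated_pser; first by move=> g _; exact: N1.
exact: le_lt_trans zr r1.
Qed.

Lemma derive1_martin z : N z < 1 ->
  derive1 (martin Gamma t0) z = 'i%C * t0 * pser (fun=> 1) z.
Proof. by move=> z1; rewrite derive1E; case: (smooth_derive smooth_martin z1). Qed.

Lemma Im_mterm g z : N z < 1 ->
  Im (mterm g z) = (1 - N z ^+ 2) / 2 * (wgt g / N (tau g - z) ^+ 2).
Proof.
move=> z1; rewrite /mterm.
have -> : 'i%C / 2 * ((tau g + z) / (tau g - z) * (wgt g)%:C%C) =
  (tau g + z) / (tau g - z) * 'i%C * (2^-1 * wgt g)%:C%C.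
  rewrite rmorphM /= fmorphV rmorph_nat; ring.
by rewrite cImZ ImiRe Re_cayley ?N_tau //; ring.
Qed.

Lemma Im_mterm_ge0 g z : N z < 1 -> 0 <= Im (mterm g z).
Proof.
move=> z1; rewrite Im_mterm // mulr_ge0 //.
  by rewrite divr_ge0 // subr_ge0 exprn_ile1 ?N_ge0 // ltW.
by rewrite divr_ge0 ?N_ge0 ?sqr_ge0.
Qed.

Lemma pser_le_martin b z : charlike b -> N z < 1 ->
  N (pser b z) <= 2 / (1 - N z ^+ 2) * Im (martin Gamma t0 z).
Proof.
move=> b1 z1; set c := 2 / _.
have d0 : 0 < 1 - N z ^+ 2 by rewrite subr_gt0 exprn_ilt1 ?N_ge0.
rewrite mulrC -cImZ martinE // mulrC -csumZ; last exact: dominated_mterm.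
apply: csum_le_Im; first exact: dominated_pser.
  by apply: dominatedZ; exact: dominated_mterm.
move=> g; rewrite mulrC cImZ Im_mterm // /pterm !NM (b1 _ (mem_val g)) mul1r.
rewrite NV NX -/(wgt g) le_eqVlt; apply/orP; left; apply/eqP.
have nz : N (tau g - z) != 0 by rewrite N_eq0 kern_neq0 ?N_tau.
by rewrite /c; field; rewrite nz gt_eqF.
Qed.

Lemma N_sub_scale (a zeta : C) (u : R) : N a = 1 -> N zeta = 1 ->
  N (a - u%:C%C * zeta) ^+ 2 = 1 + u ^+ 2 - 2 * u * Re (a * (zeta^*)%C).
Proof.
move=> /(congr1 (fun x => x ^+ 2)); rewrite Nsq expr1n => h3.
move=> /(congr1 (fun x => x ^+ 2)); rewrite Nsq expr1n => h2.
transitivity (Re a ^+ 2 + Im a ^+ 2 + u ^+ 2 * (Re zeta ^+ 2 + Im zeta ^+ 2) -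
  2 * u * Re (a * (zeta^*)%C)); last by rewrite h3 h2 mulr1.
rewrite Nsq; by case: a {h3} => a b; case: zeta {h2} => c d /=; ring.
Qed.

(* Each term of 2 s Im m(s zeta) / (1 - s^2) is s |g'(t0)| / |g(t0) - s zeta|^2,
   which increases with s on ]0, 1[. *)
Lemma martin_radial (zeta : C) (r s : R) : N zeta = 1 -> 0 < r -> r <= s -> s < 1 ->
  2 * r / (1 - r ^+ 2) * Im (martin Gamma t0 (r%:C%C * zeta)) <=
  2 * s / (1 - s ^+ 2) * Im (martin Gamma t0 (s%:C%C * zeta)).
Proof.
move=> z1 r0 rs s1; have s0 := lt_le_trans r0 rs.
have Nz u : 0 < u -> u < 1 -> N (u%:C%C * zeta) = u.
  by move=> u0 u1; rewrite NM NR z1 mulr1 gtr0_norm.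
have r1 := le_lt_trans rs s1.
have nr := Nz _ r0 r1; have ns := Nz _ s0 s1.
have lr : N (r%:C%C * zeta) < 1 by rewrite nr.
have ls : N (s%:C%C * zeta) < 1 by rewrite ns.
rewrite mulrC -cImZ mulrC [leRHS]mulrC -cImZ [in leRHS]mulrC !martinE //.
rewrite -!csumZ; [|exact: dominated_mterm|exact: dominated_mterm].
have D1 := dominatedZ (2 * s / (1 - s ^+ 2))%:C%C (dominated_mterm ls).
have D2 := dominatedZ (2 * r / (1 - r ^+ 2))%:C%C (dominated_mterm lr).
rewrite -subr_ge0 -cImB -csumB //.
apply: (@le_trans _ _ (N (csum (fun _ : Gamma => 0)))); first exact: N_ge0.
have D0 : dominated (fun _ : Gamma => 0 : C).
  by apply: (dominated_le bsum_wgt (lexx 0)) => g; rewrite mul0r N0.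
apply: csum_le_Im => //.
  have [w1 [W1 [[p1 b1] H1]]] := D1; have [w2 [W2 [[p2 b2] H2]]] := D2.
  exists (fun g => w1 g + w2 g), (W1 + W2); split.
    split=> [g|F]; first exact: addr_ge0.
    by rewrite big_split lerD.
  by move=> g; apply: le_trans (NB _ _) _; rewrite lerD.
move=> g; rewrite N0 cImB mulrC cImZ [X in _ - Im X]mulrC cImZ !Im_mterm // nr ns.
have D u := N_sub_scale u (N_tau g) z1.
have Dr : 0 < N (tau g - r%:C%C * zeta) ^+ 2.
  by rewrite exprn_gt0 // N_gt0 kern_neq0 ?N_tau.
have Ds : 0 < N (tau g - s%:C%C * zeta) ^+ 2.
  by rewrite exprn_gt0 // N_gt0 kern_neq0 ?N_tau.
have qr : 0 < 1 - r ^+ 2 by rewrite subr_gt0 exprn_ilt1 // ltW.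
have qs : 0 < 1 - s ^+ 2 by rewrite subr_gt0 exprn_ilt1 // ltW.
(* The factors [s] and [r] make the cosine terms of the two distances cancel, leaving a quantity of
   constant sign that does not depend on [g]. *)
have h : N (tau g - r%:C%C * zeta) ^+ 2 * s - N (tau g - s%:C%C * zeta) ^+ 2 * r =
  (s - r) * (1 - r * s) by rewrite !D; ring.
move: Dr Ds h; set dr := N _ ^+ 2; set ds := N _ ^+ 2 => Dr Ds h.
have -> : (1 - s ^+ 2) / 2 * (wgt g / ds) * (2 * s / (1 - s ^+ 2)) -
    (1 - r ^+ 2) / 2 * (wgt g / dr) * (2 * r / (1 - r ^+ 2)) =
    wgt g * (dr * s - ds * r) / (dr * ds).
  by field; rewrite !gt_eqF.
have rs1 : r * s <= 1 by rewrite mulr_ile1 // ltW.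
by rewrite h divr_ge0 ?mulr_ge0 ?N_ge0 ?subr_ge0 ?(ltW Dr) ?(ltW Ds).
Qed.

End PoincareSeries.

(** * The Martin function near the circle *)

Section BoundaryValues.
Context {R : realType}.
Local Notation C := R[i].
Local Notation N := (@modulus R).
Local Notation Im := (@complex.Im R).
Local Notation mu := (@lebesgue_measure R).
Local Notation J := (`[0, 2 * pi]%classic : set R).

(** The exceptional set is the countable union of the sets [E (k, n0)] on which [x_ n] is at least 1
    / (k + 1) for all [n >= n0]; Markov's inequality makes each of them null. *)
Lemma small_integrals_ae (x_ : nat -> R -> R) : (forall n, continuous (x_ n)) ->
  (forall n t, 0 <= x_ n t) ->
  \int[mu]_(t in J) x_ n t @[n --> \oo] --> 0 ->
  aeJ (fun t => forall e : R, 0 < e -> forall n0, exists2 n, (n0 <= n)%N & x_ n t < e).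
Proof.
move=> cx x0 lim.
pose E (kn : nat * nat) : set R :=
  J `&` \bigcap_n (if (kn.2 <= n)%N then x_ n @^-1` `[kn.1.+1%:R^-1, +oo[ else setT).
have mE kn : measurable (E kn : set (measurableTypeR R)).
  apply: measurableI => //; apply: bigcap_measurable => // n _.
  case: ifP => _ //; rewrite -[X in measurable X]setTI.
  by apply: (continuous_measurable_fun (cx n)) => //; exact: measurable_itv.
have E0 kn : mu (E kn) = 0%E.
  case: kn => k n0; apply/eqP; rewrite eq_le measure_ge0 andbT.
  pose d : R := k.+1%:R^-1; have d0 : 0 < d by rewrite invr_gt0 ltr0n.
  suff H e : 0 < e -> (mu (E (k, n0)) <= e%:E)%E.
    by apply/lee_addgt0Pr => e /H; rewrite add0e.
  move=> e0; have de0 : 0 < d * e by rewrite mulr_gt0.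
  have /cvgrPdist_lt/(_ _ de0)[n1 _ Hn] := lim.
  pose n := maxn n0 n1.
  have := Hn n (leq_maxr _ _); rewrite sub0r normrN => /(le_lt_trans (ler_norm _)) h.
  have ix : mu.-integrable J (EFin \o x_ n) by exact: integrableJ (cx n).
  rewrite -(@lee_pmul2l _ d%:E) ?lte_fin // -EFinM.
  apply: le_trans (_ : (\int[mu]_(t in J) (x_ n t)%:E <= _)%E); last first.
    rewrite -[leLHS]fineK; last exact: integrable_fin_num.
    by rewrite lee_fin; exact: ltW h.
  have mxn : measurable_fun J (x_ n) := measurableJ_cont (cx n).
  apply: (@le_trans _ _ (\int[mu]_(t in E (k, n0)) (x_ n t)%:E)%E); last first.
    apply: ge0_subset_integral => //; first exact/measurable_EFinP.
      by move=> t _; rewrite lee_fin.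
    exact: subIsetl.
  rewrite -integral_cst //; apply: ge0_le_integral => //.
  - by move=> t _; rewrite lee_fin ltW.
  - apply/measurable_EFinP; apply: measurable_funS mxn => //; exact: subIsetl.
  - move=> t [_ /(_ n I)]; rewrite leq_maxl /= in_itv /= andbT lee_fin; exact.
have neg : mu.-negligible (\bigcup_k \bigcup_n E (k, n)).
  apply: negligible_bigcup => k; apply: negligible_bigcup => n.
  by exists (E (k, n)); split=> //; exact: E0.
apply: negligibleS neg => t /= /not_implyP[tJ].
move=> /existsNP[e /not_implyP[e0 /existsNP[n0 H]]].
have [k ke] : exists k : nat, k.+1%:R^-1 <= e.
  exists (Num.trunc e^-1); rewrite -[leRHS]invrK lef_pV2 ?posrE ?ltr0n ?invr_gt0 //.
  exact: ltW (truncnS_gt _).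
exists k => //; exists n0 => //; split; first by rewrite /= in_itv.
move=> n _ /=; case: ifP => // nn; rewrite /= in_itv /= andbT (le_trans ke) //.
rewrite leNgt; apply/negP => xe; apply: H; by exists n.
Qed.

(** [chord_lower] doubles as injectivity of [expi]: an interior parameter shares its value with no
    other point of the period. *)
Lemma aeJ_expi_neq (c : C) : aeJ (fun t => expi t != c).
Proof.
have [[x [x02 xc]]|H] := pselect (exists x : R, 0 < x < 2 * pi /\ expi x = c); last first.
  apply: aeJS aeJ_interior => t _ t02; apply/eqP => tc; apply: H; by exists t.
have n1 : mu.-negligible [set x].
  by exists [set x]; split=> //; exact: lebesgue_measure_set1.
apply: negligibleS n1 => t /= /not_implyP[tJ /negP]; rewrite negbK => /eqP tc.
have [d d0 /(_ t tJ)] := chord_lower x02.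
rewrite tc xc subrr N0 expr0n /= pmulr_rle0 // => h.
have : (t - x) ^+ 2 = 0 by apply/eqP; rewrite eq_le h sqr_ge0.
by move=> /eqP; rewrite expf_eq0 /= subr_eq0 => /eqP.
Qed.

End BoundaryValues.

Section MartinBoundary.
Context {R : realType} (Gamma : set (R[i] -> R[i])) (t0 : R[i]).
Context (hGamma : fuchsian Gamma) (t01 : modulus t0 = 1).
Context (hsum : (\esum_(gamma in Gamma) (modulus (derive1 gamma t0))%:E < +oo)%E).
Local Notation C := R[i].
Local Notation N := (@modulus R).
Local Notation Re := (@complex.Re R).
Local Notation Im := (@complex.Im R).
Local Notation mu := (@lebesgue_measure R).
Local Notation J := (`[0, 2 * pi]%classic : set R).
Local Notation m := (martin Gamma t0).
Local Notation mt := (@mterm R Gamma t0).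

Definition mrest (F : {fset Gamma}) (z : C) : C :=
  csum (fun g => if g \in F then 0 else mt g z).

Lemma dominated_mrest (F : {fset Gamma}) z : N z < 1 ->
  dominated (fun g => if g \in F then 0 else mt g z).
Proof.
move=> z1; have [w [W [bw H]]] := dominated_mterm hGamma t01 hsum z1.
exists w, W; split=> // g; case: ifP => // _; rewrite N0; exact: (proj1 bw).
Qed.

Lemma martin_split (F : {fset Gamma}) z : N z < 1 ->
  m z = \sum_(g <- F) mt g z + mrest F z.
Proof.
move=> z1; have [w [W [bw H]]] := dominated_mterm hGamma t01 hsum z1.
rewrite martinE // -csum_finite /mrest -csumD.
- by apply: eq_csum => g; case: ifP; rewrite ?addr0 ?add0r.
- by exists w, W; split=> // g; case: ifP => // _; rewrite N0; exact: (proj1 bw).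
- exact: dominated_mrest.
Qed.

Lemma smooth_mrest (F : {fset Gamma}) : exists ds, smooth (mrest F) ds.
Proof.
exists (fun z => csum (fun g => if g \in F then 0 else 'i%C * t0 * pterm t0 (fun=> 1) g z)).
move=> r r01; exists ((1 + (1 - r) ^- 3) * tot Gamma t0).
have r0 : 0 <= 1 + (1 - r) ^- 3.
  rewrite addr_ge0 // invr_ge0 exprn_ge0 // subr_ge0.
  by case/andP: r01 => _ /ltW.
apply: (qd_csum (f := fun g z => if g \in F then 0 else mt g z) (bsum_wgt hsum) r0) => g.
case: (g \in F); last exact: (qd_mterm hGamma t01 g r01).
apply: (@qd_le R r (N (0 : C))); last exact: qd_cst.
by rewrite N0 mulr_ge0 // N_ge0.
Qed.

Lemma Im_mrest_ge0 (F : {fset Gamma}) z : N z < 1 -> 0 <= Im (mrest F z).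
Proof.
move=> z1; apply: (@le_trans _ _ (N (csum (fun _ : Gamma => 0)))); first exact: N_ge0.
apply: csum_le_Im; last first.
- by move=> g; rewrite N0; case: ifP => // _; exact: (Im_mterm_ge0 hGamma t01 g z1).
- exact: dominated_mrest.
- by apply: (dominated_le (bsum_wgt hsum) (lexx 0)) => g; rewrite mul0r N0.
Qed.

Lemma Im_martin_ge z (F : {fset Gamma}) : N z < 1 ->
  0 <= Im (m z) - Im (mrest F z).
Proof.
move=> z1; rewrite (martin_split F z1) cImD addrK.
apply: (big_ind (fun x : C => 0 <= Im x)) => // [x y|g _].
  by rewrite cImD; exact: addr_ge0.
exact: (Im_mterm_ge0 hGamma t01 g z1).
Qed.

Lemma Im_martin_ge0 z : N z < 1 -> 0 <= Im (m z).
Proof.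
move=> z1; have := Im_martin_ge fset0 z1; have := Im_mrest_ge0 fset0 z1; lra.
Qed.

Lemma pk0 (t : R) : pk 0 t = 1.
Proof. by rewrite /pk N0 expr0n subr0 subr0 N_expi expr1n divr1. Qed.

Lemma Rintegral_mrest (F : {fset Gamma}) r : 0 <= r < 1 ->
  \int[mu]_(t in J) Im (mrest F (r%:C%C * expi t)) = Im (mrest F 0) * (2 * pi).
Proof.
move=> r01; have [ds S] := smooth_mrest F.
have z0 : N (0 : C) < 1 by rewrite N0.
have := poisson_circle S r01 z0; rewrite mulr0 => /(congr1 Im).
rewrite cImZ => <-; apply: eq_Rintegral => t _.
by rewrite cImZ pk0 mulr1.
Qed.

Lemma N_circle (r : R) t : 0 <= r < 1 -> N (r%:C%C * expi t) < 1.
Proof. by move=> /andP[r0 r1]; rewrite NM NR N_expi mulr1 ger0_norm. Qed.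

Lemma continuous_Im_circle f df r : smooth f df -> 0 <= r < 1 ->
  continuous (fun t : R => Im (f (r%:C%C * expi t))).
Proof.
move=> S r01; have c := smooth_continuous_circle S r01.
by move=> t; exact: (cvg_Im (c t)).
Qed.

Lemma Im_mterm_cvg g (zeta : C) : N zeta = 1 -> zeta != tau t0 g ->
  Im (mt g ((@rho R n)%:C%C * zeta)) @[n --> \oo] --> 0.
Proof.
move=> z1 zg.
have E n : Im (mt g ((@rho R n)%:C%C * zeta)) = (1 - @rho R n ^+ 2) / 2 *
    (wgt t0 g / N (tau t0 g - (@rho R n)%:C%C * zeta) ^+ 2).
  have /andP[r0 r1] := @rho01 R n.
  have nz : N ((@rho R n)%:C%C * zeta) = @rho R n by rewrite NM NR z1 mulr1 ger0_norm.
  by rewrite (Im_mterm hGamma t01) nz.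
under eq_fun do rewrite E.
have rc : (@rho R n)%:C%C * zeta @[n --> \oo] --> zeta.
  apply/cvgCP => e e0; have /cvgrPdist_lt/(_ _ e0) := @rho_cvg R.
  apply: filterS => n; rewrite -{1}[zeta]mul1r -mulrBl NM z1 mulr1.
  by rewrite -(rmorph1 (real_complex R)) -rmorphB NR.
have Nc : N (tau t0 g - (@rho R n)%:C%C * zeta) @[n --> \oo] --> N (tau t0 g - zeta).
  exact: (cvg_modulus (cvgB (cvg_cst _) rc)).
have nz : N (tau t0 g - zeta) ^+ 2 != 0.
  by rewrite expf_neq0 // N_eq0 subr_eq0 eq_sym.
have -> : 0 = (1 - 1 * 1) / 2 * (wgt t0 g / N (tau t0 g - zeta) ^+ 2) :> R.
  by rewrite mulr1 subrr !mul0r.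
apply: cvgM; last first.
  by apply: cvgM; [exact: cvg_cst|apply: cvgV => //; exact: (cvgM Nc Nc)].
apply: cvgM; last exact: cvg_cst.
by apply: cvgB; [exact: cvg_cst|exact: (cvgM (@rho_cvg R) (@rho_cvg R))].
Qed.

Lemma sum_cvg0 (I : eqType) (s : seq I) (f : I -> nat -> R) :
  (forall i, i \in s -> f i n @[n --> \oo] --> 0) ->
  \sum_(i <- s) f i n @[n --> \oo] --> 0.
Proof.
elim: s => [|i s IH] H.
  by rewrite (_ : (fun n => _) = fun=> 0) ?funeqE => [|n]; [exact: cvg_cst|rewrite big_nil].
rewrite (_ : (fun n => _) = fun n => f i n + \sum_(j <- s) f j n); last first.
  by apply/funext => n; rewrite big_cons.
have L1 : f i n @[n --> \oo] --> 0 by apply: H; rewrite inE eqxx.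
have Hs j : j \in s -> f j n @[n --> \oo] --> 0.
  by move=> js; apply: H; rewrite inE js orbT.
have h := cvgD L1 (IH Hs); rewrite addr0 in h.
exact: h.
Qed.

(* Finitely many terms of Im m tend to 0 at almost every point of the circle,
   and the remaining ones have arbitrarily small circle means. *)
Lemma martin_boundary : aeJ (fun t => forall e : R, 0 < e -> forall n0,
  exists2 n, (n0 <= n)%N & Im (m ((@rho R n)%:C%C * expi t)) < e).
Proof.
have Sm := smooth_martin hGamma t01 hsum.
(* The cut at 1 provides a dominating constant for the part with finitely many terms, and smallness
   of the minimum with 1 is as good as smallness of [Im m]. *)
pose x_ n t := Num.min (Im (m ((@rho R n)%:C%C * expi t))) 1.
have cm n : continuous (fun t : R => Im (m ((@rho R n)%:C%C * expi t))).
  exact: continuous_Im_circle Sm (@rho01 R n).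
have cx n : continuous (x_ n).
  by move=> t; apply: (continuous_min (cm n t)); exact: cvg_cst.
have x0 n t : 0 <= x_ n t.
  by rewrite le_min ler01 andbT Im_martin_ge0 // N_circle // rho01.
suff lim : \int[mu]_(t in J) x_ n t @[n --> \oo] --> 0.
  apply: aeJS (small_integrals_ae cx x0 lim) => t _ H e e0 n0.
  have [|n nn] := H (Num.min e 1) _ n0; first by rewrite lt_min e0 ltr01.
  rewrite lt_min /x_ => /andP[h1 h2]; exists n => //.
  by move: h1 h2; rewrite !gt_min ltxx orbF => h1 h2; move: h1; case/orP => //; lra.
apply/cvgrPdist_le => e e0.
have pi0 : 0 < pi :> R := pi_gt0 R.
(* By the mean value property the remainder has circle integral [2 * pi] times its imaginary part at
   0, which the tail weight [e'] bounds; this contributes at most [e / 2]. *)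
pose e' := e / (4 * pi); have e'0 : 0 < e' by rewrite divr_gt0 // mulr_gt0.
have [F [tw0 tw]] := bsum_tail (bsum_wgt hsum) e'0.
have [ds Sr] := smooth_mrest F.
pose A n t := Num.min (Im (m ((@rho R n)%:C%C * expi t)) -
  Im (mrest F ((@rho R n)%:C%C * expi t))) 1.
have cA n : continuous (A n).
  have cr : continuous (fun t : R => Im (mrest F ((@rho R n)%:C%C * expi t))).
    exact: (continuous_Im_circle Sr (@rho01 R n)).
  have cd : continuous (fun t : R => Im (m ((@rho R n)%:C%C * expi t)) -
      Im (mrest F ((@rho R n)%:C%C * expi t))).
    by move=> t; exact: (cvgB (cm n t) (cr t)).
  by move=> t; apply: (continuous_min (cd t)); exact: cvg_cst.
have A0 n t : 0 <= A n t.
  by rewrite le_min ler01 andbT Im_martin_ge // N_circle // rho01.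
have A1 n t : A n t <= 1 by rewrite ge_min lexx orbT.
have limA : \int[mu]_(t in J) A n t @[n --> \oo] --> \int[mu]_(t in J) 0.
  apply: (@dominatedJ R _ _ (fun=> 1)) => //.
  - by move=> n; exact: measurableJ_cont (cA n).
  - have : aeJ (fun t => forall g, g \in enum_fset F -> expi t != tau t0 g).
      elim: (enum_fset F) => [|g s IH]; first by apply: aeJS aeJ_interior.
      apply: aeJS (aeJI IH (aeJ_expi_neq (tau t0 g))) => t _ [H1 H2] h.
      by rewrite inE => /predU1P[->|/H1].
    apply: aeJS => t _ H.
    have L : Im (m ((@rho R n)%:C%C * expi t)) -
        Im (mrest F ((@rho R n)%:C%C * expi t)) @[n --> \oo] --> 0.
      have E n : Im (m ((@rho R n)%:C%C * expi t)) -
        Im (mrest F ((@rho R n)%:C%C * expi t)) =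
          \sum_(g <- F) Im (mt g ((@rho R n)%:C%C * expi t)).
        rewrite (martin_split F) ?N_circle ?rho01 // cImD addrK.
        by elim/big_rec2: _ => [//|i x y _ <-]; rewrite cImD.
      under eq_fun do rewrite E.
      apply: sum_cvg0 => g gF; apply: Im_mterm_cvg; first exact: N_expi.
      exact: H.
    apply: (squeeze_cvgr _ (cvg_cst 0) L).
    by apply: nearW => n; rewrite A0 /= ge_min lexx.
  - by apply: integrableJ => t; exact: cvg_cst.
  - by move=> n t; rewrite ger0_norm.
rewrite Rintegral_cstJ mul0r in limA.
have e2 : 0 < e / 2 by rewrite divr_gt0.
have /cvgrPdist_le/(_ _ e2) := limA; apply: filterS => n.
rewrite !sub0r !normrN => h.
have iA : mu.-integrable J (EFin \o A n) by exact: integrableJ (cA n).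
have cr := continuous_Im_circle Sr (@rho01 R n).
have ir := integrableJ cr.
rewrite ger0_norm; last exact: Rintegral_ge0.
apply: (@le_trans _ _ (\int[mu]_(t in J) (A n t + Im (mrest F ((@rho R n)%:C%C * expi t))))).
  apply: le_Rintegral => //; first exact: integrableJ (cx n).
    by have := integrableD measurableJ iA ir; apply: eq_integrable.
  move=> t _; rewrite /x_ /A; have := Im_mrest_ge0 F (N_circle t (@rho01 R n)).
  set a := Im _; set b := Im _ => b0; rewrite -lerBlDr le_min lerD2r ge_min lexx /=.
  by rewrite lerBlDr ge_min lerDl b0 orbT.
rewrite RintegralD // Rintegral_mrest ?rho01 //.
have h2 : Im (mrest F 0) <= e'.
  apply: le_trans (ler_norm _) _; apply: le_trans (ImN _) _; rewrite -[e']mul1r.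
  apply: (csum_le (conj tw0 tw)) => // g; rewrite mul1r; case: ifP => _; first by rewrite N0.
  have z0 : N (0 : C) < 1 by rewrite N0.
  rewrite /mterm addr0 subr0 divff ?mul1r -?N_gt0 ?(N_tau hGamma t01) //.
  rewrite NM N_half_i NR ger0_norm ?N_ge0 // ler_piMl ?N_ge0 //.
  by rewrite invf_le1 // ler1n.
have h3 : Im (mrest F 0) * (2 * pi) <= e / 2.
  apply: (@le_trans _ _ (e' * (2 * pi))).
    by rewrite ler_wpM2r // mulr_ge0 // ltW.
  have hp (p : R) : p != 0 -> e / (4 * p) * (2 * p) = e / 2 by move=> p0; field.
  by rewrite /e' hp ?gt_eqF.
by move: h; rewrite ger0_norm ?Rintegral_ge0 //; lra.
Qed.

End MartinBoundary.

(** * Operations on smooth functions, constancy criteria and radial derivatives *)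

Section SmoothCalculus.
Context {R : realType}.
Local Notation C := R[i].
Local Notation N := (@modulus R).
Local Notation Re := (@complex.Re R).
Local Notation Im := (@complex.Im R).
Implicit Types (f df g dg : C -> C).

Lemma smooth_cst (c : C) : smooth (cst c) (cst 0).
Proof. by move=> r _; exists (N c); exact: qd_cst. Qed.

Lemma smooth_id : smooth (id : C -> C) (cst 1).
Proof. by move=> r /andP[_ r1]; exists 1; apply: qd_id; exact: ltW. Qed.

Lemma smooth_add f df g dg : smooth f df -> smooth g dg ->
  smooth (f \+ g) (df \+ dg).
Proof.
move=> F G r r01; have [K FK] := F r r01; have [L GL] := G r r01.
by exists (K + L); exact: qd_add.
Qed.

Lemma smooth_mul f df g dg : smooth f df -> smooth g dg ->
  smooth (fun z => f z * g z) (fun z => df z * g z + f z * dg z).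
Proof.
move=> F G r /[dup] r01 /andP[_ r1]; have [K FK] := F r r01; have [L GL] := G r r01.
by exists (11 * K * L); apply: qd_mul => //; exact: ltW.
Qed.

Lemma smooth_scal f df (c : C) : smooth f df ->
  smooth (fun z => c * f z) (fun z => c * df z).
Proof. by move=> F r /F[K FK]; exists (N c * K); exact: qd_scal. Qed.

Lemma smooth_comp f df g dg : smooth f df -> smooth g dg ->
  (forall r, 0 <= r < 1 ->
     exists2 s, 0 <= s < 1 & forall z, N z <= r -> N (g z) <= s) ->
  smooth (f \o g) (fun z => df (g z) * dg z).
Proof.
move=> F G gd r /[dup] r01 /andP[_ r1]; have [K GK] := G r r01.
have [s s01 H] := gd r r01; have [L FL] := F s s01.
by exists (L * (1 + K + 9 * K ^+ 2)); apply: (qd_comp (ltW r1) GK FL).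
Qed.

Lemma smooth_dilate f df (r : R) : smooth f df -> 0 <= r <= 1 ->
  smooth (fun z => f (r%:C%C * z)) (fun z => df (r%:C%C * z) * (r%:C%C * 1)).
Proof.
move=> F /andP[r0 r1].
apply: (smooth_comp F (smooth_scal r%:C%C smooth_id)) => s /[dup] s01 /andP[s0 s1].
exists s => // z zs; rewrite NM NR ger0_norm //; apply: le_trans zs.
by rewrite ler_piMl ?N_ge0.
Qed.

Lemma smooth_ext f df g dg : (forall z, N z < 1 -> f z = g z) ->
  (forall z, N z < 1 -> df z = dg z) -> smooth f df -> smooth g dg.
Proof.
move=> fg dfg F r /[dup] r01 /andP[_ r1]; have [K FK] := F r r01.
exists K; apply: qd_ext FK => z zr; [apply: fg|apply: dfg];
  exact: le_lt_trans zr r1.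
Qed.

Lemma smooth_bounded f df (r : R) : smooth f df -> 0 <= r < 1 ->
  exists K, forall z, N z <= r -> N (f z) <= K.
Proof.
by move=> F /F[K FK]; exists K => z zr; have [] := FK z z zr zr.
Qed.

Lemma smooth_deriv0_cst f df : smooth f df -> (forall z, N z < 1 -> df z = 0) ->
  forall z, N z < 1 -> f z = f 0.
Proof.
move=> F d0 z z1; have z01 : 0 <= N z < 1 by rewrite N_ge0.
have [K FK] := F _ z01.
have K0 := qd_ge0 (N_ge0 z) FK.
have : f (0%:C%C * z) = f (1%:C%C * z); last by rewrite mul0r mul1r => ->.
apply: (@quad_cst R (fun s => f (s%:C%C * z)) K) => s u /andP[s0 s1] /andP[u0 u1].
have h v : 0 <= v -> v <= 1 -> N (v%:C%C * z) <= N z.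
  by move=> v0 v1; rewrite NM NR ger0_norm // ler_piMl ?N_ge0.
have hs := h s (ltW s0) s1; have hu := h u u0 u1.
have [_ _] := FK _ _ hs hu; rewrite d0 ?mul0r ?subr0; last exact: le_lt_trans hs z1.
move=> /le_trans; apply; rewrite ler_wpM2l //.
rewrite -mulrBl -rmorphB NM NR exprMn real_normK ?num_real //.
by rewrite ler_piMr ?sqr_ge0 // exprn_ile1 ?N_ge0 // ltW.
Qed.

(* Moving in the direction conj(conj(q) q') increases |q| unless q' = 0. *)
Lemma smooth_unimodular_cst q dq : smooth q dq -> (forall z, N z < 1 -> N (q z) = 1) ->
  forall z, N z < 1 -> q z = q 0.
Proof.
move=> Q q1; apply: (smooth_deriv0_cst Q) => z z1.
pose r := (1 + N z) / 2.
have r01 : 0 <= r < 1 by rewrite /r; have := N_ge0 z; lra.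
have zr : N z <= r by rewrite /r; lra.
have [K QK] := Q _ r01; have K0 := qd_ge0 (proj1 (andP r01)) QK.
apply/eqP; rewrite -N_eq0; set D := N (dq z).
have [//|D0'] := eqVneq D 0; have D0 : 0 < D by rewrite lt_def D0' N_ge0.
exfalso; pose e := q z * (dq z)^*%C.
have e1 : N e = D by rewrite NM NJ q1 // mul1r.
have dr : 0 < (1 - N z) / 2 by rewrite divr_gt0 // subr_gt0.
(* The first bound keeps [y] in the disk of radius [r]; the second makes the quadratic remainder at
   most half of the linear gain [s' * D ^+ 2]. *)
pose s' := Num.min ((1 - N z) / 2 / D) ((2 * (K + 1))^-1).
have K1 : 0 < 2 * (K + 1) by rewrite mulr_gt0 // ltr_wpDl.
have s0 : 0 < s' by rewrite lt_min divr_gt0 //= invr_gt0.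
have s1 : s' * D <= (1 - N z) / 2.
  by rewrite -ler_pdivlMr // ge_min lexx.
have s2 : s' * (2 * (K + 1)) <= 1.
  by rewrite -ler_pdivlMr // mul1r ge_min lexx orbT.
pose y := z + s'%:C%C * e.
have ye : y - z = s'%:C%C * e by rewrite /y addrAC subrr add0r.
have yzN : N (y - z) = s' * D by rewrite ye NM NR gtr0_norm // e1.
have yr : N y <= r.
  rewrite -[y](subrK z); apply: le_trans (ND _ _) _; rewrite yzN /r; lra.
have [_ _] := QK z y zr yr; rewrite yzN.
have y1 : N (q y) = 1 by apply: q1; apply: le_lt_trans yr _; case/andP: r01.
have lin : N (q z + dq z * (y - z)) = 1 + s' * D ^+ 2.
  have -> : q z + dq z * (y - z) = q z * (1 + s' * D ^+ 2)%:C%C.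
    rewrite ye /e rmorphD rmorph1 rmorphM /= -NconjM mulrDr mulr1; congr (_ + _).
    ring.
  rewrite NM q1 // NR mul1r ger0_norm // addr_ge0 // mulr_ge0 ?sqr_ge0 //.
  exact: ltW.
have tri := ND (q y) (- (q y - q z - dq z * (y - z))).
rewrite NN in tri; have E : q y - (q y - q z - dq z * (y - z)) =
  q z + dq z * (y - z) by ring.
rewrite E lin y1 in tri => h.
have : s' * D ^+ 2 <= K * (s' * D) ^+ 2 by lra.
have -> : K * (s' * D) ^+ 2 = (s' * K) * (s' * D ^+ 2) by ring.
have p0 : 0 < s' * D ^+ 2 by rewrite mulr_gt0 // exprn_gt0.
rewrite -{1}[s' * D ^+ 2]mul1r ler_pM2r //; lra.
Qed.

Lemma radial_derive f df (zeta : C) (s : R) : smooth f df -> N zeta = 1 -> 0 <= s < 1 ->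
  is_derive s 1 (fun u : R => Im (f (u%:C%C * zeta))) (Im (df (s%:C%C * zeta) * zeta)).
Proof.
move=> F z1 /andP[s0 s1]; pose r := (1 + s) / 2.
have r01 : 0 <= r < 1 by rewrite /r; lra.
have [K FK] := F r r01; have K0 := qd_ge0 (proj1 (andP r01)) FK.
apply: (@is_derive_quad R _ s _ ((1 - s) / 2) K) => //.
  by rewrite divr_gt0 // subr_gt0.
move=> u us.
have nz v : N (v%:C%C * zeta) = `|v| by rewrite NM NR z1 mulr1.
have sr : N (s%:C%C * zeta) <= r by rewrite nz ger0_norm // /r; lra.
have ur : N (u%:C%C * zeta) <= r.
  by rewrite nz /r; move: us; rewrite ltr_norml ler_norml; lra.
have [_ _ H] := FK _ _ sr ur.
rewrite -cImZ -!cImB; apply: le_trans (ImN _) _.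
have -> : df (s%:C%C * zeta) * zeta * (u - s)%:C%C =
  df (s%:C%C * zeta) * (u%:C%C * zeta - s%:C%C * zeta) by rewrite rmorphB /=; ring.
apply: le_trans H _; by rewrite -mulrBl -rmorphB nz.
Qed.

Lemma radial_mvt f df (zeta : C) (a b M : R) : smooth f df -> N zeta = 1 ->
  0 <= a -> a <= b -> b < 1 ->
  (forall s, a <= s <= b -> N (df (s%:C%C * zeta)) <= M) ->
  Im (f (a%:C%C * zeta)) - Im (f (b%:C%C * zeta)) <= M * (b - a).
Proof.
move=> F z1 a0 ab b1 H.
have D s : s \in `]a, b[ -> is_derive s 1 (fun u : R => Im (f (u%:C%C * zeta)))
    (Im (df (s%:C%C * zeta) * zeta)).
  rewrite in_itv /= => /andP[as_ sb]; apply: radial_derive => //.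
  by rewrite (le_trans a0 (ltW as_)) (lt_trans sb b1).
have [|c /[!in_itv]/= /andP[ac cb] E] := MVT_segment ab D.
  apply: derivable_within_continuous => s; rewrite in_itv /= => /andP[as_ sb].
  have s01 : 0 <= s < 1 by rewrite (le_trans a0 as_) (le_lt_trans sb b1).
  by case: (radial_derive F z1 s01).
rewrite -opprB E -mulNr ler_wpM2r ?subr_ge0 //.
apply: le_trans (ler_norm _) _; rewrite normrN; apply: le_trans (ImN _) _.
by rewrite NM z1 mulr1 H // ac.
Qed.

End SmoothCalculus.

(** * The bound 1 for the outer factor times a twisted series *)

Section OuterFactor.
Context {R : realType} (Gamma : set (R[i] -> R[i])) (t0 : R[i]).
Context (hGamma : fuchsian Gamma) (t01 : modulus t0 = 1).
Context (hsum : (\esum_(gamma in Gamma) (modulus (derive1 gamma t0))%:E < +oo)%E).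
Local Notation C := R[i].
Local Notation N := (@modulus R).
Local Notation Re := (@complex.Re R).
Local Notation Im := (@complex.Im R).
Local Notation mu := (@lebesgue_measure R).
Local Notation J := (`[0, 2 * pi]%classic : set R).
Local Notation m := (martin Gamma t0).
Local Notation S1 := (pser Gamma t0 (fun=> 1)).

Lemma at_left1P (P : R -> Prop) : (\forall r \near (1 : R)^'-, P r) ->
  exists2 e, 0 < e & forall r, 1 - e < r < 1 -> P r.
Proof.
move=> /nbhs_ballP[e /= e0 H]; exists e => // r /andP[r1 r2]; apply: H => //.
rewrite /ball /= ltr_distlC r1 /=; apply: lt_le_trans r2 _.
by rewrite lerDl ltW.
Qed.

Lemma near_left_range (e : R) : 0 < e -> \forall r \near (1 : R)^'-, 1 - e < r < 1.
Proof. by move=> e0; apply: (near_at_left1 e0). Qed.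

Lemma herg_radial (v : R -> R) : mu.-integrable J (EFin \o v) ->
  aeJ (fun t => N (herg v (r%:C%C * expi t)) @[r --> (1 : R)^'-] --> expR (v t)).
Proof.
move=> iv; apply: aeJS (fatou_radial iv) => t _ H.
have pi0 : 2 * pi != 0 :> R by rewrite gt_eqF // mulr_gt0 // pi_gt0.
have L : (2 * pi)^-1 * \int[mu]_(y in J) (pk (r%:C%C * expi t) y * v y)
    @[r --> (1 : R)^'-] --> v t.
  have := cvgM (cvg_cst (2 * pi)^-1) H; rewrite mulKf //; exact.
have L2 : expR ((2 * pi)^-1 * \int[mu]_(y in J) (pk (r%:C%C * expi t) y * v y))
    @[r --> (1 : R)^'-] --> expR (v t).
  by apply: continuous_cvg L; exact: continuous_expR.
apply: cvg_trans L2; apply: near_eq_cvg.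
apply: filterS (near_left_range ltr01) => r; rewrite subrr => /andP[r0 r1].
have z1 : N (r%:C%C * expi t) < 1 by rewrite NM NR N_expi mulr1 gtr0_norm.
exact/esym/N_herg.
Qed.

(* The limit k of |phi| bounds |m'| by about 1 / k near the end of the radius;
   integrating from a point where Im m is small gives Im m <= (1 - s) / k there,
   and the monotonicity of martin_radial carries the bound back to r. *)
Lemma radial_bound (phi : C -> C) (t k : R) b r : 0 < k ->
  N (phi (r%:C%C * expi t)) @[r --> (1 : R)^'-] --> k ->
  (forall z, N z < 1 -> phi z != 0) ->
  (forall z, N z < 1 -> N (phi z) * N (S1 z) <= 1) ->
  (forall e : R, 0 < e -> forall n0,
    exists2 n, (n0 <= n)%N & Im (m ((@rho R n)%:C%C * expi t)) < e) ->
  charlike Gamma b -> 0 < r < 1 ->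
  k * (r * N (pser Gamma t0 b (r%:C%C * expi t))) <= 1.
Proof.
move=> k0 phik phi0 phiS freq b1 /andP[r0 r1].
have Sm := smooth_martin hGamma t01 hsum.
have z1 : N (expi t) = 1 := N_expi t.
have k0' : k != 0 by rewrite gt_eqF.
rewrite mulrC -ler_pdivlMr // div1r; apply/ler_addgt0Pr => e e0.
set M := _ + e.
have M0 : 0 < M by rewrite addr_gt0 // invr_gt0.
have /at_left1P[d d0 Hd] : \forall s \near (1 : R)^'-,
    (N (phi (s%:C%C * expi t)))^-1 < M.
  by apply: (cvgr_lt _ (cvgV k0' phik)); rewrite ltrDl.
(* The point must lie beyond [r], for the monotonicity, and beyond [1 - d], where the inverse of
   |phi| is already below [M]. *)
pose s := Num.max r (1 - d / 2).
have rs : r <= s by rewrite le_max lexx.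
have s0 := lt_le_trans r0 rs.
have s1 : s < 1 by rewrite gt_max r1 gtrBl divr_gt0.
have sd : 1 - d < s.
  by apply: lt_le_trans (_ : 1 - d / 2 <= _); [lra|rewrite le_max lexx orbT].
have dmM u : s <= u < 1 -> N ('i%C * t0 * S1 (u%:C%C * expi t)) <= M.
  move=> /andP[su u1]; have u0 := lt_le_trans s0 su.
  have nu : N (u%:C%C * expi t) < 1 by rewrite NM NR z1 mulr1 gtr0_norm.
  rewrite !NM Ni t01 !mul1r; apply: le_trans (ltW (Hd u _)); last first.
    by rewrite u1 (lt_le_trans sd su).
  rewrite -[leRHS]mul1r ler_pdivlMr ?N_gt0 ?phi0 // mulrC; exact: phiS.
have h1 : Im (m (s%:C%C * expi t)) <= M * (1 - s).
  (* The mean value theorem runs from [s] to a later radius [rho n] where [Im m] is below [e']; such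
     radii occur arbitrarily close to 1. *)
  apply/ler_addgt0Pr => e' e'0.
  have /(cvgr_gt _ (@rho_cvg R))[n0 _ Hn] : s < 1 by [].
  have [n nn mn] := freq e' e'0 n0.
  have sn : s < @rho R n by exact: Hn.
  have /andP[_ n1] := @rho01 R n.
  have := radial_mvt Sm z1 (ltW s0) (ltW sn) n1 (M := M) _.
  move=> /(_ _) h; have {h} := h _.
  have HH u : s <= u <= @rho R n -> N ('i%C * t0 * S1 (u%:C%C * expi t)) <= M.
    by move=> /andP[su un]; apply: dmM; rewrite su (le_lt_trans un n1).
  move=> /(_ HH); have : M * (@rho R n - s) <= M * (1 - s).
    by rewrite ler_wpM2l ?(ltW M0) // lerD2r ltW.
  lra.
have h2 := martin_radial hGamma t01 hsum z1 r0 rs s1.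
have nr : N (r%:C%C * expi t) = r by rewrite NM NR z1 mulr1 gtr0_norm.
have lr : N (r%:C%C * expi t) < 1 by rewrite nr.
have h3 := pser_le_martin hGamma t01 hsum b1 lr; rewrite nr in h3.
apply: le_trans (ler_wpM2l (ltW r0) h3) _; rewrite mulrA [r * _]mulrA [r * 2]mulrC.
apply: le_trans h2 _.
have q0 : 0 < 1 - s ^+ 2 by rewrite subr_gt0 exprn_ilt1 // ltW.
apply: (@le_trans _ _ (2 * s / (1 - s ^+ 2) * (M * (1 - s)))).
  by rewrite ler_wpM2l // divr_ge0 ?(ltW q0) // mulr_ge0 // ltW.
rewrite mulrAC ler_pdivrMr //.
have -> : 2 * s * (M * (1 - s)) = M * (2 * s * (1 - s)) by ring.
(* [2 * s * (1 - s) <= 1 - s ^+ 2] is the inequality (1 - s)^2 >= 0, so the bound [M] survives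
   without a loss of constant. *)
rewrite ler_wpM2l ?(ltW M0) //; have := sqr_ge0 (1 - s); lra.
Qed.

Context (phi : C -> C) (c : C) (v : R -> R).
Context (c1 : N c = 1) (iv : mu.-integrable J (EFin \o v)).
Context (phiE : forall z, N z < 1 -> phi z = c * herg v z).
Context (phi4 : forall z, N z < 1 -> N (phi z) <= 4).

Lemma phi_neq0 z : N z < 1 -> phi z != 0.
Proof.
by move=> z1; rewrite phiE // mulf_neq0 ?herg_neq0 // -N_gt0 c1.
Qed.

Lemma smooth_phi : exists d, smooth phi d.
Proof.
eexists; apply: smooth_ext (smooth_scal c (smooth_herg iv)) => [z z1|//].
by rewrite phiE.
Qed.

Lemma phi_radial : aeJ (fun t =>
  N (phi (r%:C%C * expi t)) @[r --> (1 : R)^'-] --> expR (v t)).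
Proof.
apply: aeJS (herg_radial iv) => t _ H; apply: cvg_trans H; apply: near_eq_cvg.
apply: filterS (near_left_range ltr01) => r /andP[r0 r1]; rewrite subrr in r0.
have z1 : N (r%:C%C * expi t) < 1 by rewrite NM NR N_expi mulr1 gtr0_norm.
by rewrite phiE // NM c1 mul1r.
Qed.

Context (phiS : forall z, N z < 1 -> N (phi z) * N (S1 z) <= 1).

(** Only the series is dilated: [phi z] times the series at [r * z] is bounded by [4 * K], as the
    maximum principle requires, and [radial_bound] gives its boundary bound [r^-1], which tends to
    1. *)
Lemma phi_pser_le1 b z : charlike Gamma b -> N z < 1 ->
  N (phi z) * N (pser Gamma t0 b z) <= 1.
Proof.
move=> b1 z1; have [ds Ss] := smooth_pser hGamma t01 hsum b1.
have [dp Sp] := smooth_phi.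
have H r : 0 < r < 1 -> N (phi z) * N (pser Gamma t0 b (r%:C%C * z)) <= r^-1.
  move=> /[dup] r01 /andP[r0 r1].
  have r01' : 0 <= r <= 1 by rewrite !ltW.
  have r01'' : 0 <= r < 1 by rewrite ltW.
  have [K HK] := smooth_bounded Ss r01''.
  have := smooth_mul Sp (smooth_dilate Ss r01') => Sf.
  rewrite -NM; apply: (max_principle (B := 4 * K) Sf) => //; last by rewrite invr_ge0 ltW.
    move=> w w1; rewrite NM ler_pM ?N_ge0 ?phi4 // HK // NM NR gtr0_norm //.
    by rewrite ler_piMr ?(ltW r0) // ltW.
  apply: aeJS (aeJI phi_radial (martin_boundary hGamma t01 hsum)) => t _ [k1 k2] e e0.
  have k0 := expR_gt0 (v t).
  have B := radial_bound k0 k1 phi_neq0 phiS k2 b1 r01.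
  have cs : N (pser Gamma t0 b (r%:C%C * (s%:C%C * expi t))) @[s --> (1 : R)^'-] -->
      N (pser Gamma t0 b (r%:C%C * expi t)).
    have rt1 : N (r%:C%C * expi t) < 1 by rewrite NM NR N_expi mulr1 gtr0_norm.
    apply: cvg_modulus; apply: cvg_comp (smooth_cvg Ss rt1).
    apply/cvgCP => e' e'0; apply: filterS (near_left_range e'0) => s /andP[s1 s2].
    rewrite -mulrBr -{1}[expi t]mul1r -mulrBl !NM N_expi mulr1.
    rewrite -(rmorph1 (real_complex R)) -rmorphB !NR gtr0_norm //.
    apply: le_lt_trans (_ : `|1 - s| < e'); first by rewrite ler_piMl // ltW.
    by rewrite gtr0_norm; lra.
  have L := cvgM k1 cs.
  have lim : expR (v t) * N (pser Gamma t0 b (r%:C%C * expi t)) < r^-1 + e.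
    apply: le_lt_trans (_ : r^-1 < _); last by rewrite ltrDl.
    by rewrite -[leRHS]mul1r ler_pdivlMr // mulrAC -mulrA.
  have near_lt := cvgr_lt _ (L _) _ lim.
  apply: filterS (near_lt _ _) => s h.
  by rewrite NM; exact: ltW h.
have L1 : N (phi z) * N (pser Gamma t0 b ((@rho R n)%:C%C * z)) @[n --> \oo] -->
    N (phi z) * N (pser Gamma t0 b z).
  by apply: cvgM; [exact: cvg_cst|exact: (cvg_modulus (smooth_cvg_dilate Ss z1))].
have L2 : (@rho R n)^-1 @[n --> \oo] --> (1 : R).
  by have := cvgV (oner_neq0 R) (@rho_cvg R); rewrite invr1; exact.
apply: (ler_cvg_to L1 L2); apply: filterS (cvgr_gt _ (@rho_cvg R) _ ltr01) => n n0.
by apply: H; rewrite n0; have /andP[] := @rho01 R n.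
Qed.

End OuterFactor.

(** * The character of the outer factor *)

Section Character.
Context {R : realType}.
Local Notation C := R[i].
Local Notation N := (@modulus R).
Local Notation mu := (@lebesgue_measure R).
Local Notation J := (`[0, 2 * pi]%classic : set R).

(** The logarithm of min(1 / exp v, e^n). Cutting from above makes the outer function bounded, while
    [trunc_le] keeps the data integrable and dominated by |v|. *)
Definition trunc (v : R -> R) (n : nat) (t : R) : R := Num.min (- v t) n%:R.

Lemma trunc_le v n t : `|trunc v n t| <= `|v t|.
Proof.
rewrite /trunc minEle; case: ifPn => [_|]; first by rewrite normrN.
rewrite -ltNge => h; have n0 : 0 <= n%:R :> R := ler0n R n.
by rewrite (ger0_norm n0) -normrN (ltW (lt_le_trans h (ler_norm _))).
Qed.

Lemma measurable_trunc v n : measurable_fun J v -> measurable_fun J (trunc v n).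
Proof. by move=> mv; apply: measurable_minr => //; exact: measurableT_comp. Qed.

Lemma integrable_trunc v n : mu.-integrable J (EFin \o v) ->
  mu.-integrable J (EFin \o trunc v n).
Proof.
move=> iv; have mv : measurable_fun J v.
  by apply/measurable_EFinP; apply: measurable_int iv.
apply: (le_integrable measurableJ _ _ iv).
  by apply/measurable_EFinP; exact: measurable_trunc.
by move=> t _; rewrite /= lee_fin trunc_le.
Qed.

Lemma herg_trunc_le v n z : mu.-integrable J (EFin \o v) -> N z < 1 ->
  N (herg (trunc v n) z) <= expR n%:R.
Proof.
move=> iv z1; have it := integrable_trunc n iv.
have pi0 : 0 < 2 * pi :> R by rewrite mulr_gt0 // pi_gt0.
rewrite N_herg // ler_expR ler_pdivrMl // [leRHS]mulrC.
apply: (@le_trans _ _ (\int[mu]_(t in J) (n%:R * pk z t))).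
  apply: (le_Rintegral measurableJ) => [||t _].
  - exact: integrable_pk.
  - exact: integrableJZ (integrableJ (continuous_pk z1)).
  - by rewrite mulrC ler_wpM2r ?pk_ge0 // ge_min lexx orbT.
rewrite RintegralZl ?Rintegral_pk //; exact: (integrableJ (continuous_pk z1)).
Qed.

Lemma herg_trunc_cvg v z : mu.-integrable J (EFin \o v) -> N z < 1 ->
  N (herg (trunc v n) z) @[n --> \oo] --> (N (herg v z))^-1.
Proof.
move=> iv z1; rewrite N_herg // -expRN -mulrN.
have mv : measurable_fun J v.
  by apply/measurable_EFinP; apply: measurable_int iv.
have mpk := measurableJ_cont (continuous_pk z1).
have -> : - (\int[mu]_(t in J) (pk z t * v t)) = \int[mu]_(t in J) (pk z t * - v t).
  rewrite -mulN1r -RintegralZl //; last exact: integrable_pk.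
  by apply: eq_Rintegral => t _; ring.
have D : \int[mu]_(t in J) (pk z t * trunc v n t) @[n --> \oo] -->
    \int[mu]_(t in J) (pk z t * - v t).
  apply: (dominatedJ (g := fun t => pk z t * `|v t|)).
  - by move=> n; apply: measurable_funM => //; exact: measurable_trunc.
  - by apply: measurable_funM => //; exact: measurableT_comp.
  - apply: (@filterE _ _ (@ae_filter_lebesgue R)) => t _; apply: cvgM; first exact: cvg_cst.
    apply: cvg_near_cst.
    near=> n; apply/min_idPl; near: n; exact: nbhs_infty_ger.
  - by apply: integrable_pk => //; have := integrable_norm iv.
  - by move=> n t; rewrite normrM (ger0_norm (pk_ge0 t z1)) ler_wpM2l ?pk_ge0 // trunc_le.
have D2 : expR ((2 * pi)^-1 * \int[mu]_(t in J) (pk z t * trunc v n t)) @[n --> \oo] -->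
   expR ((2 * pi)^-1 * \int[mu]_(t in J) (pk z t * - v t)).
  apply: continuous_cvg; first exact: continuous_expR.
  by apply: cvgM D; exact: cvg_cst.
apply: cvg_trans D2; apply: near_eq_cvg; apply: nearW => n.
by rewrite N_herg //; exact: integrable_trunc.
Unshelve. all: by end_near.
Qed.

Lemma hergN v z : mu.-integrable J (EFin \o v) -> N z < 1 ->
  herg v z * herg (fun t => - v t) z = 1.
Proof.
move=> iv z1; rewrite /herg -cexpD -mulrDr /herglotz.
have [M hM] : exists M, forall t, N (kern z t) <= M.
  have z01 : 0 <= N z < 1 by rewrite N_ge0.
  by exists (1 + 2 * (1 - N z) ^- 3) => t; have [] := qd_cayley z01 (N_expi t) (lexx (N z)) (lexx (N z)).
have ci := cintegrable_mulR (continuous_kern z1) hM iv.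
rewrite (_ : (fun t => kern z t * (- v t)%:C%C) = fun t => -1 * (kern z t * (v t)%:C%C)).
  by rewrite cintZ // mulN1r subrr mulr0 /cexp /expi /= expR0 cos0 sin0 rmorph1 mul1r.
by apply/funext => t; rewrite rmorphN; ring.
Qed.

End Character.

(** * The transformation law of the outer factor *)

Section Cocycle.
Context {R : realType} (Gamma : set (R[i] -> R[i])) (t0 : R[i]).
Context (hGamma : fuchsian Gamma) (t01 : modulus t0 = 1).
Context (hsum : (\esum_(gamma in Gamma) (modulus (derive1 gamma t0))%:E < +oo)%E).
Local Notation C := R[i].
Local Notation N := (@modulus R).
Local Notation mu := (@lebesgue_measure R).
Local Notation J := (`[0, 2 * pi]%classic : set R).
Local Notation S1 := (pser Gamma t0 (fun=> 1)).
Context (phi : C -> C) (c : C) (v : R -> R) (Delta : C -> C).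
Context (c1 : N c = 1) (iv : mu.-integrable J (EFin \o v)).
Context (phiE : forall z, N z < 1 -> phi z = c * herg v z).
Context (phi4 : forall z, N z < 1 -> N (phi z) <= 4).
Context (DeltaE : forall z, N z < 1 -> 'i%C * t0 * phi z * S1 z = Delta z).
Context (Delta1 : forall z, N z < 1 -> N (Delta z) <= 1).
Context (Delta_radial : aeJ (fun t =>
  N (Delta (r%:C%C * expi t)) @[r --> (1 : R)^'-] --> (1 : R))).

(** The inverse of the derivative is the polynomial [den p z ^+ 2]. *)
Lemma gam_inv_derive g : Gamma g -> exists B dw, smooth (fun z => (derive1 g z)^-1) dw /\
  forall z, N z < 1 -> N (derive1 g z)^-1 <= B.
Proof.
move=> /(gam_coefs hGamma)[p hp ->].
have Sden := smooth_add (smooth_scal (p.2^*)%C (@smooth_id R)) (smooth_cst (p.1^*)%C).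
exists ((N p.2 + N p.1) ^+ 2); eexists; split.
  apply: smooth_ext (smooth_mul Sden Sden) => [z z1|//].
  by rewrite derive1_moebius ?(ltW z1) // invrK expr2.
move=> z z1; rewrite derive1_moebius ?(ltW z1) // invrK NX.
rewrite ler_pXn2r ?nnegrE ?addr_ge0 ?N_ge0 //.
by apply: le_trans (ND _ _) _; rewrite NM !NJ lerD2r ler_piMr ?N_ge0 ?ltW.
Qed.

(** The law is cross-multiplied because [Delta] may vanish in the disk. *)
Lemma phi_Delta g z : Gamma g -> N z < 1 ->
  phi (g z) * Delta z = phi z * derive1 g z * Delta (g z).
Proof.
move=> Gg z1; have gz1 := gam_disk1 hGamma Gg z1.
have E : S1 (g z) * derive1 g z = S1 z.
  have b1 : charlike Gamma (fun=> 1 : C) by move=> ? _; exact: N1.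
  have := pser_automorphic hGamma t01 hsum b1 (fun _ _ _ _ _ _ _ => esym (mul1r 1)) Gg z1.
  by move=> ->; exact: mul1r.
rewrite -!DeltaE // -E; ring.
Qed.

(* The quotient phi (g z) / (g' z phi z) has radial limits of modulus at most 1,
   but it need not be bounded; replacing 1 / phi by the outer function with
   boundary modulus min (1 / |phi|, e^n) makes the maximum principle apply. *)
Lemma phi_gam_le g z : Gamma g -> N z < 1 ->
  N (phi (g z)) <= N (phi z) * N (derive1 g z).
Proof.
move=> Gg z1; have [B [dw [Sw wB]]] := gam_inv_derive Gg.
have [dp Sp] := smooth_phi iv phiE.
have Spg := smooth_comp Sp (gam_smooth hGamma Gg) (fun r r01 => gam_disk hGamma Gg r01).
have H n : N (phi (g z) * (derive1 g z)^-1) * N (herg (trunc v n) z) <= 1.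
  have it := integrable_trunc n iv.
  have Sf := smooth_mul (smooth_mul Spg Sw) (smooth_herg it).
  rewrite -NM; apply: (max_principle (B := 4 * B * expR n%:R) Sf) => //.
    move=> w w1; rewrite NM ler_pM ?N_ge0 ?herg_trunc_le // NM ler_pM ?N_ge0 ?wB //.
    by apply: phi4; exact: (gam_disk1 hGamma Gg w1).
  have ae3 := aeJI (aeJI (phi_radial c1 iv phiE) (herg_radial it)) Delta_radial.
  apply: aeJS ae3 => t _ [[k1 k2] k3] e e0.
  (* Dividing by |Delta| is harmless near the end of the radius, where it tends to 1; the limit of
     the product is at most 1 because [v + min (- v) n <= 0]. *)
  have L := cvgM (cvgM k1 k2) (cvgV (oner_neq0 R) k3).
  have lim : expR (v t) * expR (trunc v n t) * 1^-1 < 1 + e.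
    rewrite invr1 mulr1 -expRD; apply: le_lt_trans (_ : 1 < _); last by rewrite ltrDl.
    by rewrite expR_le1 /trunc -lerBrDl sub0r ge_min lexx.
  have FF : Filter ((1 : R)^'-) by exact: _.
  have hP := filterI (filterI (cvgr_lt _ (L FF FF FF) _ lim) (cvgr_gt _ k3 _ ltr01))
    (near_left_range (@ltr01 R)).
  apply: filterS (hP _ _ _ _) => r [[h1 h2] /andP[r0 r1]]; rewrite subrr in r0.
  set x := r%:C%C * expi t; have x1 : N x < 1 by rewrite NM NR N_expi mulr1 gtr0_norm.
  have {h1} : N (phi x) * N (herg (trunc v n) x) / N (Delta x) < 1 + e := h1.
  move=> /ltW /(le_trans _); apply; rewrite ler_pdivlMr // -NM -NM.
  have gx := gam_derive_neq0 hGamma Gg (ltW x1).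
  have -> : (phi (g x) * (derive1 g x)^-1) * herg (trunc v n) x * Delta x =
      phi x * herg (trunc v n) x * Delta (g x).
    transitivity (phi (g x) * Delta x * (derive1 g x)^-1 * herg (trunc v n) x).
      by move: (derive1 g x)^-1 (herg _ x) => u w; ring.
    by rewrite phi_Delta //; move: (herg _ x) => w; field.
  by rewrite [leLHS]NM ler_piMr ?N_ge0 // Delta1 // (gam_disk1 hGamma Gg x1).
have L1 := cvgM (cvg_cst (N (phi (g z) * (derive1 g z)^-1))) (herg_trunc_cvg iv z1).
have gz := gam_derive_neq0 hGamma Gg (ltW z1).
have FF : Filter (\oo : set_system nat) by exact: _.
have Nh : N (herg v z) = N (phi z) by rewrite phiE // NM c1 mul1r.
have p0 : 0 < N (phi z) by rewrite N_gt0 (phi_neq0 c1 phiE).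
have : N (phi (g z) / derive1 g z) / N (phi z) <= 1.
  by rewrite -Nh; apply: (ler_cvg_to (L1 FF FF) (cvg_cst (1 : R))); exact: nearW.
by rewrite ler_pdivrMr // mul1r NM NV ler_pdivrMr // N_gt0.
Qed.

Lemma phi_gam_eq g z : Gamma g -> N z < 1 ->
  N (phi (g z)) = N (phi z) * N (derive1 g z).
Proof.
move=> Gg z1; apply: le_anti; rewrite phi_gam_le //=.
have gz1 := gam_disk1 hGamma Gg z1.
have [h Gh hg] := fuchsian_inv hGamma Gg.
have [E1 E2] := gam_comp hGamma Gh Gg (fuchsian_id hGamma)
  (fun z dz => esym (hg z dz)) (ltW z1).
have := phi_gam_le Gh gz1; rewrite -E1 => /(ler_wpM2r (N_ge0 (derive1 g z))).
move=> /le_trans; apply; rewrite -mulrA -NM -E2.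
rewrite derive1E; have -> : 'D_1 (id : C -> C) z = 1 by exact: derive_id.
by rewrite N1 mulr1.
Qed.

(** The quotient of phi(g z) by phi(z) g'(z) turns out to be constant in z; the origin is merely a
    base point. *)
Definition chi (g : C -> C) : C := phi (g 0) / (phi 0 * derive1 g 0).

Lemma phi_cocycle g z : Gamma g -> N z < 1 ->
  phi (g z) = chi g * phi z * derive1 g z.
Proof.
move=> Gg z1; have [B [dw [Sw _]]] := gam_inv_derive Gg.
have [dp Sp] := smooth_phi iv phiE.
have Spg := smooth_comp Sp (gam_smooth hGamma Gg) (fun r r01 => gam_disk hGamma Gg r01).
have ivN : mu.-integrable J (EFin \o (fun t => - v t)).
  by have := integrableJZ (-1) iv; apply: eq_integrable => // t _; rewrite /= mulN1r.
(* Smoothness of 1 / phi comes for free: up to a constant it is the outer function with data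
   [- v]. *)
have Sh := smooth_scal c^-1 (smooth_herg ivN).
have c0 : c != 0 by rewrite -N_gt0 c1.
have Einv x : N x < 1 -> c^-1 * herg (fun t => - v t) x = (phi x)^-1.
  move=> x1; have h := hergN iv x1; have h0 := herg_neq0 v x.
  by rewrite phiE // invfM; congr (_ * _); apply: (mulfI h0); rewrite h mulfV.
have := smooth_unimodular_cst (smooth_mul (smooth_mul Spg Sw) Sh).
have N0' : N (0 : C) < 1 by rewrite N0.
have gd x : N x < 1 -> derive1 g x != 0.
  by move=> x1; rewrite (gam_derive_neq0 hGamma Gg (ltW x1)).
have ph x : N x < 1 -> phi x != 0 := @phi_neq0 R phi c v c1 phiE x.
move=> /(_ _ z z1) q; have {q} := q _.
have h1 x : N x < 1 -> N ((phi \o g) x * (derive1 g x)^-1 * (c^-1 * herg (fun t => - v t) x)) = 1.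
  move=> x1; rewrite Einv // !NM !NV phi_gam_eq // mulfK ?mulfV // N_eq0 ?gd ?ph //.
move=> /(_ h1); rewrite !Einv //= => E.
have -> : chi g = phi (g z) * (derive1 g z)^-1 * (phi z)^-1.
  by rewrite E /chi invfM; ring.
by rewrite mulfVK ?ph // mulfVK // gd.
Qed.

Lemma N_chi g : Gamma g -> N (chi g) = 1.
Proof.
move=> Gg; have z1 : N (0 : C) < 1 by rewrite N0.
rewrite /chi NM NV NM phi_gam_eq // divff // mulf_neq0 // N_eq0.
  exact: (phi_neq0 c1 phiE z1).
exact: (gam_derive_neq0 hGamma Gg (ltW z1)).
Qed.

Lemma chi_mul g h k : Gamma g -> Gamma h -> Gamma k ->
  (forall z, disk z -> k z = g (h z)) -> chi k = chi g * chi h.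
Proof.
move=> Gg Gh Gk E; have z1 : N (0 : C) < 1 by rewrite N0.
have [E1 E2] := gam_comp hGamma Gg Gh Gk E (ltW z1).
have h1 := gam_disk1 hGamma Gh z1.
have kd := gam_derive_neq0 hGamma Gk (ltW z1).
have ph := phi_neq0 c1 phiE z1.
rewrite [LHS]/chi E1 phi_cocycle // phi_cocycle // E2; move: kd ph; rewrite E2.
move: (chi g) (chi h) (phi 0) (derive1 g (h 0)) (derive1 h 0) => a b p x y.
by rewrite mulf_eq0 negb_or => /andP[x0 y0] p0; field; rewrite p0 x0 y0.
Qed.

End Cocycle.

(** * Behaviour at t0 and square means *)

Section RadialEstimates.
Context {R : realType}.
Local Notation C := R[i].
Local Notation N := (@modulus R).
Local Notation Re := (@complex.Re R).
Local Notation mu := (@lebesgue_measure R).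
Local Notation J := (`[0, 2 * pi]%classic : set R).

Lemma N_radial (t : C) r : N t = 1 -> 0 < r -> N (r%:C%C * t) = r.
Proof. by move=> t1 r0; rewrite NM NR t1 mulr1 gtr0_norm. Qed.

Lemma N_radialB (t : C) r : N t = 1 -> r < 1 -> N (t - r%:C%C * t) = 1 - r.
Proof.
move=> t1 r1; rewrite -{1}[t]mul1r -mulrBl NM t1 mulr1.
by rewrite -(rmorph1 (real_complex R)) -rmorphB NR gtr0_norm ?subr_gt0.
Qed.

(** On the radius |t - z| = 1 - |z|, so every aperture larger than 1 contains it; 2 is one such
    choice. *)
Lemma stolz_radial (t : C) : N t = 1 ->
  (fun r : R => r%:C%C * t) @ (1 : R)^'- `=>` stolz t 2.
Proof.
move=> t1 A HA.
have L : r%:C%C * t @[r --> (1 : R)^'-] --> t.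
  apply/cvgCP => e e0; apply: filterS (near_left_range e0) => r /andP[r1 r2].
  by rewrite N_radialB //; lra.
have HA' : ((1 : R)^'-) (fun r : R => (disk (r%:C%C * t) /\
    `|t - r%:C%C * t| < 2%:C%C * (1 - `|r%:C%C * t|)) -> A (r%:C%C * t)) := L _ HA.
have FF : Filter ((1 : R)^'-) by exact: _.
apply: (@filterS _ _ FF _ ((fun r : R => r%:C%C * t) @^-1` A) _
  (filterI HA' (near_left_range (@ltr01 R)))) => r [h /andP[r0 r1]]; rewrite subrr in r0; apply: h; split.
  by rewrite diskE N_radial.
rewrite !normE N_radial // N_radialB //.
rewrite -(rmorph1 (real_complex R)) -rmorphB -rmorphM ltcR.
lra.
Qed.

Lemma inner_radial (f : C -> C) : inner f -> aeJ (fun t =>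
  N (f (r%:C%C * expi t)) @[r --> (1 : R)^'-] --> (1 : R)).
Proof.
move=> [_ _]; apply: (@filterS _ _ (@ae_filter_lebesgue R)) => t H t02.
have /H[l L /(congr1 Re)] : t \in `[0, 2 * pi] by rewrite in_itv.
rewrite normE => l1.
have l1' : N l = 1 := l1.
have Lr : f (r%:C%C * expi t) @[r --> (1 : R)^'-] --> l.
  by move=> A /(L 2) /(stolz_radial (N_expi t)).
by have := cvg_modulus Lr; rewrite l1'; exact.
Qed.

(** The remainder quotient tends to 0, hence is eventually at most 1, and the linear term
    contributes [N l1]. *)
Lemma expansion_radial (f : C -> C) (t l0 l1 : C) : N t = 1 ->
  nontangential_expansion f t l0 l1 ->
  exists K, \forall r \near (1 : R)^'-, N (f (r%:C%C * t) - l0) <= K * (1 - r).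
Proof.
move=> t1 /(_ 2) H; exists (1 + N l1).
have Hr : (f (r%:C%C * t) - (l0 + l1 * (r%:C%C * t - t))) / (r%:C%C * t - t)
    @[r --> (1 : R)^'-] --> (0 : C).
  by move=> A /H /(stolz_radial t1).
have FF : Filter ((1 : R)^'-) by exact: _.
have /(_ FF 1 ltr01) Hn := (cvgCP _ _).1 Hr.
apply: filterS (filterI Hn (near_left_range (@ltr01 R))) => r [h /andP[r0 r1]]; rewrite subrr in r0.
set z := r%:C%C * t in h *.
have zt : N (z - t) = 1 - r by rewrite Ndist N_radialB.
have p : 0 < 1 - r by rewrite subr_gt0.
move: h; rewrite sub0r NN NM NV zt ltr_pdivrMr // mul1r => h.
have -> : f z - l0 = f z - (l0 + l1 * (z - t)) + l1 * (z - t) by ring.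
apply: le_trans (ND _ _) _; rewrite NM zt mulrDl mul1r lerD2r; exact: ltW.
Qed.

Lemma dist_circle_radial (t : C) r x : N t = 1 ->
  N (r%:C%C * expi x - t) = N (expi x - r%:C%C * t).
Proof.
move=> t1; apply/eqP; rewrite -(@eqrXn2 _ 2) ?N_ge0 //; apply/eqP.
have := N_expi x; have := congr1 (fun y => y ^+ 2) t1; rewrite !Nsq expr1n => h1.
move=> /(congr1 (fun y => y ^+ 2)); rewrite Nsq expr1n => h2.
rewrite !cReB !cImB; move: h1 h2; rewrite /expi; case: t {t1} => a b /= h1 h2.
simpc => /=.
have -> : (r * cos x - a) ^+ 2 + (r * sin x - b) ^+ 2 = (cos x - r * a) ^+ 2 +
   (sin x - r * b) ^+ 2 + (r ^+ 2 - 1) * ((cos x ^+ 2 + sin x ^+ 2) - (a ^+ 2 + b ^+ 2)).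
  by ring.
by rewrite h1 h2 subrr mulr0 addr0.
Qed.

(* |f - 1|^2 <= 2 (1 - Re f) since |f| <= 1, and |r x - t| = |x - r t| for |x| = 1
   makes |r x - t|^-2 a multiple of the Poisson kernel at r t. *)
Lemma hardy2_quotient (f df : C -> C) (t : C) (K : R) : smooth f df -> N t = 1 ->
  (forall z, N z < 1 -> N (f z) <= 1) ->
  (\forall r \near (1 : R)^'-, N (f (r%:C%C * t) - 1) <= K * (1 - r)) ->
  hardy2 (fun z => (f z - 1) / (z - t)).
Proof.
move=> F t1 f1 /at_left1P[d d0 HK].
have SI : smooth (fun z => (t - z)^-1) (fun z => (t - z) ^- 2).
  by move=> r r01; eexists; exact: (qd_kern r01 t1).
have [dh Sh] : exists dh, smooth (fun z => (f z - 1) / (z - t)) dh.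
  eexists; apply: smooth_ext (smooth_scal (-1) (smooth_mul
    (smooth_add F (smooth_cst (-1))) SI)) => [z _|//].
  by rewrite /= -[z - t]opprB invrN mulN1r mulrN.
split; first exact: smooth_analytic Sh.
have pi0 : 0 < pi :> R := pi_gt0 R.
(* The Poisson formula evaluates 1 - Re f at [r ^+ 2 * t]. There it is at most [K * (1 - r ^+ 2)]
   when this point is within [d] of [t]; elsewhere the trivial bound 2 is at most
   [2 / d * (1 - r ^+ 2)]. *)
exists (2 * (2 * pi * (K + 2 / d))) => r /[dup] r01 /andP[r0 r1].
have q0 : 0 < 1 - r ^+ 2 by rewrite subr_gt0 exprn_ilt1.
have w1 : N (r%:C%C * t) < 1 by rewrite NM NR t1 mulr1 ger0_norm.
have ch := smooth_continuous_circle Sh r01.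
have cN : continuous (fun x => N ((f (r%:C%C * expi x) - 1) / (r%:C%C * expi x - t)) ^+ 2).
  move=> x; have c := cvg_modulus (ch x); exact: (cvgM (c _) (c _)).
have cf := smooth_continuous_circle F r01.
have cp := continuous_pk w1.
have cRf : continuous (fun x => 1 - Re (f (r%:C%C * expi x))).
  move=> x; apply: cvgB; [exact: cvg_cst|exact: (cvg_Re (cf x))].
have cfp : continuous (fun x => 2 / (1 - r ^+ 2) *
    ((1 - Re (f (r%:C%C * expi x))) * pk (r%:C%C * t) x)).
  by move=> x; apply: cvgM; [exact: cvg_cst|exact: (cvgM (cRf x) (cp x))].
rewrite -[X in (X <= _)%E]fineK; last first.
  by apply: integrable_fin_num; [exact: measurableJ|exact: (integrableJ cN)].
rewrite lee_fin; apply: (@le_trans _ _ (\int[mu]_(x in J) (2 / (1 - r ^+ 2) *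
    ((1 - Re (f (r%:C%C * expi x))) * pk (r%:C%C * t) x)))).
  apply: (le_Rintegral measurableJ) => [||x _].
  - exact: (integrableJ cN).
  - exact: (integrableJ cfp).
  have x1 : N (r%:C%C * expi x) < 1 by rewrite NM NR N_expi mulr1 ger0_norm.
  rewrite NM NV dist_circle_radial // exprMn exprVn /pk NM NR t1 mulr1 real_normK ?num_real //.
  have -> u w : 2 / (1 - r ^+ 2) * (u * ((1 - r ^+ 2) / w)) = 2 * u / w :> R.
    by move: w^-1 => w'; field; rewrite gt_eqF.
  rewrite ler_wpM2r ?invr_ge0 ?sqr_ge0 //.
  have : N (f (r%:C%C * expi x)) ^+ 2 <= 1 by rewrite exprn_ile1 ?N_ge0 // f1.
  by rewrite !Nsq cReB cImB /=; case: (f _) => a b /=; nra.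
rewrite RintegralZl //; last first.
  by apply: integrableJ => x; exact: (cvgM (cRf x) (cp x)).
have S1f := smooth_add (smooth_cst 1) (smooth_scal (-1) F).
have /(congr1 Re) := poisson_circle S1f r01 w1.
rewrite cReZ /cint /= => E.
have -> : \int[mu]_(x in J) ((1 - Re (f (r%:C%C * expi x))) * pk (r%:C%C * t) x) =
    (1 - Re (f (r%:C%C * (r%:C%C * t)))) * (2 * pi).
  have h z : Re (1 + -1 * f z) = 1 - Re (f z) by rewrite mulN1r cReB.
  rewrite -h -E; apply: eq_Rintegral => x _; rewrite -h; case: (1 + _ * _) => a b /=.
  by rewrite mulr0 subr0.
rewrite mulrA -rmorphM -expr2.
set s := r ^+ 2.
have s0 : 0 <= s by rewrite sqr_ge0.
have s1 : s < 1 by rewrite -subr_gt0.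
have sz : N (s%:C%C * t) < 1 by rewrite NM NR t1 mulr1 ger0_norm.
suff H : 1 - Re (f (s%:C%C * t)) <= (K + 2 / d) * (1 - s).
  have -> X : 2 / (1 - s) * (X * (2 * pi)) = 2 * (2 * pi * (X / (1 - s))).
    by move: (1 - s)^-1 => u; ring.
  by rewrite ler_wpM2l // ler_wpM2l ?ler_pdivrMr // mulr_ge0 ?ltW.
have K0 : 0 <= K.
  have e0 : 0 < Num.min d 1 / 2 by rewrite divr_gt0 // lt_min d0 ltr01.
  have := HK (1 - Num.min d 1 / 2); rewrite opprB addrCA subrr addr0.
  have md : Num.min d 1 / 2 < d.
    by rewrite ltr_pdivrMr // (le_lt_trans (_ : _ <= d)) ?ge_min ?lexx //; lra.
  move=> h; have {h} := le_trans (N_ge0 _) (h _).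
  rewrite pmulr_lge0 //; apply; rewrite ltrD2l ltrN2 md /=; lra.
have d2 : 0 <= 2 / d by rewrite divr_ge0 // ltW.
rewrite mulrDl; have [sd|sd] := ltP (1 - d) s.
  have : 1 - Re (f (s%:C%C * t)) <= N (f (s%:C%C * t) - 1).
    apply: le_trans (ReN _); rewrite cReB /= -normrN opprB; exact: ler_norm.
  move=> /le_trans; apply; apply: le_trans (HK _ _) _; first by rewrite sd s1.
  by rewrite lerDl mulr_ge0 // subr_ge0 ltW.
have h1 : 1 - Re (f (s%:C%C * t)) <= 2.
  have := le_trans (ReN _) (f1 _ sz); rewrite ler_norml => /andP[]; lra.
apply: le_trans h1 _; apply: (@le_trans _ _ (2 / d * (1 - s))).
  by rewrite mulrAC ler_pdivlMr // ler_wpM2l //; lra.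
by rewrite lerDr mulr_ge0 // subr_ge0 ltW.
Qed.

End RadialEstimates.

(** * Separating the identity term from the series *)

Section IdentityTerm.
Context {R : realType} (Gamma : set (R[i] -> R[i])) (t0 : R[i]).
Context (hGamma : fuchsian Gamma) (t01 : modulus t0 = 1).
Context (hsum : (\esum_(gamma in Gamma) (modulus (derive1 gamma t0))%:E < +oo)%E).
Local Notation C := R[i].
Local Notation N := (@modulus R).

(** Since [b id = 1], the identity contributes exactly [(t0 - z) ^- 2]; the other coefficients are
    unimodular, so the remaining terms have the absolute values summed in the hypothesis. *)
Lemma pser_sub_id b z (W : R) : charlike Gamma b -> b id = 1 -> N z < 1 ->
  (\esum_(gamma in Gamma `\ id)
     (N (derive1 gamma t0) / N (gamma t0 - z) ^+ 2)%:E <= W%:E)%E ->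
  N (pser Gamma t0 b z - (t0 - z) ^- 2) <= W.
Proof.
move=> b1 bid z1 HW.
pose f (h : C -> C) : R := N (derive1 h t0) / N (h t0 - z) ^+ 2.
have f0 h : 0 <= f h by rewrite /f divr_ge0 ?N_ge0 ?sqr_ge0.
pose w (g : Gamma) := if val g \in Gamma `\ id then f (val g) else 0.
have bw : bsum w W.
  split=> [g|F]; first by rewrite /w; case: ifP.
  by rewrite -lee_fin; apply: le_trans HW; exact: esum_fset_le.
pose i0 : Gamma := exist _ id (mem_set (fuchsian_id hGamma)).
pose a2 (g : Gamma) := if g \in [fset i0]%fset then pterm t0 b g z else 0.
have da := dominated_pser hGamma t01 hsum b1 z1.
have da2 : dominated a2.
  have [w' [W' [bw' aw']]] := da; exists w', W'; split=> // g.
  by rewrite /a2; case: ifP => _; [exact: aw'|rewrite N0; case: bw'].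
have <- : csum a2 = (t0 - z) ^- 2.
  rewrite csum_finite big_seq_fset1 /pterm /tau /= bid mul1r.
  have -> : derive1 (id : C -> C) t0 = 1 by rewrite derive1E; exact: derive_id.
  by rewrite mul1r.
rewrite -[W]mul1r -csumB //; apply: (csum_le bw ler01) => g; rewrite mul1r /a2 /w.
case: ifPn => [|gi]; first by rewrite subrr N0; case: ifP.
have -> : val g \in Gamma `\ id.
  apply/mem_set; split; first exact: mem_val.
  by move=> /= h; case/negP: gi; rewrite inE; apply/eqP/val_inj.
by rewrite subr0 /pterm !NM NV NX b1 ?mul1r //; exact: mem_val.
Qed.

End IdentityTerm.

(** * Radial behaviour at t0 and the automorphic function *)

Section Conclusion.
Context {R : realType} (Gamma : set (R[i] -> R[i])) (t0 : R[i]).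
Context (hGamma : fuchsian Gamma) (t01 : modulus t0 = 1).
Context (hsum : (\esum_(gamma in Gamma) (modulus (derive1 gamma t0))%:E < +oo)%E).
Context (Delta phi : R[i] -> R[i]) (Delta_t0 Delta'_t0 c : R[i]) (v : R -> R).
Local Notation C := R[i].
Local Notation N := (@modulus R).
Local Notation mu := (@lebesgue_measure R).
Local Notation J := (`[0, 2 * pi]%classic : set R).
Local Notation S1 := (pser Gamma t0 (fun=> 1)).
Context (inn : inner Delta).
Context (c1 : N c = 1) (iv : mu.-integrable J (EFin \o v)).
Context (phiE : forall z, N z < 1 -> phi z = c * herg v z).
Context (phi4 : forall z, N z < 1 -> N (phi z) <= 4).
Context (DeltaE : forall z, N z < 1 -> 'i%C * t0 * phi z * S1 z = Delta z).
Context (hDelta_t0 : N Delta_t0 = 1).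
Context (hDelta' : nontangential_expansion Delta t0 Delta_t0 Delta'_t0).
Context (ho : forall M : R,
      ((modulus (t0 - z))%:E *
         \esum_(gamma in Gamma `\ id)
           (modulus (derive1 gamma t0) / modulus (gamma t0 - z) ^+ 2)%:E)%E
        @[z --> stolz t0 M] --> 0%E).
Local Notation chi := (chi phi).

Let Delta1 z : N z < 1 -> N (Delta z) <= 1.
Proof.
case: inn => _ h _; rewrite -diskE => /h; exact: N_le1.
Qed.

Let phiS z : N z < 1 -> N (phi z) * N (S1 z) <= 1.
Proof.
move=> z1; have := Delta1 z1; rewrite -DeltaE // !NM Ni t01 !mul1r; exact.
Qed.

(** On the radius |t0 - z| is [1 - r], and a quantity tending to 0 is eventually below 1. *)
Lemma esum_radial : \forall r \near (1 : R)^'-,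
  (\esum_(gamma in Gamma `\ id)
     (N (derive1 gamma t0) / N (gamma t0 - r%:C%C * t0) ^+ 2)%:E <= ((1 - r)^-1)%:E)%E.
Proof.
have H : ((1 : R)^'-) (fun r => (N (t0 - r%:C%C * t0))%:E *
    (\esum_(gamma in Gamma `\ id)
     (N (derive1 gamma t0) / N (gamma t0 - r%:C%C * t0) ^+ 2)%:E) < 1%:E)%E.
  have lt01 : (0%E < 1%:E :> \bar R)%E by rewrite lte_fin.
  exact: (stolz_radial t01 (ho 2 (open_ereal_lt' lt01))).
have FF : Filter ((1 : R)^'-) by exact: _.
apply: filterS (filterI H (near_left_range (@ltr01 R))) => r [h /andP[_ r1]].
move: h; rewrite N_radialB // => /ltW h.
by rewrite -[leRHS]mule1 lee_pdivlMl ?subr_gt0.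
Qed.

(* On the radius towards t0 every series is dominated by its term (t0 - z)^-2
   at the identity, up to an error of relative order 1 - r; hence twisting the
   coefficients by a character moves Delta = i t0 phi S1 by O(1 - r) only. *)
Lemma twist_radial b : charlike Gamma b -> b id = 1 -> exists K,
  \forall r \near (1 : R)^'-,
    N (Delta_t0^-1 * ('i%C * t0) * (phi (r%:C%C * t0) * pser Gamma t0 b (r%:C%C * t0)) - 1)
      <= K * (1 - r).
Proof.
(* [K] comes from the expansion of [Delta]; 4 is the product of |phi| <= 2 (1 - r)^2 with two series
   errors of size 1 / (1 - r). *)
move=> b1 bid; have [K HK] := expansion_radial t01 hDelta'; exists (K + 4).
have FF : Filter ((1 : R)^'-) by exact: _.
have half : 0 < 2^-1 :> R by rewrite invr_gt0.
apply: filterS (filterI (filterI HK esum_radial) (near_left_range half)).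
move=> r [[hD he] /andP[r2 r1]].
have p0 : 0 < 1 - r by rewrite subr_gt0.
have r0 : 0 < r by lra.
set z := r%:C%C * t0 in hD he *.
have z1 : N z < 1 by rewrite N_radial.
have one1 : charlike Gamma (fun=> 1 : C) by move=> ? _; exact: N1.
have eb := pser_sub_id hGamma t01 hsum b1 bid z1 he.
have e1 := pser_sub_id hGamma t01 hsum one1 erefl z1 he.
have NT : N ((t0 - z) ^- 2) = (1 - r) ^- 2 by rewrite NV NX N_radialB.
(* For [r] above 1/2 the error [(1 - r)^-1] is at most half of the main term [(1 - r) ^- 2]. *)
have lower : (1 - r) ^- 2 / 2 <= N (S1 z).
  have := ND (S1 z) (- (S1 z - (t0 - z) ^- 2)); rewrite opprB addrCA subrr addr0.
  rewrite -opprB NN NT => h.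
  have -> : (1 - r) ^- 2 / 2 = (1 - r) ^- 2 - (1 - r) ^- 2 / 2.
    by move: ((1 - r) ^- 2) => u; lra.
  rewrite lerBlDr; apply: le_trans h _; rewrite lerD2l; apply: le_trans e1 _.
  rewrite -exprVn expr2 -mulrA ler_peMr ?invr_ge0 ?(ltW p0) //.
  by rewrite ler_pdivlMr // mul1r -div1r ler_pdivlMr //; lra.
have phi2 : N (phi z) <= 2 * (1 - r) ^+ 2.
  have h := le_trans (ler_wpM2l (N_ge0 (phi z)) lower) (phiS z1).
  move: h; rewrite -exprVn => h.
  have q0 : 0 < (1 - r) ^+ 2 by rewrite exprn_gt0.
  by move: h; rewrite exprVn mulrA ler_pdivrMr // mul1r ler_pdivrMr.
have D0 : Delta_t0 != 0 by rewrite -N_gt0 hDelta_t0.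
(* The common term [(t0 - z) ^- 2] cancels between the twisted and the untwisted series, so only
   their errors meet the small factor phi. *)
have -> : Delta_t0^-1 * ('i%C * t0) * (phi z * pser Gamma t0 b z) - 1 =
    Delta_t0^-1 * (Delta z - Delta_t0 + 'i%C * t0 * phi z *
      ((pser Gamma t0 b z - (t0 - z) ^- 2) - (S1 z - (t0 - z) ^- 2))).
  rewrite -DeltaE //; move: ((t0 - z) ^- 2) (S1 z) (pser _ _ _ _) => x y w.
  by field.
rewrite NM NV hDelta_t0 invr1 mul1r mulrDl; apply: le_trans (ND _ _) _.
rewrite lerD // !NM Ni t01 !mul1r.
apply: (@le_trans _ _ (2 * (1 - r) ^+ 2 * ((1 - r)^-1 + (1 - r)^-1))).
  by rewrite ler_pM ?N_ge0 // (le_trans (NB _ _)) // lerD.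
by rewrite le_eqVlt; apply/orP; left; apply/eqP; field; rewrite gt_eqF.
Qed.

Lemma exists_automorphic alpha : unitary_character Gamma alpha ->
  exists g : C -> C, automorphic Gamma alpha g /\
    exists2 h : C -> C, hardy2 h & forall z, disk z -> g z = 1 + (z - t0) * h z.
Proof.
move=> [alpha1 alphaM].
have DR := inner_radial inn.
pose b g := alpha g / chi g.
have chi1 g : Gamma g -> N (chi g) = 1.
  exact: (N_chi hGamma t01 hsum c1 iv phiE phi4 DeltaE Delta1 DR).
have chi0 g : Gamma g -> chi g != 0 by move=> Gg; rewrite -N_gt0 chi1.
have b1 : charlike Gamma b.
  by move=> g Gg; rewrite NM NV chi1 // (N_eq1 (alpha1 g Gg)) divr1.
have bM g h k : Gamma g -> Gamma h -> Gamma k ->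
    (forall z, disk z -> k z = g (h z)) -> b k = b g * b h.
  move=> Gg Gh Gk E; rewrite /b (alphaM g h k Gg Gh Gk E).
  rewrite (chi_mul hGamma t01 hsum c1 iv phiE phi4 DeltaE Delta1 DR Gg Gh Gk E).
  by rewrite invfM mulrACA.
have Gid := fuchsian_id hGamma.
have bid : b id = 1.
  have b0 : b id != 0 by rewrite -N_gt0 b1.
  by apply: (mulfI b0); rewrite mulr1 -(bM id id id).
have [ds Sb] := smooth_pser hGamma t01 hsum b1.
have [dp Sp] := smooth_phi iv phiE.
pose g z := Delta_t0^-1 * ('i%C * t0) * (phi z * pser Gamma t0 b z).
have Sg := smooth_scal (Delta_t0^-1 * ('i%C * t0)) (smooth_mul Sp Sb).
have g1 z : N z < 1 -> N (g z) <= 1.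
  move=> z1; rewrite /g NM [N (_^-1 * _)]NM NV hDelta_t0 [N ('i%C * _)]NM Ni t01.
  rewrite invr1 !mul1r NM.
  exact: (phi_pser_le1 hGamma t01 hsum c1 iv phiE phi4 phiS b1 z1).
have [K HK] := twist_radial b1 bid.
exists g; split.
  split; first exact: smooth_analytic Sg.
  move=> d z Gd; rewrite diskE => z1; rewrite /g.
  have h1 := phi_cocycle hGamma t01 hsum c1 iv phiE phi4 DeltaE Delta1 DR Gd z1.
  have h2 := pser_automorphic hGamma t01 hsum b1 bM Gd z1.
  (* [phi] picks up the factor d'(z) and the series its inverse, so that only [chi d * b d], which
     is [alpha d], remains. *)
  have -> : phi (d z) * pser Gamma t0 b (d z) = alpha d * (phi z * pser Gamma t0 b z).
    have -> : alpha d = chi d * b d by rewrite mulrC /b mulfVK ?chi0.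
    rewrite h1; transitivity (chi d * phi z * (pser Gamma t0 b (d z) * derive1 d z)).
      by ring.
    by rewrite h2; ring.
  by rewrite mulrCA.
exists (fun z => (g z - 1) / (z - t0)).
  exact: (hardy2_quotient Sg t01 g1 HK).
move=> z; rewrite diskE => z1.
have zt : z - t0 != 0 by rewrite subr_eq0; apply/eqP => E; rewrite E t01 ltxx in z1.
by rewrite mulrC mulfVK // addrC subrK.
Qed.

End Conclusion.

Theorem corollary4p3 (R : realType) (Gamma : set (R[i] -> R[i])) (t0 : R[i])
    (Delta : R[i] -> R[i]) (Delta_t0 Delta'_t0 : R[i])
    (hGamma : fuchsian Gamma)
    (ht0 : `|t0| = 1)
    (hsum : (\esum_(gamma in Gamma) (modulus (derive1 gamma t0))%:E < +oo)%E)
    (hbc : bounded_characteristic (derive1 (martin Gamma t0)))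
    (hDelta : martin_inner_factor Gamma t0 Delta)
    (hDelta_t0 : `|Delta_t0| = 1)
    (hDelta' : nontangential_expansion Delta t0 Delta_t0 Delta'_t0)
    (ho : forall M : R,
      ((modulus (t0 - z))%:E *
         \esum_(gamma in Gamma `\ id)
           (modulus (derive1 gamma t0) / modulus (gamma t0 - z) ^+ 2)%:E)%E
        @[z --> stolz t0 M] --> 0%E) :
  forall alpha : (R[i] -> R[i]) -> R[i], unitary_character Gamma alpha ->
  exists g : R[i] -> R[i], automorphic Gamma alpha g /\
    exists2 h : R[i] -> R[i], hardy2 h &
      forall z, disk z -> g z = 1 + (z - t0) * h z.
Proof.
have t01 := N_eq1 ht0.
have [inn [phi [[c [k [hc _ ik Ephi]]] phi4 dm]]] := hDelta.
have c1 := N_eq1 hc.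
have phiE z : modulus z < 1 -> phi z = c * herg (fun t => ln (k t)) z.
  by rewrite -diskE => /Ephi.
have phi4' z : modulus z < 1 -> modulus (phi z) <= 4.
  rewrite -diskE => /phi4; rewrite normE -(rmorph_nat (real_complex R)).
  by rewrite lecR.
have DeltaE z : modulus z < 1 ->
    'i%C * t0 * phi z * pser Gamma t0 (fun=> 1) z = Delta z.
  move=> z1; have dz : disk z by rewrite diskE.
  have := dm z dz; rewrite (derive1_martin hGamma t01 hsum z1) => /(congr1 ( *%R (phi z))).
  rewrite [RHS]mulrC divfK ?(phi_neq0 c1 phiE) // => <-.
  by ring.
exact: (exists_automorphic hGamma t01 hsum inn c1 ik phiE phi4' DeltaE (N_eq1 hDelta_t0)
  hDelta' ho).
Qed.
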